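(* Let $A$ be an artinian algebra and $n\geq 1$ an integer. 1. The poset of $\omega_n$-torsion pairs of $\operatorname{mod} A$ is a complete sublattice of the lattice of all torsion pairs (equivalently, of torsion classes) of $\operatorname{mod} A$. 2. If $A$ has finite global dimension $d$ and $\operatorname{mod} A$ is viewed as an abelian category with $\operatorname{Ext}^{-1}$-structure given by $\operatorname{Ext}^{-1}(X,Y)=\operatorname{Ext}^{d}_A(X,Y)$, then the poset of $s$-torsion pairs is a complete sublattice of the lattice of torsion pairs of $\operatorname{mod} A$. 3. The lattice of $\omega_n$-torsion pairs of $\operatorname{mod} A$ is a completely semidistributive lattice. 4. If $A$ is $\tau$-tilting finite, the lattice of $\omega_n$-torsion pairs of $\operatorname{mod} A$ is a congruence uniform lattice.
   Context: An artinian algebra (Artin algebra) is an algebra that is finitely generated as a module over a commutative artinian ring (e.g. a finite dimensional algebra over a field). $\operatorname{mod} A$ denotes the category of finitely generated right $A$-modules. Subcategories are full and closed under isomorphisms. A torsion pair of $\operatorname{mod} A$ is a pair $(\mathcal{T},\mathcal{F})$ of subcategories such that (1) $\operatorname{Hom}_A(T,F)=0$ for all $T\in\mathcal{T}$, $F\in\mathcal{F}$; (2) for every $X\in\operatorname{mod} A$ there is a short exact sequence $0\to t(X)\to X\to f(X)\to 0$ with $t(X)\in\mathcal{T}$ and $f(X)\in\mathcal{F}$. Then $\mathcal{T}$ is called a torsion class and $\mathcal{F}$ a torsion-free class. Torsion pairs are ordered by $(\mathcal{T}_1,\mathcal{F}_1)\leq(\mathcal{T}_2,\mathcal{F}_2)$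 if and only if $\mathcal{T}_1\subseteq\mathcal{T}_2$ (equivalently $\mathcal{F}_2\subseteq\mathcal{F}_1$), and they form a complete lattice: the meet of a family has torsion class $\bigcap_i\mathcal{T}_i$ and the join has torsion-free class $\bigcap_i\mathcal{F}_i$. An $\omega_n$-torsion pair of $\operatorname{mod} A$ is a torsion pair $(\mathcal{T},\mathcal{F})$ such that $\operatorname{Ext}^n_A(T,F)=0$ for all $T\in\mathcal{T}$, $F\in\mathcal{F}$; the set of $\omega_n$-torsion pairs carries the induced order. In the setting of item 2, an $s$-torsion pair is a torsion pair $(\mathcal{T},\mathcal{F})$ of $\operatorname{mod} A$ such that $\operatorname{Ext}^{-1}(T,F)=0$ for all $T\in\mathcal{T}$, $F\in\mathcal{F}$. A complete sublattice of a complete lattice is a subset closed under arbitrary meets and joins. A complete lattice $L$ is completely semidistributive if for every $x,z\in L$ and every nonempty family $(y_i)_{i}$ in $L$: $x\wedge y_i=z$ for all $i$ implies $x\wedge\bigvee_i y_i=z$, and $x\vee y_i=z$ for all $i$ implies $x\vee\bigwedge_i y_i=z$. An Artin algebra $A$ is $\tau$-tilting finite if it has finitely many isomorphism classes of indecomposable $\tau$-rigid modules (modules $M$ with $\operatorname{Hom}_A(M,\tau M)=0$, $\tau$ the Auslander–Reiten translation); equivalently $\operatorname{mod} A$ has finitely many torsion classes. A finite lattice $L$ is congruence uniform if the map sending a join-irreducible $j$ (with unique lower cover $j_*$) to the smallest congruence identifying $j$ and $j_*$ is a bijection from join-irreducible elements of $L$ to join-irreducible elements of its congruence lattice, and the dual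 map on meet-irreducible elements $m$ (using the unique upper cover $m^*$) is a bijection from meet-irreducible elements of $L$ to join-irreducible congruences. *)

(* Defs.v *)
From HB Require Import structures.
From mathcomp Require Import all_boot all_algebra.

Set Implicit Arguments.
Unset Strict Implicit.
Unset Printing Implicit Defensive.

Import GRing.Theory.
Local Open Scope ring_scope.

(** * Complete lattices, semidistributivity, congruence uniformity *)

(* Subsets are Prop-valued predicates.  Families [(y_i)_i] are represented by
   their ranges: meets and joins only depend on those. *)

Section Orders.
Variables (L : Type) (le : L -> L -> Prop).

Definition partial_order : Prop :=
  [/\ forall x, le x x,
      forall x y z, le x y -> le y z -> le x z
    & forall x y, le x y -> le y x -> x = y].

Definition is_meet_of (S : L -> Prop) (m : L) : Prop :=
  (forall x, S x -> le m x) /\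
  (forall l, (forall x, S x -> le l x) -> le l m).

Definition is_join_of (S : L -> Prop) (j : L) : Prop :=
  (forall x, S x -> le x j) /\
  (forall u, (forall x, S x -> le x u) -> le j u).

Definition is_meet (x y m : L) : Prop := is_meet_of (fun z => z = x \/ z = y) m.
Definition is_join (x y j : L) : Prop := is_join_of (fun z => z = x \/ z = y) j.

Definition is_lattice : Prop :=
  [/\ partial_order,
      forall x y, exists m, is_meet x y m
    & forall x y, exists j, is_join x y j].

Definition is_complete_lattice : Prop :=
  [/\ partial_order,
      forall S : L -> Prop, exists m, is_meet_of S m
    & forall S : L -> Prop, exists j, is_join_of S j].

Definition is_complete_sublattice (P : L -> Prop) : Prop :=
  is_complete_lattice /\
  forall S : L -> Prop, (forall x, S x -> P x) ->
    (forall m, is_meet_of S m -> P m) /\ (forall j, is_join_of S j -> P j).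

Definition completely_semidistributive : Prop :=
  [/\ is_complete_lattice,
      forall (x z : L) (Y : L -> Prop), (exists y, Y y) ->
        (forall y, Y y -> is_meet x y z) ->
        forall j, is_join_of Y j -> is_meet x j z
    & forall (x z : L) (Y : L -> Prop), (exists y, Y y) ->
        (forall y, Y y -> is_join x y z) ->
        forall m, is_meet_of Y m -> is_join x m z].

Definition is_finite_lattice : Prop :=
  is_lattice /\ exists (n : nat) (s : 'I_n -> L), forall x, exists i, s i = x.

Definition join_irreducible (x : L) : Prop :=
  ~ (forall y, le x y) /\ (forall y z, is_join y z x -> x = y \/ x = z).

Definition meet_irreducible (x : L) : Prop :=
  ~ (forall y, le y x) /\ (forall y z, is_meet y z x -> x = y \/ x = z).

Definition is_covered_by (x y : L) : Prop :=
  [/\ le x y, x <> y & forall z, le x z -> le z y -> z = x \/ z = y].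

Record congruence : Type := Congruence {
  cong :> L -> L -> Prop;
  cong_refl : forall x, cong x x;
  cong_sym : forall x y, cong x y -> cong y x;
  cong_trans : forall x y z, cong x y -> cong y z -> cong x z;
  cong_meet : forall x x' y y' m m', cong x x' -> cong y y' ->
    is_meet x y m -> is_meet x' y' m' -> cong m m';
  cong_join : forall x x' y y' j j', cong x x' -> cong y y' ->
    is_join x y j -> is_join x' y' j' -> cong j j'
}.

Definition cong_le (t u : congruence) : Prop := forall x y, t x y -> u x y.

Definition smallest_congruence_identifying (x y : L) (t : congruence) : Prop :=
  t x y /\ forall u : congruence, u x y -> cong_le t u.

(* The graphs of the maps j |-> con(j_*, j) and m |-> con(m, m^* ). *)
Definition lower_congruence (j : L) (t : congruence) : Prop :=
  exists j_, [/\ is_covered_by j_ j, forall c, is_covered_by c j -> c = j_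
               & smallest_congruence_identifying j_ j t].

Definition upper_congruence (m : L) (t : congruence) : Prop :=
  exists m_, [/\ is_covered_by m m_, forall c, is_covered_by m c -> c = m_
               & smallest_congruence_identifying m m_ t].

End Orders.

Definition is_bijection_between (X Y : Type) (D : X -> Prop) (E : Y -> Prop)
    (G : X -> Y -> Prop) : Prop :=
  [/\ forall x, D x -> exists y, E y /\ (forall y', G x y' <-> y' = y),
      forall x x' y, D x -> D x' -> G x y -> G x' y -> x = x'
    & forall y, E y -> exists x, D x /\ G x y].

Definition congruence_uniform (L : Type) (le : L -> L -> Prop) : Prop :=
  [/\ is_finite_lattice le,
      is_bijection_between (join_irreducible le)
        (join_irreducible (@cong_le L le)) (@lower_congruence L le)
    & is_bijection_between (meet_irreducible le)
        (join_irreducible (@cong_le L le)) (@upper_congruence L le)].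

(** * Modules *)

Section Modules.
Variable R : pzRingType.
Implicit Types M N : lmodType R.

Definition finitely_generated M : Prop :=
  exists (n : nat) (g : 'I_n -> M),
    forall x, exists a : 'I_n -> R, x = \sum_i a i *: g i.

Definition zero_module M : Prop := forall x : M, x = 0.

Definition isomorphic M N : Prop := exists f : {linear M -> N}, bijective f.

Definition zero_hom M N : Prop := forall (f : {linear M -> N}) x, f x = 0.

Definition surjective (X Y : Type) (f : X -> Y) : Prop :=
  forall y, exists x, f x = y.

Definition exact M N (K : lmodType R) (f : {linear M -> N}) (g : {linear N -> K})
  : Prop := forall y, g y = 0 <-> exists x, f x = y.

Definition projective (P : lmodType R) : Prop :=
  forall M N (g : {linear M -> N}) (f : {linear P -> N}), surjective g ->
    exists h : {linear P -> M}, forall x, g (h x) = f x.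

Definition injective_module (E : lmodType R) : Prop :=
  forall M N (i : {linear M -> N}) (f : {linear M -> E}), injective i ->
    exists h : {linear N -> E}, forall x, h (i x) = f x.

Definition indecomposable M : Prop :=
  ~ zero_module M /\
  forall X Y : lmodType R, isomorphic M (X * Y)%type ->
    zero_module X \/ zero_module Y.

End Modules.

(** * Commutative artinian rings and Artin algebras *)

Section CommutativeRings.
Variable k : comPzRingType.

Definition ideal (I : k -> Prop) : Prop :=
  I 0 /\ forall a x y, I x -> I y -> I (a * x + y).

Definition artinian_ring : Prop :=
  forall I : nat -> k -> Prop, (forall i, ideal (I i)) ->
    (forall i x, I i.+1 x -> I i x) ->
    exists m : nat, forall i x, (m <= i)%N -> I m x -> I i x.

Definition maximal_ideal (I : k -> Prop) : Prop :=
  [/\ ideal I, ~ I 1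
    & forall J, ideal J -> ~ J 1 -> (forall x, I x -> J x) ->
        forall x, J x -> I x].

Definition jacobson_radical (x : k) : Prop :=
  forall I, maximal_ideal I -> I x.

(* [i] is the composite of k -> k / rad k with an embedding into [E], which is
   essential: a map out of [E] is injective as soon as it is so on the image. *)
Definition injective_envelope_of_top (E : lmodType k) : Prop :=
  injective_module E /\
  exists i : {linear k^o -> E},
    (forall c, i c = 0 <-> jacobson_radical c) /\
    (forall (X : lmodType k) (g : {linear E -> X}),
       (forall c, g (i c) = 0 -> i c = 0) -> injective g).

Definition artin_algebra (A : algType k) : Prop :=
  artinian_ring /\ finitely_generated (A : lmodType k).

End CommutativeRings.

(** * Finitely generated right modules *)

(* Right A-modules are left modules over the converse ring A^c: the scaling
   [a *: x] is the right action x . a. *)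

Record fgmod (R : pzRingType) : Type := FgMod {
  fgmod_sort :> lmodType R^c;
  fgmodP : finitely_generated fgmod_sort
}.

Section Homological.
Variable R : pzRingType.
Implicit Types X Y : fgmod R.

Record projective_resolution X : Type := ProjectiveResolution {
  pres_obj :> nat -> fgmod R;
  pres_diff : forall i, {linear pres_obj i.+1 -> pres_obj i};
  pres_aug : {linear pres_obj 0%N -> X};
  pres_projective : forall i, projective (pres_obj i);
  pres_aug_surj : surjective pres_aug;
  pres_exact0 : exact (pres_diff 0%N) pres_aug;
  pres_exactS : forall i, exact (pres_diff i.+1) (pres_diff i)
}.

Definition cocycle X Y (P : projective_resolution X) (n : nat)
    (f : {linear P n -> Y}) : Prop :=
  forall x, f (pres_diff P n x) = 0.

Definition coboundary X Y (P : projective_resolution X) (n : nat) :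
    {linear P n -> Y} -> Prop :=
  match n return {linear P n -> Y} -> Prop with
  | 0%N => fun f => forall x, f x = 0
  | m.+1 => fun f =>
      exists g : {linear P m -> Y}, forall x, f x = g (pres_diff P m x)
  end.

(* Ext^n(X, Y) = H^n(Hom(P, Y)) = 0.  Over an Artin algebra every X has such a
   resolution P, and the cohomology does not depend on it. *)
Definition ext_zero (n : nat) X Y : Prop :=
  forall (P : projective_resolution X) (f : {linear P n -> Y}),
    cocycle f -> coboundary f.

Definition projective_dimension_le X (d : nat) : Prop :=
  exists P : projective_resolution X,
    forall i, (d < i)%N -> zero_module (P i).

Definition global_dimension_le (d : nat) : Prop :=
  forall X, projective_dimension_le X d.

Definition has_global_dimension (d : nat) : Prop :=
  global_dimension_le d /\ forall e, global_dimension_le e -> (d <= e)%N.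

(** * Torsion pairs *)

Record torsion_pair : Type := TorsionPair {
  tors : fgmod R -> Prop;
  tfree : fgmod R -> Prop;
  tors_iso : forall X Y, isomorphic X Y -> tors X -> tors Y;
  tfree_iso : forall X Y, isomorphic X Y -> tfree X -> tfree Y;
  torsion_pair_hom : forall T F, tors T -> tfree F -> zero_hom T F;
  torsion_pair_ses : forall X, exists (T F : fgmod R)
    (i : {linear T -> X}) (p : {linear X -> F}),
    [/\ tors T, tfree F, injective i, surjective p & exact i p]
}.

Definition torsion_pair_le (t u : torsion_pair) : Prop :=
  forall X, tors t X -> tors u X.

Definition omega_torsion_pair (n : nat) (t : torsion_pair) : Prop :=
  forall T F, tors t T -> tfree t F -> ext_zero n T F.

(* [negext_zero X Y] stands for Ext^{-1}(X, Y) = 0. *)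
Definition s_torsion_pair (negext_zero : fgmod R -> fgmod R -> Prop)
    (t : torsion_pair) : Prop :=
  forall T F, tors t T -> tfree t F -> negext_zero T F.

Definition omega_lattice (n : nat) : Type :=
  {t : torsion_pair | omega_torsion_pair n t}.

Definition omega_le (n : nat) (t u : omega_lattice n) : Prop :=
  torsion_pair_le (proj1_sig t) (proj1_sig u).

End Homological.

(** * The Auslander-Reiten translation tau = D Tr *)

Section AuslanderReiten.
Variables (k : comPzRingType) (A : algType k).

(* A as a right module over itself. *)
Definition right_regular : lmodType A^c := (A^c)^o.

(* Both P0 -> M and P1 -> im f are essential epimorphisms, hence projective
   covers of M and ker p. *)
Definition minimal_presentation (M P1 P0 : fgmod A)
    (f : {linear P1 -> P0}) (p : {linear P0 -> M}) : Prop :=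
  [/\ projective P1 /\ projective P0, surjective p, exact f p,
      forall (X : lmodType A^c) (g : {linear X -> P0}),
        (forall y, exists x, p (g x) = p y) -> surjective g
    & forall (X : lmodType A^c) (g : {linear X -> P1}),
        (forall y, exists x, f (g x) = f y) -> surjective g].

(* T is the cokernel of Hom(f, A) : Hom_A(P0, A) -> Hom_A(P1, A), with quotient
   map q; the left action on Hom_A(P1, A) is (a . u) x = a (u x). *)
Definition is_transpose (M : fgmod A) (T : lmodType A) : Prop :=
  exists (P1 P0 : fgmod A) (f : {linear P1 -> P0}) (p : {linear P0 -> M})
         (q : {linear P1 -> right_regular} -> T),
    [/\ minimal_presentation f p,
        forall (a : A) (u v w : {linear P1 -> right_regular}),
          (forall x, (w x : A) = a * (u x : A) + (v x : A)) ->
          q w = a *: q u + q v,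
        surjective q
      & forall u, q u = 0 <->
          exists v : {linear P0 -> right_regular}, forall x, u x = v (f x)].

(* N is D T = Hom_k(T, E), with E the injective envelope of k / rad k and right
   A-action (phi . a) t = phi (a t); [b] is the identification, and T is a
   k-module through k -> A. *)
Definition is_dual (T : lmodType A) (N : lmodType A^c) : Prop :=
  exists (E : lmodType k) (b : N -> T -> E),
    [/\ injective_envelope_of_top E,
        forall x (c : k) t t',
          b x ((c%:A : A) *: t + t') = c *: b x t + b x t',
        forall (a : A) x y t,
          b ((a : A^c) *: x + y) t = b x (a *: t) + b y t
      & forall g : T -> E,
          (forall (c : k) t t', g ((c%:A : A) *: t + t') = c *: g t + g t') ->
          exists! x, forall t, b x t = g t].

Definition is_tau (M : fgmod A) (N : lmodType A^c) : Prop :=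
  exists T : lmodType A, is_transpose M T /\ is_dual T N.

(* tau M exists and is unique up to isomorphism. *)
Definition tau_rigid (M : fgmod A) : Prop :=
  forall N : lmodType A^c, is_tau M N -> zero_hom M N.

Definition tau_tilting_finite : Prop :=
  exists (n : nat) (s : 'I_n -> fgmod A),
    forall M : fgmod A, indecomposable M -> tau_rigid M ->
      exists i, isomorphic M (s i).

End AuslanderReiten.

(* Main.v *)
Require Import Defs.
From HB Require Import structures.
From mathcomp Require Import all_boot all_algebra.
From mathcomp Require Import boolp.

(** The theorem rests on three facts: finitely generated modules over an Artin
    algebra have finite length, a torsion pair is determined by either of its two
    classes, and meets of torsion pairs are intersections of torsion classes while
    joins are intersections of torsion-free classes.

    _Sublattices._ A torsion-free module for the meet of a family is filtered by
    modules torsion-free for members of the family, and dually for joins. As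
    [Ext^n] is half exact in both variables ([ext_zero_half_exact]), its vanishing
    passes along these filtrations ([orthogonal_complete_sublattice]). For
    [d = 0] the condition on s-torsion pairs is the vanishing of Hom, which every
    torsion pair satisfies.

    _Semidistributivity._ Meets and joins in a complete sublattice are those of all
    torsion pairs, and there an induction on the length of modules applies
    ([sub_completely_semidistributive]).

    _Congruence uniformity._ In a finite lattice the map from join-irreducible
    elements to join-irreducible congruences is onto, and only its injectivity
    needs an argument ([lower_bijection]). If a class of modules is closed under
    submodules and quotients, having the same torsion modules in this class is a
    congruence, on any sublattice ([agree_cong]). Classes bounding the length
    provide enough such congruences to recover [j] from the congruence that
    collapses [j] to its lower cover ([separate_by_length]). Meet-irreducible
    elements are treated by exchanging torsion and torsion-free classes.

    _Finiteness._ It remains to see that a tau-tilting finite algebra has finitely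
    many torsion classes. Ext-projective modules of torsion classes are tau-rigid
    ([ext_projective_tau_rigid]), so all their indecomposable summands are among
    finitely many modules [s i]. Say that a torsion class has enough
    Ext-projectives if each of its modules is the quotient of an Ext-projective by
    a torsion module. Such a class [t] consists of the quotients of sums of the
    [s i] in it. If [u] is strictly smaller, there is a class [t'] between them
    that again has enough Ext-projectives and contains fewer [s i] than [t]
    ([descend]). Hence the descent from the class of all modules reaches every
    torsion class, and torsion classes are determined by the [s i] they contain.

    The step from [t] to [t'] is a form of mutation. Let [X] be nonzero, torsion
    for [t] and torsion-free for [u]. By the lemma of Harada and Sai there is an
    indecomposable Ext-projective [M] of [t] with a nonzero map to [X] that
    vanishes on the images of all non-isomorphisms to [M] from indecomposable
    Ext-projectives. Let [B] be the quotient of [M] by these images, and let [t']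
    consist of the modules of [t] without nonzero maps to [B]. Its modules are
    generated by the indecomposable Ext-projectives of [t] other than [M], and the
    cokernels of left approximations by sums of these provide the
    Ext-projectives of [t'] that are missing among them. *)

Set Implicit Arguments.
Unset Strict Implicit.
Unset Printing Implicit Defensive.

Import GRing.Theory.
Local Open Scope ring_scope.

(** * Join-irreducible congruences of a finite lattice *)

Section Order.
Variables (L : Type) (le : L -> L -> Prop).

Definition dual_le (x y : L) : Prop := le y x.

Lemma partial_order_dual : partial_order le -> partial_order dual_le.
Proof.
case=> r t a; split=> // [x y z xy yz|x y xy yx]; first exact: t yz xy.
exact: a.
Qed.

Lemma is_meet_of_uniq S m m' : partial_order le ->
  is_meet_of le S m -> is_meet_of le S m' -> m = m'.
Proof. by case=> _ _ a [l g] [l' g']; apply: a; [exact: g' | exact: g]. Qed.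

Lemma is_lattice_of_complete : is_complete_lattice le -> is_lattice le.
Proof. by case=> po m j; split=> // x y; [exact: m | exact: j]. Qed.

End Order.

Lemma is_join_of_uniq (L : Type) (le : L -> L -> Prop) S j j' : partial_order le ->
  is_join_of le S j -> is_join_of le S j' -> j = j'.
Proof. by move/partial_order_dual; exact: is_meet_of_uniq. Qed.

Lemma finite_lattice_dual (L : Type) (le : L -> L -> Prop) :
  is_finite_lattice le -> is_finite_lattice (dual_le le).
Proof.
by case=> -[po m j] e; split=> //; split=> //; exact: partial_order_dual.
Qed.

(** The number of elements below [x] increases strictly with [x]. *)
Lemma finite_poset_max (L : Type) (le : L -> L -> Prop) (n : nat) (s : 'I_n -> L)
    (Q : L -> Prop) : partial_order le -> (forall x, exists i, s i = x) ->
  (exists x, Q x) -> exists x, Q x /\ forall y, Q y -> le x y -> y = x.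
Proof.
move=> [r t a] hs [x0 Qx0].
pose mu x := #|[pred i | `[< le (s i) x >]]|.
have exP : exists m, `[< exists x, Q x /\ mu x = m >].
  by exists (mu x0); apply/asboolP; exists x0.
have bP : forall m, `[< exists x, Q x /\ mu x = m >] -> (m <= n)%N.
  by move=> m /asboolP[x [_ <-]]; rewrite -[leqRHS]card_ord; exact: max_card.
case: (ex_maxnP exP bP) => m /asboolP[x [Qx <-]] mx.
exists x; split=> // y Qy xy; apply: contrapT => ne.
suff : (mu x < mu y)%N.
  by rewrite ltnNge mx //; apply/asboolP; exists y.
apply: proper_card; apply/properP; split.
  by apply/subsetP => i; rewrite !inE => /asboolP h; apply/asboolP; exact: t xy.
have [i iy] := hs y; exists i; rewrite !inE; first by apply/asboolP; rewrite iy.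
by apply/asboolP; rewrite iy => yx; apply: ne; exact: a.
Qed.

Lemma finite_lattice_of_injective (L : Type) (le : L -> L -> Prop) (m : nat)
    (code : L -> {set 'I_m}) :
  is_complete_lattice le -> injective code -> is_finite_lattice le.
Proof.
move=> cL ci; split; first exact: is_lattice_of_complete.
have [x0 _] := let: And3 _ _ h := cL in h (fun=> False).
have /choice[g hg] (c : {set 'I_m}) : exists x, (exists y, code y = c) -> code x = c.
  case: (EM (exists y, code y = c)) => [[y hy]|no]; first by exists y.
  by exists x0.
exists #|{set 'I_m}|, (fun i => g (enum_val i)) => x.
by exists (enum_rank (code x)); rewrite enum_rankK; apply: ci; apply: hg; exists x.
Qed.

Section FiniteLattice.
Variables (L : Type) (le : L -> L -> Prop).
Hypothesis hL : is_finite_lattice le.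

Let po : partial_order le. Proof. by case: hL => -[]. Qed.
Let lexx x : le x x. Proof. by case: po. Qed.
Let lett y x z : le x y -> le y z -> le x z. Proof. by case: po => _ t _; exact: t. Qed.
Let lea x y : le x y -> le y x -> x = y. Proof. by case: po => _ _ t; exact: t. Qed.
Let exm x y : exists m, is_meet le x y m. Proof. by case: hL => -[]. Qed.
Let exj x y : exists m, is_join le x y m. Proof. by case: hL => -[]. Qed.

Lemma is_meet_lr x y m : is_meet le x y m -> le m x /\ le m y.
Proof. by case=> l _; split; apply: l; [left | right]. Qed.

Lemma is_meetC x y m : is_meet le x y m -> is_meet le y x m.
Proof.
case=> l g; split=> [z [->|->]|z h]; [by apply: l; right|by apply: l; left|].
by apply: g => w [->|->]; apply: h; [right|left].
Qed.

Lemma is_meet_le x y : le x y -> is_meet le x y x.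
Proof. by move=> h; split=> [z [->|->]//|z]; apply; left. Qed.

Lemma is_join_lr x y m : is_join le x y m -> le x m /\ le y m.
Proof. by case=> l _; split; apply: l; [left | right]. Qed.

Lemma is_joinC x y m : is_join le x y m -> is_join le y x m.
Proof.
case=> l g; split=> [z [->|->]|z h]; [by apply: l; right|by apply: l; left|].
by apply: g => w [->|->]; apply: h; [right|left].
Qed.

Lemma is_join_le x y : le x y -> is_join le x y y.
Proof. by move=> h; split=> [z [->|->]//|z]; apply; right. Qed.

Lemma lattice_max (Q : L -> Prop) : (exists x, Q x) ->
  exists x, Q x /\ forall y, Q y -> le x y -> y = x.
Proof. by case: hL => _ [n [s hs]]; exact: finite_poset_max hs. Qed.

Lemma lattice_min (Q : L -> Prop) : (exists x, Q x) ->
  exists x, Q x /\ forall y, Q y -> le y x -> y = x.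
Proof.
case: hL => _ [n [s hs]].
exact: (finite_poset_max (partial_order_dual po) hs).
Qed.

(** In a finite lattice the elements strictly below a join-irreducible [j] have
    a largest one: two maximal ones would join to [j]. *)
Lemma join_irreducible_lower j : join_irreducible le j ->
  exists j_, [/\ le j_ j, j_ <> j & forall c, le c j -> c <> j -> le c j_].
Proof.
move=> [nb ir].
have [y0 ny0] : exists y, ~ le j y by apply: contrapT => h; apply: nb => y; apply: contrapT => hy; apply: h; exists y.
have [x [[xj xnj] mx]] : exists x, (le x j /\ x <> j) /\ forall y, (le y j /\ y <> j) -> le x y -> y = x.
  apply: lattice_max; have [m mm] := exm y0 j; have [my mj] := is_meet_lr mm.
  by exists m; split=> // e; apply: ny0; rewrite -e.
exists x; split=> // c cj cnj.
have [w xw] := exj x c; have [xw1 cw] := is_join_lr xw.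
have wj : le w j by case: xw => _; apply=> z [->|->].
case: (EM (w = j)) => [e|ne]; last by rewrite -(mx w).
by rewrite e in xw; case: (ir _ _ xw) => e'; [case: xnj | case: cnj].
Qed.

Lemma lower_covered j j_ : le j_ j -> j_ <> j -> (forall c, le c j -> c <> j -> le c j_) ->
  is_covered_by le j_ j /\ forall c, is_covered_by le c j -> c = j_.
Proof.
move=> h1 h2 h3; split.
  split=> // z z1 z2; case: (EM (z = j)) => [|ne]; [by right|left].
  by apply: lea => //; exact: h3.
move=> c [c1 c2 c3]; have := h3 _ c1 c2 => cj.
by case: (c3 _ cj h1).
Qed.

Lemma cong_ext (t u : congruence le) : (forall x y, t x y <-> u x y) -> t = u.
Proof.
case: t => t a1 a2 a3 a4 a5; case: u => u b1 b2 b3 b4 b5 /= h.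
have e : t = u by apply: funext => x; apply: funext => y; exact: propext.
by subst u; congr Congruence; exact: Prop_irrelevance.
Qed.

Lemma cong_le_anti (t u : congruence le) : cong_le t u -> cong_le u t -> t = u.
Proof. by move=> a b; apply: cong_ext => x y; split; [exact: a | exact: b]. Qed.

Definition generated_cong (G : L -> L -> Prop) : congruence le.
Proof.
refine (@Congruence L le
  (fun x y => forall u : congruence le, (forall a b, G a b -> u a b) -> u x y)
  _ _ _ _ _).
- by move=> x u _; exact: cong_refl.
- by move=> x y h u hu; apply: cong_sym; exact: h.
- by move=> x y z h1 h2 u hu; apply: cong_trans; [exact: h1 | exact: h2].
- by move=> x x' y y' m m' h1 h2 a b u hu; apply: (cong_meet (h1 u hu) (h2 u hu)).
- by move=> x x' y y' m m' h1 h2 a b u hu; apply: (cong_join (h1 u hu) (h2 u hu)).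
Defined.

Lemma generated_cong_sub G a b : G a b -> generated_cong G a b.
Proof. by move=> h u; apply. Qed.

Lemma generated_cong_min G (u : congruence le) :
  (forall a b, G a b -> u a b) -> cong_le (generated_cong G) u.
Proof. by move=> h x y; apply. Qed.

Definition diag_cong : congruence le.
Proof.
refine (@Congruence L le (@eq L) _ _ _ _ _) => //.
- by move=> x y z -> ->.
- by move=> x x' y y' m m' -> ->; exact: is_meet_of_uniq.
- by move=> x x' y y' m m' -> ->; exact: is_join_of_uniq.
Defined.

(** Paths with steps in two congruences: together they form the join of the two. *)
Inductive cong_path (t u : congruence le) (x : L) : L -> Prop :=
| cong_path_nil : cong_path t u x x
| cong_path_rcons y z : cong_path t u x y -> t y z \/ u y z -> cong_path t u x z.

Lemma cong_path_trans t u x y z :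
  cong_path t u x y -> cong_path t u y z -> cong_path t u x z.
Proof. by move=> xy; elim=> // a b _ xa h; exact: cong_path_rcons h. Qed.

Lemma cong_path_sym t u x y : cong_path t u x y -> cong_path t u y x.
Proof.
elim=> [|a b _ xa h]; first exact: cong_path_nil.
apply: cong_path_trans xa; apply: cong_path_rcons (cong_path_nil _ _ _) _.
by case: h => h; [left | right]; exact: cong_sym.
Qed.

Lemma cong_path_meet t u x x' w m m' : cong_path t u x x' ->
  is_meet le x w m -> is_meet le x' w m' -> cong_path t u m m'.
Proof.
move=> p; elim: p m' => [|a b _ IH h] m' hm hm'.
  by rewrite (is_meet_of_uniq po hm hm'); exact: cong_path_nil.
have [c hc] := exm a w; apply: cong_path_rcons (IH _ hm hc) _.
by case: h => h; [left | right]; apply: cong_meet h (cong_refl _ w) hc hm'.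
Qed.

Lemma cong_path_join t u x x' w m m' : cong_path t u x x' ->
  is_join le x w m -> is_join le x' w m' -> cong_path t u m m'.
Proof.
move=> p; elim: p m' => [|a b _ IH h] m' hm hm'.
  by rewrite (is_join_of_uniq po hm hm'); exact: cong_path_nil.
have [c hc] := exj a w; apply: cong_path_rcons (IH _ hm hc) _.
by case: h => h; [left | right]; apply: cong_join h (cong_refl _ w) hc hm'.
Qed.

Definition path_cong (t u : congruence le) : congruence le.
Proof.
refine (@Congruence L le (cong_path t u) _ _ _ _ _).
- exact: cong_path_nil.
- exact: cong_path_sym.
- exact: cong_path_trans.
- move=> x x' y y' m m' px py hm hm'; have [c hc] := exm x' y.
  apply: cong_path_trans (cong_path_meet px hm hc) _.
  exact: cong_path_meet py (is_meetC hc) (is_meetC hm').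
- move=> x x' y y' m m' px py hm hm'; have [c hc] := exj x' y.
  apply: cong_path_trans (cong_path_join px hm hc) _.
  exact: cong_path_join py (is_joinC hc) (is_joinC hm').
Defined.

Definition pair_cong (x y : L) := generated_cong (fun a b => a = x /\ b = y).

Lemma pair_cong_smallest x y : smallest_congruence_identifying x y (pair_cong x y).
Proof.
split=> [|u h]; first by apply: generated_cong_sub.
by apply: generated_cong_min => a b [-> ->].
Qed.

Lemma smallest_cong_uniq x y (t u : congruence le) :
  smallest_congruence_identifying x y t -> smallest_congruence_identifying x y u -> t = u.
Proof. by move=> [t1 t2] [u1 u2]; apply: cong_le_anti; [exact: t2 | exact: u2]. Qed.

(** A path from [j] whose steps lie in two congruences that do not identify [j]
    with [j_] never leaves the elements above [j]. *)
Lemma pair_cong_irreducible j j_ : le j_ j -> j_ <> j ->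
  (forall c, le c j -> c <> j -> le c j_) ->
  join_irreducible (@cong_le L le) (pair_cong j_ j).
Proof.
move=> h1 h2 h3; split.
  by move=> /(_ diag_cong) h; apply: h2; apply: (h j_ j); exact: generated_cong_sub.
move=> t u [ub lub].
have bt : cong_le t (pair_cong j_ j) by apply: ub; left.
have bu : cong_le u (pair_cong j_ j) by apply: ub; right.
have key (v : congruence le) : cong_le v (pair_cong j_ j) -> v j_ j -> pair_cong j_ j = v.
  by move=> b h; apply: cong_le_anti => //; case: (pair_cong_smallest j_ j) => _; exact.
case: (EM (t j_ j)) => [tj|ntj]; first by left; exact: key.
case: (EM (u j_ j)) => [uj|nuj]; first by right; exact: key.
(* If [v] relates [x >= j] to [y], it relates [j] to [m := y /\ j]. Were [m]
   below [j_], joining with [j_] would identify [j] and [j_]. *)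
have step (v : congruence le) x y : ~ v j_ j -> v x y -> le j x -> le j y.
  move=> nv vxy jx; have [m hm] := exm y j; have [my mj] := is_meet_lr hm.
  case: (EM (m = j)) => [<- //|ne]; case: nv.
  have mj_ := h3 _ mj ne.
  have vjm : v j m := cong_meet vxy (cong_refl _ j) (is_meetC (is_meet_le jx)) hm.
  exact: cong_join (cong_sym vjm) (cong_refl _ j_) (is_join_le mj_) (is_joinC (is_join_le h1)).
have inv x : cong_path t u j x -> le j x.
  by elim=> // y z _ jy [] h; apply: step h jy.
exfalso; apply: h2; apply: lea => //; apply: inv; apply: cong_path_sym.
have : cong_le (pair_cong j_ j) (path_cong t u).
  apply: lub => v [->|->] x y vxy; apply: cong_path_rcons (cong_path_nil _ _ _) _; by [left|right].
by apply; exact: generated_cong_sub.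
Qed.

Definition collapsed (t : congruence le) (j_ j : L) : Prop :=
  [/\ join_irreducible le j, le j_ j, j_ <> j,
      forall c, le c j -> c <> j -> le c j_ & t j_ j].

(** A congruence is determined by the join-irreducibles it collapses. If [t]
    relates [m < b] and [u] does not, let [c] be maximal among the elements from
    [m] to [b] that [u] relates to [m], and let [j] be minimal among the elements below [b] and not below [c]: it is
    join-irreducible and collapsed by [t], and if it were by [u] too, [u] would
    relate [m] to [c \/ j]. *)
Lemma cong_le_collapsed (t u : congruence le) :
  (forall j_ j, collapsed t j_ j -> u j_ j) -> cong_le t u.
Proof.
move=> hu.
have main m b : le m b -> t m b -> u m b.
  move=> mb tmb.
  have [c [[mc cb uc] cmax]] : exists c, [/\ le m c, le c b & u m c] /\
      forall y, [/\ le m y, le y b & u m y] -> le c y -> y = c.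
    by apply: lattice_max; exists m; split=> //; exact: cong_refl.
  case: (EM (le b c)) => [bc|nbc]; first by rewrite (lea bc cb).
  have [j [[jb jc] jmin]] : exists j, (le j b /\ ~ le j c) /\
      forall y, (le y b /\ ~ le y c) -> le y j -> y = j.
    by apply: lattice_min; exists b.
  have below y : le y j -> y <> j -> le y c.
    move=> yj ne; apply: contrapT => nyc; apply: ne; apply: jmin => //.
    by split=> //; exact: lett jb.
  have ji : join_irreducible le j.
    split=> [|y z yz]; first by move=> h; apply: jc; exact: h.
    have [yj zj] := is_join_lr yz.
    case: (EM (j = y)) => [|ny]; [by left|right; apply: contrapT => nz; apply: jc].
    by case: yz => _; apply=> w [->|->]; apply: below => // e; [case: ny|case: nz].
  have [j_ [j1 j2 j3]] := join_irreducible_lower ji.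
  have j_c : le j_ c by exact: below.
  have tcb : t c b := cong_join tmb (cong_refl _ c) (is_join_le mc) (is_joinC (is_join_le cb)).
  have [w hw] := exm c j; have [wc wj] := is_meet_lr hw.
  have wj_ : w = j_.
    apply: lea; first by apply: j3 => // e; apply: jc; rewrite -e.
    by case: hw => _; apply=> z [->|->].
  have tj : t j_ j.
    by rewrite -wj_; exact: cong_meet tcb (cong_refl _ j) hw (is_meetC (is_meet_le jb)).
  have uj : u j_ j by apply: hu.
  have [c' hc'] := exj j c; have [jc' cc'] := is_join_lr hc'.
  have ucc' : u c c' := cong_join uj (cong_refl _ c) (is_join_le j_c) hc'.
  case: jc; rewrite -(cmax c') //; split.
  - exact: lett mc cc'.
  - by case: hc' => _; apply=> z [->|->].
  - exact: cong_trans uc ucc'.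
move=> a b tab; have [m hm] := exm a b; have [ma mb] := is_meet_lr hm.
have tma : t m a.
  by apply: cong_sym; exact: cong_meet (cong_refl _ a) tab (is_meet_le (lexx a)) hm.
apply: cong_trans (cong_sym (main _ _ ma tma)) (main _ _ mb _).
exact: cong_trans tma tab.
Qed.

(** [t] is the finite join of the congruences generated by the pairs it
    collapses, hence equal to one of them. *)
Lemma cong_le_join_irreducible t : join_irreducible (@cong_le L le) t ->
  exists j_ j, collapsed t j_ j /\ t = pair_cong j_ j.
Proof.
move=> [nb ir]; have [_ [n [s hs]]] := hL.
pose G k a b := exists i : 'I_n, [/\ (i < k)%N, s i = b & collapsed t a b].
have fin k : t = generated_cong (G k) -> exists j_ j, collapsed t j_ j /\ t = pair_cong j_ j.
  elim: k => [e|k IH e].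
    by case: nb => y; rewrite e; apply: generated_cong_min => a b [i []].
  case: (EM (exists a b (i : 'I_n), [/\ i = k :> nat, s i = b & collapsed t a b])); last first.
    move=> no; apply: IH; rewrite {1}e; apply: cong_le_anti.
      apply: generated_cong_min => a b [i [ik sb c]]; apply: generated_cong_sub.
      exists i; split=> //; move: ik; rewrite ltnS leq_eqVlt => /orP[/eqP ik|//].
      by case: no; exists a, b, i.
    by apply: generated_cong_min => a b [i [ik sb c]]; apply: generated_cong_sub; exists i; split=> //; exact: ltnW.
  move=> [j_ [j [i0 [ik sj cj]]]].
  have : is_join (@cong_le L le) (generated_cong (G k)) (pair_cong j_ j) t.
    split=> [v [->|->]|v hv].
    - by rewrite e; apply: generated_cong_min => a b [i [ik' sb c]]; apply: generated_cong_sub; exists i; split=> //; exact: ltnW.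
    - by apply: generated_cong_min => a b [-> ->]; case: cj.
    - rewrite e; apply: generated_cong_min => a b [i [ik' sb c]].
      move: ik'; rewrite ltnS leq_eqVlt => /orP[/eqP ik'|ik'].
        have ei : i = i0 by apply: val_inj; rewrite /= ik ik'.
        have eb : b = j by rewrite -sb -sj ei.
        apply: (hv (pair_cong j_ j)); first by right.
        apply: generated_cong_sub; split=> //; rewrite eb in c.
        case: c cj => _ a1 a2 a3 _ [_ b1 b2 b3 _].
        by apply: lea; [exact: (b3 _ a1 a2) | exact: (a3 _ b1 b2)].
      by apply: (hv (generated_cong (G k))); [left|apply: generated_cong_sub; exists i].
  by case/ir => [|->]; [exact: IH | exists j_, j; split=> //; case: cj => *; split=> //; exact: generated_cong_sub].
apply: (fin n); apply: cong_le_anti.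
  apply: cong_le_collapsed => j_ j c; apply: generated_cong_sub.
  by have [i si] := hs j; exists i.
by apply: generated_cong_min => a b [i [_ _ []]].
Qed.

(** Everything except injectivity of [j |-> con(j_, j)] holds in any finite
    lattice. *)
Lemma lower_bijection :
  (forall j j' j_ j'_ (t : congruence le), le j_ j -> (forall c, le c j -> c <> j -> le c j_) ->
     le j'_ j' -> (forall c, le c j' -> c <> j' -> le c j'_) -> j_ <> j ->
     smallest_congruence_identifying j_ j t ->
     smallest_congruence_identifying j'_ j' t -> j = j') ->
  is_bijection_between (join_irreducible le)
    (join_irreducible (@cong_le L le)) (@lower_congruence L le).
Proof.
move=> inj.
have lowE j j_ (t : congruence le) : le j_ j -> j_ <> j -> (forall c, le c j -> c <> j -> le c j_) ->
    lower_congruence j t <-> smallest_congruence_identifying j_ j t.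
  move=> h1 h2 h3; have [cv un] := lower_covered h1 h2 h3; split=> [[c [c1 _ c3]]|h].
    by rewrite -(un _ c1).
  by exists j_.
split.
- move=> j hj; have [j_ [h1 h2 h3]] := join_irreducible_lower hj.
  exists (pair_cong j_ j); split=> [|t]; first exact: pair_cong_irreducible.
  rewrite (lowE _ _ _ h1 h2 h3); split=> [h|->]; last exact: pair_cong_smallest.
  exact: smallest_cong_uniq h (pair_cong_smallest _ _).
- move=> j j' t hj hj'; have [j_ [h1 h2 h3]] := join_irreducible_lower hj.
  have [j'_ [h1' h2' h3']] := join_irreducible_lower hj'.
  by rewrite (lowE _ _ _ h1 h2 h3) (lowE _ _ _ h1' h2' h3'); exact: inj.
- move=> t /cong_le_join_irreducible[j_ [j [[ji h1 h2 h3 _] ->]]].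
  by exists j; split=> //; rewrite (lowE _ _ _ h1 h2 h3); exact: pair_cong_smallest.
Qed.

End FiniteLattice.

Definition dual_cong (L : Type) (le : L -> L -> Prop) (t : congruence le) :
  congruence (dual_le le) :=
  @Congruence L (dual_le le) t (@cong_refl _ _ t) (@cong_sym _ _ t)
    (@cong_trans _ _ t) (@cong_join _ _ t) (@cong_meet _ _ t).

Definition undual_cong (L : Type) (le : L -> L -> Prop)
  (t : congruence (dual_le le)) : congruence le :=
  @Congruence L le t (@cong_refl _ _ t) (@cong_sym _ _ t)
    (@cong_trans _ _ t) (@cong_join _ _ t) (@cong_meet _ _ t).

Section DualBijection.
Variables (L : Type) (le : L -> L -> Prop).

Lemma dual_congK : cancel (@dual_cong L le) (@undual_cong L le).
Proof. by case. Qed.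

Lemma undual_congK : cancel (@undual_cong L le) (@dual_cong L le).
Proof. by case. Qed.

Lemma dual_cong_irreducible t : join_irreducible (@cong_le L le) t <->
  join_irreducible (@cong_le L (dual_le le)) (dual_cong t).
Proof.
split=> -[nb ir]; split.
- move=> h; apply: nb => y x x' hx; exact: (h (dual_cong y) x x' hx).
- move=> y z [ub lub].
  have : t = undual_cong y \/ t = undual_cong z.
    apply: ir; split=> [u [->|->]|u hu].
    + by move=> a b; exact: (ub y (or_introl erefl) a b).
    + by move=> a b; exact: (ub z (or_intror erefl) a b).
    + move=> a b; apply: (lub (dual_cong u)) => v [->|->] c d h.
        by apply: (hu (undual_cong y)) => //; left.
      by apply: (hu (undual_cong z)) => //; right.
  by case=> ->; rewrite undual_congK; [left|right].
- move=> h; apply: nb => y x x' hx; exact: (h (undual_cong y) x x' hx).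
- move=> y z [ub lub].
  have : dual_cong t = dual_cong y \/ dual_cong t = dual_cong z.
    apply: ir; split=> [u [->|->]|u hu].
    + by move=> a b; exact: (ub y (or_introl erefl) a b).
    + by move=> a b; exact: (ub z (or_intror erefl) a b).
    + move=> a b; apply: (lub (undual_cong u)) => v [->|->] c d h.
        by apply: (hu (dual_cong y)) => //; left.
      by apply: (hu (dual_cong z)) => //; right.
  by case=> /(congr1 (@undual_cong L le)); rewrite !dual_congK => ->; [left|right].
Qed.

Lemma dual_smallest x y t : @smallest_congruence_identifying L le x y t <->
  @smallest_congruence_identifying L (dual_le le) y x (dual_cong t).
Proof.
split=> -[h1 h2]; split.
- exact: (cong_sym h1).
- by move=> u hu a b; apply: (h2 (undual_cong u)); exact: (cong_sym hu).
- exact: (cong_sym h1).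
- by move=> u hu a b; apply: (h2 (dual_cong u)); exact: (cong_sym hu).
Qed.

Lemma dual_covered x y : is_covered_by (dual_le le) x y <-> is_covered_by le y x.
Proof.
have half (le' : L -> L -> Prop) u v : is_covered_by (dual_le le') u v -> is_covered_by le' v u.
  case=> h1 h2 h3; split=> // [e|z a b]; first by apply: h2.
  by case: (h3 z b a); [right|left].
by split; exact: half.
Qed.

Lemma dual_lower_congruence x t :
  @upper_congruence L le x t <-> @lower_congruence L (dual_le le) x (dual_cong t).
Proof.
split=> -[m [h1 h2 h3]]; exists m; split.
- exact/dual_covered.
- by move=> c /dual_covered; exact: h2.
- exact/dual_smallest.
- exact/dual_covered.
- by move=> c /dual_covered; exact: h2.
- exact/dual_smallest.
Qed.

Lemma upper_bijection :
  is_bijection_between (join_irreducible (dual_le le))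
    (join_irreducible (@cong_le L (dual_le le))) (@lower_congruence L (dual_le le)) ->
  is_bijection_between (meet_irreducible le)
    (join_irreducible (@cong_le L le)) (@upper_congruence L le).
Proof.
case=> tot inj sur; split.
- move=> x hx; have [t [ht htu]] := tot x hx; exists (undual_cong t); split.
    by rewrite dual_cong_irreducible undual_congK.
  move=> u; rewrite dual_lower_congruence htu; split=> [<-|->]; first by rewrite dual_congK.
  by rewrite undual_congK.
- by move=> x x' t hx hx'; rewrite !dual_lower_congruence; exact: inj.
- move=> t /dual_cong_irreducible /sur[x [hx hg]].
  by exists x; split=> //; exact/dual_lower_congruence.
Qed.

End DualBijection.

(** * Submodules, quotients and linear maps *)

Section Submodules.
Variable S : pzRingType.

Definition linear_map_of (V W : lmodType S) (f : V -> W) (hf : linear f) :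
  {linear V -> W} := HB.pack f (GRing.isLinear.Build S V W *:%R f hf).

Definition submod (V : lmodType S) (U : V -> Prop) : Prop :=
  U 0 /\ forall a x y, U x -> U y -> U (a *: x + y).

Section Closure.
Variables (V : lmodType S) (U : V -> Prop).
Hypothesis hU : submod U.

Lemma submodD x y : U x -> U y -> U (x + y).
Proof. by move=> ux uy; rewrite -[x]scale1r; apply: hU.2. Qed.
Lemma submodZ a x : U x -> U (a *: x).
Proof. by move=> ux; rewrite -[_ *: _]addr0; apply: hU.2 => //; case: hU. Qed.
Lemma submodN x : U x -> U (- x).
Proof. by move=> ux; rewrite -scaleN1r; exact: submodZ. Qed.
Lemma submodB x y : U x -> U y -> U (x - y).
Proof. by move=> ux uy; apply: submodD => //; exact: submodN. Qed.
End Closure.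

Section SubObject.
Variables (V : lmodType S) (U : V -> Prop).
Hypothesis hU : submod U.

Definition submod_pred of submod U : {pred V} := fun x => `[< U x >].

Lemma submod_pred_closed : GRing.submod_closed (submod_pred hU).
Proof.
split=> [|a x y /asboolP ux /asboolP uy]; apply/asboolP; first by case: hU.
exact: hU.2.
Qed.

HB.instance Definition _ :=
  GRing.isSubmodClosed.Build S V (submod_pred hU) submod_pred_closed.

Definition submod_type := {x : V | x \in submod_pred hU}.
HB.instance Definition _ := SubChoice.on submod_type.
HB.instance Definition _ := [SubChoice_isSubLmodule of submod_type by <:].

Definition submod_val : submod_type -> V := val.
Lemma submod_val_linear : linear submod_val.
Proof. by []. Qed.
End SubObject.

Lemma submod_object (V : lmodType S) (U : V -> Prop) : submod U ->
  exists (K : lmodType S) (i : {linear K -> V}),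
    injective i /\ forall x, U x <-> exists y, i y = x.
Proof.
move=> hU; exists (submod_type hU), (linear_map_of (@submod_val_linear V U hU)).
split=> [x y|x]; first exact: val_inj.
split=> [ux|[y <-]]; last by apply/asboolP; case: y.
have px : x \in submod_pred hU by apply/asboolP.
by exists (Sub x px); rewrite /=/submod_val SubK.
Qed.

Section QuotObject.
Variables (V : lmodType S) (U : V -> Prop).
Hypothesis hU : submod U.

(** A canonical element of the coset of [x]: [choose] only depends on the
    extension of the predicate. The quotient is the set of these elements. *)
Definition quot_repr of submod U := fun x : V => choose (fun y => `[< U (x - y) >]) x.
Local Notation repr := (quot_repr hU).

Lemma quot_repr_in x : U (x - repr x).
Proof.
apply/asboolP; apply: (chooseP (P := fun y => `[< U (x - y) >])).
by apply/asboolP; rewrite subrr; case: hU.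
Qed.

Lemma quot_repr_eq x y : U (x - y) -> repr x = repr y.
Proof.
move=> uxy; rewrite /quot_repr.
have e : (fun z => `[< U (x - z) >]) =1 (fun z => `[< U (y - z) >]).
  move=> z; apply/asboolP/asboolP => h.
    have -> : y - z = (x - z) - (x - y) by rewrite opprB [RHS]addrC subrKA.
    exact: submodB.
  by rewrite -[x - z](subrKA y); exact: submodD.
rewrite (eq_choose e); apply: choose_id; apply/asboolP; last by rewrite subrr; case: hU.
by rewrite -opprB; exact: submodN.
Qed.

Definition quot_canon : pred V := fun x => repr x == x.

Lemma quot_repr_idem x : quot_canon (repr x).
Proof. by apply/eqP/esym/quot_repr_eq/quot_repr_in. Qed.

Definition quot_type := {x : V | quot_canon x}.
HB.instance Definition _ := SubChoice.on quot_type.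

Definition quot_class (x : V) : quot_type := Sub (repr x) (quot_repr_idem x).

Lemma quot_class_eq x y : U (x - y) -> quot_class x = quot_class y.
Proof. by move=> h; apply: val_inj; rewrite !SubK; exact: quot_repr_eq. Qed.

Lemma quot_classK (a : quot_type) : quot_class (val a) = a.
Proof. by apply: val_inj; rewrite SubK; apply/eqP; case: a. Qed.

Lemma quot_val_class x : U (val (quot_class x) - x).
Proof. by rewrite SubK -opprB; apply: submodN => //; exact: quot_repr_in. Qed.

Definition quot_add (a b : quot_type) := quot_class (val a + val b).
Definition quot_opp (a : quot_type) := quot_class (- val a).
Definition quot_scale (c : S) (a : quot_type) := quot_class (c *: val a).

Lemma quot_addE x y : quot_add (quot_class x) (quot_class y) = quot_class (x + y).
Proof.
by apply: quot_class_eq; rewrite opprD addrACA; apply: submodD => //; exact: quot_val_class.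
Qed.
Lemma quot_oppE x : quot_opp (quot_class x) = quot_class (- x).
Proof.
by apply: quot_class_eq; rewrite -opprD; apply: submodN => //; exact: quot_val_class.
Qed.
Lemma quot_scaleE c x : quot_scale c (quot_class x) = quot_class (c *: x).
Proof.
by apply: quot_class_eq; rewrite -scalerBr; apply: submodZ => //; exact: quot_val_class.
Qed.

Lemma quot_addA : associative quot_add.
Proof. by move=> a b c; rewrite -[a]quot_classK -[b]quot_classK -[c]quot_classK !quot_addE addrA. Qed.
Lemma quot_addC : commutative quot_add.
Proof. by move=> a b; rewrite /quot_add addrC. Qed.
Lemma quot_add0 : left_id (quot_class 0) quot_add.
Proof. by move=> a; rewrite -[a]quot_classK quot_addE add0r. Qed.
Lemma quot_addN : left_inverse (quot_class 0) quot_opp quot_add.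
Proof. by move=> a; rewrite -[a]quot_classK quot_oppE quot_addE addNr. Qed.

HB.instance Definition _ :=
  GRing.isZmodule.Build quot_type quot_addA quot_addC quot_add0 quot_addN.

Lemma quot_scaleA a b (v : quot_type) :
  quot_scale a (quot_scale b v) = quot_scale (a * b) v.
Proof. by rewrite -[v]quot_classK !quot_scaleE scalerA. Qed.
Lemma quot_scale1 : left_id 1 quot_scale.
Proof. by move=> v; rewrite -[v]quot_classK quot_scaleE scale1r. Qed.
Lemma quot_scaleDr : right_distributive quot_scale +%R.
Proof.
move=> c a b; rewrite -[a]quot_classK -[b]quot_classK.
by rewrite /GRing.add /= quot_addE !quot_scaleE quot_addE scalerDr.
Qed.
Lemma quot_scaleDl (v : quot_type) : {morph quot_scale^~ v : a b / a + b}.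
Proof.
by move=> a b; rewrite -[v]quot_classK [RHS]/GRing.add /= !quot_scaleE quot_addE scalerDl.
Qed.

HB.instance Definition _ := GRing.Zmodule_isLmodule.Build S quot_type
  quot_scaleA quot_scale1 quot_scaleDr quot_scaleDl.

Lemma quot_class_linear : linear quot_class.
Proof. by move=> c x y; rewrite -quot_addE -quot_scaleE. Qed.

End QuotObject.

Lemma quot_object (V : lmodType S) (U : V -> Prop) : submod U ->
  exists (Q : lmodType S) (p : {linear V -> Q}),
    surjective p /\ forall x, p x = 0 <-> U x.
Proof.
move=> hU; exists (quot_type hU), (linear_map_of (quot_class_linear hU)).
split=> [y|x]; first by exists (val y); exact: quot_classK.
split=> /= [h|ux]; last first.
  by rewrite -[RHS](_ : quot_class hU 0 = _) //; apply: quot_class_eq; rewrite subr0.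
have := quot_val_class hU x; rewrite h.
have := quot_val_class hU 0; rewrite subr0 => u0.
by move=> u; rewrite -[x]opprK -[- x](addKr (val (0 : quot_type hU))) opprD opprK; apply: submodB => //.
Qed.

Lemma factor_surj (V W X : lmodType S) (p : {linear V -> W}) (f : {linear V -> X}) :
  surjective p -> (forall x, p x = 0 -> f x = 0) ->
  exists g : {linear W -> X}, forall x, g (p x) = f x.
Proof.
move=> sp hp; have [s sK] := choice sp.
have fE x y : p x = p y -> f x = f y.
  by move=> e; apply/eqP; rewrite -subr_eq0 -raddfB; apply/eqP/hp; rewrite linearB e subrr.
have lg : linear (f \o s).
  by move=> a x y /=; rewrite -linearP; apply: fE; rewrite linearP !sK.
by exists (linear_map_of lg) => x /=; apply: fE; rewrite sK.
Qed.

Lemma factor_inj (V W X : lmodType S) (i : {linear W -> X}) (f : {linear V -> X}) :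
  injective i -> (forall x, exists y, i y = f x) ->
  exists g : {linear V -> W}, forall x, i (g x) = f x.
Proof.
move=> ii /choice[s sK].
have lg : linear s by move=> a x y; apply: ii; rewrite linearP !sK linearP.
by exists (linear_map_of lg).
Qed.

Lemma surj_inj_bij (V W : lmodType S) (f : {linear V -> W}) :
  injective f -> surjective f -> bijective f.
Proof.
move=> fi /choice[g gK]; exists g => // x; apply: fi; exact: gK.
Qed.

Lemma bij_surj (V W : Type) (f : V -> W) : bijective f -> surjective f.
Proof. by case=> g _ gK y; exists (g y). Qed.

Lemma ker0_inj (V W : lmodType S) (f : {linear V -> W}) :
  (forall x, f x = 0 -> x = 0) -> injective f.
Proof.
by move=> h x y e; apply/eqP; rewrite -subr_eq0; apply/eqP/h; rewrite linearB e subrr.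
Qed.

Lemma inj0 (V W : lmodType S) (f : {linear V -> W}) x : injective f -> f x = 0 -> x = 0.
Proof. by move=> fi e; apply: fi; rewrite e raddf0. Qed.

Lemma linear_bij_inv (V W : lmodType S) (f : {linear V -> W}) : bijective f ->
  exists g : {linear W -> V}, (forall x, g (f x) = x) /\ (forall y, f (g y) = y).
Proof.
move=> fb; have [g gK] := factor_surj (f:=idfun) (bij_surj fb) (fun x => inj0 (bij_inj fb)).
by exists g; split=> // y; have [x <-] := bij_surj fb y; rewrite gK.
Qed.

Lemma iso_of (V W : lmodType S) (f : {linear V -> W}) (g : {linear W -> V}) :
  (forall x, g (f x) = x) -> (forall y, f (g y) = y) -> isomorphic V W.
Proof. by move=> fK gK; exists f, g. Qed.

Lemma iso_refl (V : lmodType S) : isomorphic V V.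
Proof. by exists idfun; exists id. Qed.

Lemma iso_sym (V W : lmodType S) : isomorphic V W -> isomorphic W V.
Proof. by case=> f /linear_bij_inv[g [fK gK]]; exact: iso_of gK fK. Qed.

Lemma iso_trans (V W X : lmodType S) : isomorphic V W -> isomorphic W X -> isomorphic V X.
Proof. by case=> f fb [g gb]; exists (g \o f); exact: bij_comp. Qed.

Lemma submod_ker (V W : lmodType S) (f : {linear V -> W}) : submod (fun x => f x = 0).
Proof. by split=> [|a x y fx fy]; rewrite ?raddf0 // linearP fx fy scaler0 addr0. Qed.

Lemma submod_image (V W : lmodType S) (f : {linear V -> W}) (U : V -> Prop) :
  submod U -> submod (fun y => exists2 x, U x & f x = y).
Proof.
case=> u0 uP; split=> [|a _ _ [x ux <-] [y uy <-]]; first by exists 0; rewrite ?raddf0.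
by exists (a *: x + y); rewrite ?linearP //; exact: uP.
Qed.

Lemma submod_range (V W : lmodType S) (f : {linear V -> W}) :
  submod (fun y => exists x, f x = y).
Proof.
split=> [|a _ _ [x <-] [y <-]]; first by exists 0; rewrite raddf0.
by exists (a *: x + y); rewrite linearP.
Qed.

Lemma submod_preim (V W : lmodType S) (f : {linear V -> W}) (U : W -> Prop) :
  submod U -> submod (fun x => U (f x)).
Proof. by case=> u0 uP; split=> [|a x y ux uy]; rewrite ?raddf0 // linearP; exact: uP. Qed.

Lemma submod_full (V : lmodType S) : submod (fun _ : V => True).
Proof. by []. Qed.

Lemma submod0 (V : lmodType S) : submod (fun x : V => x = 0).
Proof. by split=> // a x y -> ->; rewrite scaler0 addr0. Qed.

Lemma submodI (V : lmodType S) (U W : V -> Prop) :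
  submod U -> submod W -> submod (fun x => U x /\ W x).
Proof. by move=> [u0 uP] [w0 wP]; split=> // a x y [? ?] [? ?]; split; [exact: uP | exact: wP]. Qed.

Definition addS (V : lmodType S) (U W : V -> Prop) (x : V) : Prop :=
  exists u w, [/\ U u, W w & x = u + w].

Lemma submod_add (V : lmodType S) (U W : V -> Prop) :
  submod U -> submod W -> submod (addS U W).
Proof.
move=> [u0 uP] [w0 wP]; split=> [|a _ _ [u [w [uu ww ->]]] [u' [w' [uu' ww' ->]]]].
  by exists 0, 0; rewrite addr0.
exists (a *: u + u'), (a *: w + w'); split; [exact: uP | exact: wP|].
by rewrite scalerDr addrACA.
Qed.

(** ** Length *)

(** Chains of submodules from [V] up to [U] have at most [n] strict steps; the
    recursion removes the top step. *)
Fixpoint len_le (X : lmodType S) (n : nat) (V U : X -> Prop) : Prop :=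
  if n is m.+1 then
    forall W, submod W -> (forall x, V x -> W x) -> (forall x, W x -> U x) ->
      ~ (forall x, U x -> W x) -> len_le m V W
  else forall x, U x -> V x.

End Submodules.

(** Strict chains are sent to strict chains. The scalars of the two modules may
    differ, so that lengths over an algebra and over its base ring can be
    compared. *)
Lemma len_le_transfer (S S' : pzRingType) (X : lmodType S) (Y : lmodType S')
    (V U : X -> Prop) (Phi : (X -> Prop) -> Y -> Prop) n :
  submod V -> submod U -> (forall x, V x -> U x) ->
  (forall W, submod W -> (forall x, V x -> W x) -> (forall x, W x -> U x) ->
     submod (Phi W)) ->
  (forall W W' : X -> Prop, (forall x, W x -> W' x) -> forall y, Phi W y -> Phi W' y) ->
  (forall W W', submod W -> submod W' -> (forall x, V x -> W x) ->
     (forall x, W x -> W' x) -> (forall x, W' x -> U x) ->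
     (forall y, Phi W' y -> Phi W y) -> forall x, W' x -> W x) ->
  len_le n (Phi V) (Phi U) -> len_le n V U.
Proof.
move=> hV + + + mono; elim: n U => [|n IH] U hU VU sub refl /= h.
  by apply: refl.
move=> W hW VW WU nUW; apply: IH => //.
- by move=> Z hZ VZ ZW; apply: sub => // x /ZW/WU.
- by move=> Z Z' hZ hZ' VZ ZZ' Z'W; apply: refl => // x /Z'W/WU.
- apply: h; [exact: sub | exact: mono | exact: mono |].
  by move=> h; apply: nUW; apply: refl.
Qed.

Section Length.
Variable S : pzRingType.
Implicit Types X Y : lmodType S.

Lemma len_le_ext X n (V V' U U' : X -> Prop) : (forall x, V x <-> V' x) ->
  (forall x, U x <-> U' x) -> len_le n V U -> len_le n V' U'.
Proof.
move=> hV hU; have -> : V' = V by apply: funext => x; apply/esym/propext.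
by have -> : U' = U by apply: funext => x; apply/esym/propext.
Qed.

Lemma len_leS X n (V U : X -> Prop) : len_le n V U -> len_le n.+1 V U.
Proof.
elim: n U => [|n IH] U /= h W hW VW WU nUW; first by case: nUW => x /h/VW.
by apply: IH; exact: h.
Qed.

Lemma len_leW X m n (V U : X -> Prop) : (m <= n)%N -> len_le m V U -> len_le n V U.
Proof. by move=> /subnK <-; elim: (n - m)%N => // k IH h; rewrite addSn; apply/len_leS/IH. Qed.

(** A strict chain from [V'] extends to a longer one from [V]. *)
Lemma len_le_bot X n (V V' U : X -> Prop) : submod V' -> submod U ->
  (forall x, V x -> V' x) -> (forall x, V' x -> U x) -> ~ (forall x, V' x -> V x) ->
  len_le n.+1 V U -> len_le n V' U.
Proof.
move=> hV' + VV' + nV; elim: n U => [|n IH] U hU V'U h.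
  move=> x Ux; apply: contrapT => nx; apply: nV; apply: (h V') => // h'.
  by apply: nx; exact: h'.
move=> W hW V'W WU nUW; apply: IH => //; apply: h => // x /VV'; exact: V'W.
Qed.

(** By the modular law, [Z |-> W + Z] is strictly monotone above [W /\ V]. *)
Lemma len_le_modular X n (W U V : X -> Prop) : submod W -> submod U -> submod V ->
  (forall x, W x -> U x) -> (forall x, V x -> U x) ->
  len_le n W U -> len_le n (fun x => W x /\ V x) V.
Proof.
move=> hW hU hV WU VU h.
have WV0 : W 0 /\ V 0 by split; [case: hW | case: hV].
apply: (len_le_transfer (Phi := addS W)) => //.
- exact: submodI.
- by move=> x [].
- by move=> Z hZ _ _; exact: submod_add.
- by move=> Z Z' ZZ' y [w [z [Ww Zz ->]]]; exists w, z; split=> //; exact: ZZ'.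
- move=> Z Z' hZ hZ' WVZ ZZ' Z'V sub x Z'x.
  have [|w [z [Ww Zz e]]] := sub x; first by exists 0, x; rewrite add0r; split=> //; case: hW.
  rewrite e; apply: submodD => //; apply: WVZ; split=> //.
  have -> : w = x - z by rewrite e addrK.
  by apply: submodB => //; apply: Z'V => //; exact: ZZ'.
- have bot x : W x <-> addS W (fun x => W x /\ V x) x.
    split=> [Wx|[w [v [Ww [Wv _] ->]]]]; last exact: submodD.
    by exists x, 0; rewrite addr0.
  apply: (len_le_ext (V := W) (U := addS W V)) => //.
  case: n h => [|n] h.
    by move=> x [w [v [Ww Vv ->]]]; apply: submodD => //; apply: h; exact: VU.
  move=> Z hZ WZ ZU nUZ; apply: h => // [x /ZU[w [v [Ww Vv ->]]]|UZ].
    by apply: submodD => //; [exact: WU | exact: VU].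
  apply: nUZ => x [w [v [Ww Vv ->]]]; apply: UZ; apply: submodD => //; [exact: WU | exact: VU].
Qed.

(** Induction on [a + b]: a proper submodule [Z] of [U] either contains [W], so
    that the upper interval gets shorter, or meets [W] in a proper submodule, and
    then the modular law bounds the interval from [W /\ Z] to [Z]. *)
Lemma len_le_trans X a b (V W U : X -> Prop) : submod V -> submod W -> submod U ->
  (forall x, V x -> W x) -> (forall x, W x -> U x) ->
  len_le a V W -> len_le b W U -> len_le (a + b) V U.
Proof.
move=> hV; elim: {a b}(a + b)%N {-2}a {-2}b (leqnn (a + b)) W U => [|n IH] a b ab W U hW hU VW WU ha hb.
  by move: ab ha hb; rewrite leqn0 addn_eq0 => /andP[/eqP-> /eqP->] /= ha hb x /hb/ha.
case abE : (a + b)%N => [|m].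
  by move/eqP: abE ha hb; rewrite addn_eq0 => /andP[/eqP-> /eqP->] /= ha hb x /hb/ha.
move=> Z hZ VZ ZU nUZ.
case: (EM (forall x, W x -> Z x)) => [WZ|nWZ].
  case: b hb abE ab => [|b] hb abE ab; first by case: nUZ => x /hb/WZ.
  have -> : m = (a + b)%N by move: abE; rewrite addnS => -[].
  apply: (IH _ _ _ W) => //; last exact: hb.
  by rewrite addnS ltnS in ab.
case: a ha abE ab => [|a] ha abE ab; first by case: nWZ => x /ha/VZ.
have -> : m = (a + b)%N by move: abE; rewrite addSn => -[].
have hWZ := submodI hW hZ.
apply: (IH _ _ _ (fun x => W x /\ Z x)) => //.
- by move=> x Vx; split; [exact: VW | exact: VZ].
- by move=> x [].
- by apply: ha => // [x Vx|x []//|h]; [split; [exact: VW | exact: VZ]|apply: nWZ => x /h[]].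
- exact: len_le_modular hb.
Qed.

Definition length_le (n : nat) X : Prop :=
  len_le n (fun x : X => x = 0) (fun _ => True).

Definition finite_length X : Prop := exists n, length_le n X.

Lemma length_leW m n X : (m <= n)%N -> length_le m X -> length_le n X.
Proof. exact: len_leW. Qed.

Lemma length_le0 X : length_le 0 X <-> zero_module X.
Proof. by split=> h x; [exact: h | move=> _; exact: h]. Qed.

Lemma length_le_sub n X (U : X -> Prop) : submod U -> length_le n X ->
  len_le n (fun x => x = 0) U.
Proof.
move=> hU; case: n => [|n] h; first by move=> x _; exact: h.
move=> W hW W0 WU nUW; apply: h => // h; by apply: nUW => x _; exact: h.
Qed.

Lemma len_le_image n X Y (i : {linear X -> Y}) : injective i ->
  len_le n (fun y => y = 0) (fun y => exists x, i x = y) -> length_le n X.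
Proof.
move=> ii h.
apply: (len_le_transfer (Phi := fun W y => exists2 x, W x & i x = y)).
- exact: submod0.
- exact: submod_full.
- by [].
- by move=> W hW _ _; exact: submod_image.
- by move=> W W' WW' y [x Wx <-]; exists x => //; exact: WW'.
- move=> W W' hW hW' _ _ _ h' x W'x.
  have [|z Wz /ii <- //] := h' (i x); by exists x.
apply: len_le_ext h => y.
  by split=> [->|[x -> <-]]; [exists 0; rewrite ?raddf0 | rewrite raddf0].
by split=> -[x]; [exists x | exists x].
Qed.

Lemma length_le_inj n X Y (i : {linear X -> Y}) : injective i ->
  length_le n Y -> length_le n X.
Proof. by move=> ii h; apply: len_le_image (ii) _; apply: length_le_sub h; exact: submod_range. Qed.

Lemma length_lt_inj n X Y (i : {linear X -> Y}) : injective i -> ~ surjective i ->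
  length_le n.+1 Y -> length_le n X.
Proof.
move=> ii ns h; apply: (len_le_image ii); apply: h => //.
- exact: submod_range.
- by move=> x ->; exists 0; rewrite raddf0.
- by move=> h; apply: ns => y; exact: h.
Qed.

Lemma len_le_quot n X Y (p : {linear X -> Y}) : surjective p ->
  len_le n (fun x => p x = 0) (fun _ => True) -> length_le n Y.
Proof.
move=> sp h.
apply: (len_le_transfer (Phi := fun W x => W (p x))) => //.
- exact: submod0.
- by move=> W hW _ _; exact: submod_preim.
- by move=> W W' WW' y; exact: WW'.
- by move=> W W' hW hW' _ _ _ h' y; have [x <-] := sp y; exact: h'.
Qed.

Lemma length_le_surj n X Y (p : {linear X -> Y}) : surjective p ->
  length_le n X -> length_le n Y.
Proof.
move=> sp h; apply: (len_le_quot sp).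
case: n h => [|n] h; first by move=> x _; rewrite (h x) ?raddf0.
case: (EM (forall x, p x = 0 -> x = 0)) => [inj|ninj].
  by apply: len_le_ext h => // x; split=> [->|/inj//]; rewrite raddf0.
apply: len_leS; apply: len_le_bot h => //; first exact: submod_ker.
by move=> x ->; rewrite raddf0.
Qed.

Lemma length_lt_surj n X Y (p : {linear X -> Y}) : surjective p -> ~ injective p ->
  length_le n.+1 X -> length_le n Y.
Proof.
move=> sp ninj h; apply: (len_le_quot sp).
apply: len_le_bot h => //; first exact: submod_ker.
  by move=> x ->; rewrite raddf0.
by move=> h; apply: ninj; exact: ker0_inj.
Qed.

(** ** Chain conditions *)

Lemma len_le_up X n (V V' U : X -> Prop) : submod V' -> submod U ->
  (forall x, V x -> V' x) -> (forall x, V' x -> U x) ->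
  len_le n V U -> len_le n V' U.
Proof.
move=> hV' hU VV' V'U h; case: (EM (forall x, V' x -> V x)) => [V'V|nV].
  by apply: len_le_ext h => // x; split; [exact: VV' | exact: V'V].
case: n h => [|n] h; first by move=> x /h/VV'.
by apply: len_leS; exact: len_le_bot h.
Qed.

Lemma submod_max X (Fam : (X -> Prop) -> Prop) : finite_length X ->
  (forall U, Fam U -> submod U) -> (exists U, Fam U) ->
  exists U, Fam U /\ forall W, Fam W -> (forall x, U x -> W x) -> forall x, W x -> U x.
Proof.
move=> [n hn] sub [U0 F0].
have : len_le n U0 (fun _ => True).
  by apply: len_le_up hn => //; [exact: sub | move=> x ->; case: (sub _ F0)].
elim: n {hn} U0 F0 => [|n IH] U FU h; first by exists U; split=> // W _ _ x _; exact: h.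
case: (EM (exists W, [/\ Fam W, forall x, U x -> W x & ~ forall x, W x -> U x])).
  move=> [W [FW UW nWU]]; apply: (IH W) => //.
  by apply: len_le_bot h => //; exact: sub.
move=> no; exists U; split=> // W FW UW; apply: contrapT => nWU.
by apply: no; exists W.
Qed.

(** A maximal finitely generated submodule is everything. *)
Lemma finite_length_fg X : finite_length X -> finitely_generated X.
Proof.
move=> fX.
pose spn (n : nat) (g : 'I_n -> X) x := exists a : 'I_n -> S, x = \sum_i a i *: g i.
have hspn n (g : 'I_n -> X) : submod (spn n g).
  split; first by exists (fun=> 0); rewrite big1 // => i _; rewrite scale0r.
  move=> c x y [a ->] [b ->]; exists (fun i => c * a i + b i).
  rewrite scaler_sumr -big_split /=; apply: eq_bigr => i _.
  by rewrite scalerDl scalerA.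
have [||U [[n [g ->]] mx]] := @submod_max X (fun U => exists n (g : 'I_n -> X), U = spn n g) fX.
- by move=> U [n [g ->]].
- by exists (spn 0 (fun=> 0)), 0%N, (fun=> 0).
exists n, g => x.
pose g' (i : 'I_n.+1) := oapp g x (unlift ord0 i).
apply: (mx (spn n.+1 g')).
- by exists n.+1, g'.
- move=> y [a ->]; exists (fun i => oapp a 0 (unlift ord0 i)).
  rewrite big_ord_recl /= /g' unlift_none /= scale0r add0r.
  by apply: eq_bigr => i _; rewrite liftK.
- exists (fun i => oapp (fun=> 0) 1 (unlift ord0 i)).
  rewrite big_ord_recl /= /g' unlift_none /= scale1r big1 ?addr0 // => i _.
  by rewrite liftK scale0r.
Qed.

End Length.

(** [V] is filtered by the partial sums of the images of the [mu i], and each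
    step of this filtration is a quotient of [B]. *)
Lemma length_le_sum (S : pzRingType) (B V : lmodType S) (N m : nat)
    (mu : 'I_m -> {linear B -> V}) : length_le N B ->
  (forall x, exists b : 'I_m -> B, x = \sum_i mu i (b i)) -> length_le (m * N) V.
Proof.
move=> hB gen.
pose W k x := exists b : 'I_m -> B, x = \sum_(i < m | (i < k)%N) mu i (b i).
have hW k : submod (W k).
  split; first by exists (fun=> 0); rewrite big1 // => i _; rewrite raddf0.
  move=> c x y [a ->] [b ->]; exists (fun i => c *: a i + b i).
  rewrite scaler_sumr -big_split /=; apply: eq_bigr => i _.
  by rewrite linearP.
have WS k x : W k x -> W k.+1 x.
  move=> [b ->]; exists (fun i : 'I_m => if (i < k)%N then b i else 0).
  rewrite big_mkcond [RHS]big_mkcond /=; apply: eq_bigr => i _.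
  by case: ltnP => ik; [rewrite ltnW // ltnS ltnW | rewrite raddf0 if_same].
have step k : (k <= m)%N -> len_le (k * N) (fun x : V => x = 0) (W k).
  elim: k => [_|k IH km]; first by move=> x [b ->]; rewrite big1 // => i; rewrite ltn0.
  rewrite mulSn addnC; apply: (len_le_trans (W := W k)) => //.
  - exact: submod0.
  - by move=> x ->; case: (hW k).
  - exact: WS.
  - by apply: IH; exact: ltnW.
  pose i0 := Ordinal km.
  have decomp x : W k.+1 x -> exists b y, W k y /\ x = mu i0 b + y.
    move=> [b ->]; exists (b i0), (\sum_(i < m | (i < k)%N) mu i (b i)); split; first by exists b.
    rewrite (bigD1 i0) //=; congr (_ + _); apply: eq_bigl => i.
    by rewrite ltnS [RHS]ltn_neqAle andbC.
  apply: (len_le_transfer (Phi := fun Z b => Z (mu i0 b))) => //.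
  - exact: WS.
  - by move=> Z hZ _ _; exact: submod_preim.
  - by move=> Z Z' h b; exact: h.
  - move=> Z Z' hZ hZ' WZ ZZ' Z'W h x Z'x; have [b [y [Wy e]]] := decomp _ (Z'W _ Z'x).
    rewrite e; apply: submodD => //; last exact: WZ.
    apply: h; have -> : mu i0 b = x - y by rewrite e addrK.
    by apply: submodB => //; apply: ZZ'; exact: WZ.
  apply: len_le_up (_ : len_le N (fun b => b = 0) _).
  - exact: submod_preim.
  - exact: submod_preim.
  - by move=> b ->; rewrite raddf0; case: (hW k).
  - by move=> b; exact: WS.
  - by apply: length_le_sub => //; exact: submod_preim.
apply: len_le_ext (step m (leqnn m)) => // x; split=> // _.
by have [b ->] := gen x; exists b; apply: eq_bigl => i; rewrite ltn_ord.
Qed.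

(** * Artin algebras have finite length *)

Section ArtinianRing.
Variable k : comPzRingType.
Hypothesis hk : artinian_ring k.

Lemma artinian_min (Fam : (k -> Prop) -> Prop) :
  (forall I, Fam I -> ideal I) -> (exists I, Fam I) ->
  exists I, Fam I /\ forall J, Fam J -> (forall x, J x -> I x) -> forall x, I x -> J x.
Proof.
move=> hFam [I0 F0]; apply: contrapT => no.
have /choice[nxt hnxt] (I : {I | Fam I}) : exists J : {J | Fam J},
    (forall x, sval J x -> sval I x) /\ ~ (forall x, sval I x -> sval J x).
  apply: contrapT => h; apply: no; exists (sval I); split; first by case: I {h}.
  move=> J FJ JI; apply: contrapT => nIJ; apply: h; by exists (exist _ J FJ).
pose c n := iter n nxt (exist _ I0 F0).
have [] := hk (I := fun n => sval (c n)).
- by move=> n; apply: hFam; case: (c n).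
- by move=> n x; exact: (hnxt (c n)).1.
- move=> m hm; apply: (hnxt (c m)).2 => x; apply: (hm m.+1); exact: leqnSn.
Qed.

(** Let [I] be minimal among the ideals of infinite length. For every [a], one of
    [a I] and the kernel of [a] on [I] has infinite length, since [I] has, so it
    is [I]: every [a] acts on [I] as zero or surjectively. As the chain of the
    [a ^+ n] stops modulo the annihilator of [I], every [a] not annihilating [I]
    has an inverse on [I]. So [I] is a vector space; its finitely generated
    subspaces have finite length and are thus proper, which yields an infinite
    independent sequence, whose tails span a strictly decreasing sequence of
    ideals. *)
Lemma artinian_ring_finite_length : finite_length (k^o : lmodType k).
Proof.
pose fin (I : k -> Prop) := exists n, @len_le k k^o n (fun x => x = 0) I.
apply: contrapT => nfin.
have [I [[hI nI] minI]] : exists I, (ideal I /\ ~ fin I) /\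
    forall J, ideal J /\ ~ fin J -> (forall x, J x -> I x) -> forall x, I x -> J x.
  apply: artinian_min => [I []//|]; exists (fun=> True); split=> //.
have finI (J : k -> Prop) : ideal J -> (forall x, J x -> I x) -> ~ (forall x, I x -> J x) -> fin J.
  by move=> hJ JI nIJ; apply: contrapT => nJ; apply: nIJ; exact: minI.
have sI : submod (V := k^o) I by [].
pose ann a := forall x, I x -> a * x = 0.
have divI a : ~ ann a -> forall y, I y -> exists2 x, I x & a * x = y.
  move=> na; apply: contrapT => nsur; apply: nI.
  have hK : ideal (fun x => I x /\ a * x = 0).
    split=> [|c x y [Ix ax] [Iy ay]]; first by split; [case: hI | rewrite mulr0].
    split; first exact: hI.2.
    by rewrite mulrDr ay addr0 mulrCA ax mulr0.
  have haI : ideal (fun y => exists2 x, I x & a * x = y).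
    split=> [|c _ _ [x Ix <-] [y Iy <-]]; first by exists 0; [case: hI | rewrite mulr0].
    by exists (c * x + y); [exact: hI.2 | rewrite mulrDr mulrCA].
  have [|h|m hm] := finI _ hK; first by move=> x [].
    by apply: na => x /h[].
  have [_ [x Ix <-]||n hn] := finI _ haI.
    by rewrite -[_ * _]addr0; apply: hI.2 => //; case: hI.
    exact: nsur.
  exists (m + n)%N; apply: (len_le_trans (W := fun x : k^o => I x /\ a * x = 0)) => //.
  - exact: submod0.
  - by move=> x ->; split; [case: hI | rewrite mulr0].
  - by move=> x [].
  apply: (@len_le_transfer k k k^o k^o _ _ (fun Z y => exists2 x, Z x & a * x = y)) => //.
  - by move=> x [].
  - move=> Z hZ _ _; split=> [|c _ _ [x Zx <-] [y Zy <-]]; first by exists 0; [case: hZ | rewrite mulr0].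
    by exists (c *: x + y); [exact: hZ.2 | rewrite mulrDr mulrCA].
  - by move=> Z Z' h y [x Zx <-]; exists x => //; exact: h.
  - move=> Z Z' hZ hZ' KZ ZZ' Z'I h x Z'x.
    have [|z Zz e] := h (a * x); first by exists x.
    rewrite -[x](subrK z); apply: submodD => //; apply: KZ; split.
      by apply: (submodB sI); [exact: Z'I | apply: Z'I; exact: ZZ'].
    by rewrite mulrBr e subrr.
  apply: len_le_ext hn => // y.
  by split=> [->|[x [_ ->] <-] //]; exists 0; [split; [case: hI | rewrite mulr0] | rewrite mulr0].
have invI a : ~ ann a -> exists b, forall x, I x -> b * (a * x) = x.
  move=> na.
  have [|n x [c [p [hp ->]]]|m hm] := hk (I := fun n x => exists c p, ann p /\ x = a ^+ n * c + p).
  - move=> n; split; first by exists 0, 0; split=> [x _|]; rewrite ?mul0r // mulr0 addr0.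
    move=> d _ _ [c [p [hp ->]]] [c' [p' [hp' ->]]].
    exists (d * c + c'), (d * p + p'); split=> [x Ix|].
      by rewrite mulrDl -mulrA hp // hp' // mulr0 addr0.
    by rewrite !mulrDr mulrCA addrACA.
  - by exists (a * c), p; split=> //; rewrite mulrA -exprSr.
  have [||b [p [hp e]]] := hm m.+1 (a ^+ m); first exact: leqnSn.
    by exists 1, 0; split=> [x _|]; rewrite ?mul0r // mulr1 addr0.
  exists b => y Iy.
  have [x Ix <-] : exists2 x, I x & a ^+ m * x = y.
    elim: {hm e} m y Iy => [|m IH] y Iy; first by exists y; rewrite ?expr0 ?mul1r.
    have [z Iz <-] := divI a na y Iy; have [x Ix <-] := IH z Iz.
    by exists x => //; rewrite exprS mulrA.
  have -> : b * (a * (a ^+ m * x)) = (a ^+ m.+1 * b + p) * x.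
    by rewrite mulrDl hp // addr0 exprS; rewrite !mulrA; congr (_ * _); rewrite -!mulrA mulrC -mulrA.
  by rewrite -e.
(* [x n] is a vector of [I] outside of [E n], the span of its predecessors. *)
have /choice[pick hpick] (E : k -> Prop) : exists x, ~ (forall x, I x -> E x) -> I x /\ ~ E x.
  case: (EM (exists x, I x /\ ~ E x)) => [[x hx]|no]; first by exists x.
  by exists 0 => h; case: h => x Ix; apply: contrapT => nE; apply: no; exists x.
pose E := fix E n := if n is m.+1 then fun y => exists z c, E m z /\ y = z + c * pick (E m)
                     else fun y => y = 0.
pose x n := pick (E n).
have EI n : [/\ ideal (E n), forall y, E n y -> I y & I (x n) /\ ~ E n (x n)].
  have step (F : k -> Prop) : ideal F -> (forall y, F y -> I y) -> fin F -> I (pick F) /\ ~ F (pick F).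
    by move=> hF FI [m hm]; apply: hpick => IF; apply: nI; exists m; apply: len_le_ext hm => // y; split; [exact: FI | exact: IF].
  have : [/\ ideal (E n), forall y, E n y -> I y & fin (E n)].
    elim: n => [|n [hE EI [m hm]]].
      by split=> [|y ->|]; [exact: (submod0 k^o) | case: hI | exists 0%N].
    have [Ix nEx] := step _ hE EI (ex_intro _ m hm).
    have hE' : ideal (E n.+1).
      split=> [|d _ _ [z [c [Ez ->]]] [z' [c' [Ez' ->]]]].
        by exists 0, 0; split; [case: hE | rewrite mul0r addr0].
      exists (d * z + z'), (d * c + c'); split; first exact: hE.2.
      by rewrite mulrDl !mulrDr mulrA addrACA.
    have sE : submod (V := k^o) (E n) by [].
    split=> //.
      move=> _ [z [c [Ez ->]]]; apply: (submodD sI); first exact: EI.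
      exact: (submodZ sI c Ix).
    exists (m + 1)%N; apply: (len_le_trans (W := (E n : k^o -> Prop))) => //.
    - exact: submod0.
    - by move=> y ->; case: hE.
    - by move=> y Ey; exists y, 0; rewrite mul0r addr0.
    move=> Z hZ EZ ZE' nE'Z y Zy.
    have [z [c [Ez e]]] := ZE' _ Zy.
    have Zcx : Z (c * pick (E n)).
      by have -> : c * pick (E n) = y - z; [rewrite e addrC addKr | apply: submodB => //; exact: EZ].
    case: (EM (ann c)) => [ac|nc]; first by rewrite e ac // addr0.
    have [b hb] := invI _ nc.
    case: nE'Z => _ [z' [c' [Ez' ->]]]; apply: (submodD hZ); first exact: EZ.
    rewrite -(hb _ Ix); have := submodZ hZ (c' * b) Zcx.
    by rewrite /GRing.scale /= mulrA.
  by case=> hE EI' fE; split=> //; exact: step.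
(* The ideals spanned by the [x j] with [m <= j < N]; their union over [N] is the
   decreasing sequence of ideals. *)
pose T m N y := exists c : nat -> k, y = \sum_(m <= j < N) c j * x j.
have T0 n y : T 0%N n y -> E n y.
  move=> [c ->]; elim: n => [|n IH]; first by rewrite big_geq.
  by rewrite big_nat_recr //=; exists (\sum_(0 <= j < n) c j * x j), (c n).
have Tmono m N N' y : (N <= N')%N -> T m N y -> T m N' y.
  move=> /subnK <-; elim: (N' - N)%N => // d IH /IH [c ->]; rewrite addSn.
  exists (fun j => if j == (d + N)%N then 0 else c j).
  case: (leqP m (d + N)) => h; last by rewrite !big_geq // ltnW.
  rewrite [RHS]big_nat_recr //= eqxx mul0r addr0.
  by apply: eq_big_nat => j /andP[_ jd]; rewrite ltn_eqF.
have [||m hm] := hk (I := fun m y => exists N, T m N y).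
- move=> m; split; first by exists 0%N, (fun=> 0); rewrite big1 // => j _; rewrite mul0r.
  move=> d y z [N1 h1] [N2 h2].
  have [c1 ->] := Tmono _ _ _ _ (leq_maxl N1 N2) h1.
  have [c2 ->] := Tmono _ _ _ _ (leq_maxr N1 N2) h2.
  exists (maxn N1 N2), (fun j => d * c1 j + c2 j).
  rewrite mulr_sumr -big_split /=; apply: eq_bigr => j _.
  by rewrite mulrDl mulrA.
- move=> m y [N [c ->]]; exists N, (fun j => if j == m then 0 else c j).
  case: (leqP N m) => h; first by rewrite !big_geq // ltnW.
  rewrite [RHS]big_ltn // eqxx mul0r add0r.
  by apply: eq_big_nat => j /andP[jm _]; rewrite gtn_eqF.
have [||N hN] := hm m.+1 (x m); first exact: leqnSn.
  by exists m.+1, (fun=> 1); rewrite big_nat1 mul1r.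
have Enle i j y : (i <= j)%N -> E i y -> E j y.
  move=> /subnK <-; elim: (j - i)%N => // d IH /IH h; rewrite addSn.
  by exists y, 0; rewrite mul0r addr0.
(* In a relation expressing [x m] by later vectors, the last vector with a
   coefficient not annihilating [I] depends on the previous ones. *)
elim: N hN => [|N IH] [c e].
  by case: (EI m) => _ _ [_]; apply; rewrite e big_geq //; case: (EI m) => -[].
case: (leqP m.+1 N) => h; last first.
  by case: (EI m) => _ _ [_]; apply; rewrite e big_geq //; case: (EI m) => -[].
rewrite big_nat_recr //= in e.
have [_ _ [IxN nExN]] := EI N.
case: (EM (ann (c N))) => [ac|nc].
  by apply: IH; exists c; rewrite {1}e ac // addr0.
have [b hb] := invI _ nc; apply: nExN; rewrite -(hb _ IxN).
have [sE _ _] := EI N.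
have -> : c N * x N = x m - \sum_(m.+1 <= i < N) c i * x i by rewrite e [RHS]addrC addKr.
apply: (submodZ (V := k^o)) => //; apply: (submodB (V := k^o)) => //.
  by apply: (Enle m.+1) => //; exists 0, 1; rewrite mul1r add0r; split=> //; case: (EI m) => -[].
apply: T0; exists (fun j => if (j < m.+1)%N then 0 else c j).
rewrite [RHS](big_cat_nat (n := m.+1)) //=.
rewrite [X in X + _]big_nat_cond [X in X + _]big1 ?add0r; last first.
  by move=> j /andP[/andP[_ ->] _]; rewrite mul0r.
by apply: eq_big_nat => j /andP[jm _]; rewrite ltnNge jm.
Qed.

End ArtinianRing.

Section RestrictScalars.
Variables (k : comPzRingType) (A : algType k) (X : lmodType A^c).

Definition restrict_scalars : Type := X.
HB.instance Definition _ := GRing.Zmodule.on restrict_scalars.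

Definition restricted_scale (c : k) (x : restrict_scalars) : restrict_scalars :=
  ((c%:A : A) : A^c) *: (x : X).

Lemma restricted_scaleA a b v :
  restricted_scale a (restricted_scale b v) = restricted_scale (a * b) v.
Proof.
rewrite /restricted_scale scalerA; congr (_ *: _).
by rewrite /GRing.mul /= mulr_algl scalerA mulrC.
Qed.
Lemma restricted_scale1 : left_id 1 restricted_scale.
Proof. by move=> v; rewrite /restricted_scale scale1r; exact: scale1r. Qed.
Lemma restricted_scaleDr : right_distributive restricted_scale +%R.
Proof. by move=> c x y; rewrite /restricted_scale; exact: scalerDr. Qed.
Lemma restricted_scaleDl v : {morph restricted_scale^~ v : a b / a + b}.
Proof. by move=> a b; rewrite /restricted_scale scalerDl; exact: scalerDl. Qed.

HB.instance Definition _ := GRing.Zmodule_isLmodule.Build k restrict_scalars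
  restricted_scaleA restricted_scale1 restricted_scaleDr restricted_scaleDl.

Lemma restricted_scaleE (c : k) (x : restrict_scalars) :
  c *: x = ((c%:A : A) : A^c) *: (x : X).
Proof. by []. Qed.

End RestrictScalars.

Section ArtinAlgebra.
Variables (k : comPzRingType) (A : algType k).
Hypothesis hA : artin_algebra A.

Lemma artin_algebra_length : finite_length (A : lmodType k).
Proof.
have [/artinian_ring_finite_length[N hN] [m [g hg]]] := hA.
have lin i : linear (fun c : k^o => c *: g i).
  by move=> a x y; rewrite scalerDl scalerA.
exists (m * N)%N.
by apply: (length_le_sum (mu := fun i => linear_map_of (lin i)) hN) => x.
Qed.

Lemma restrict_scalars_length (X : lmodType A^c) : finitely_generated X ->
  finite_length (restrict_scalars X).
Proof.
have [N hN] := artin_algebra_length; move=> [m [g hg]].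
have lin i : linear (fun a : A => ((a : A^c) *: g i : restrict_scalars X)).
  move=> c a b; rewrite [LHS]scalerDl; congr (_ + _).
  have e : ((c *: a : A) : A^c) = ((c%:A : A) : A^c) * (a : A^c).
    by rewrite /GRing.mul /= mulr_algr.
  by rewrite restricted_scaleE e; exact/esym/(@scalerA _ X).
exists (m * N)%N.
by apply: (length_le_sum (mu := fun i => linear_map_of (lin i)) hN) => x.
Qed.

Lemma artin_algebra_finite_length (X : lmodType A^c) : finitely_generated X ->
  finite_length X.
Proof.
move=> /restrict_scalars_length[n hn]; exists n.
apply: (@len_le_transfer _ _ X (restrict_scalars X) _ _ (fun W => W)) => //.
- exact: submod0.
- by move=> W [W0 hW] _ _; split=> // c x y; exact: hW.
Qed.

Lemma central_scaleC (Y : lmodType A^c) (c : k) (a : A^c) (y : Y) :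
  ((c%:A : A) : A^c) *: (a *: y) = a *: (((c%:A : A) : A^c) *: y).
Proof.
rewrite !scalerA; congr (_ *: _).
by rewrite /GRing.mul /= mulr_algl mulr_algr.
Qed.

Lemma central_scale_linear (Y : lmodType A^c) (c : k) :
  linear (fun y : Y => ((c%:A : A) : A^c) *: y).
Proof.
by move=> a x y; rewrite scalerDr central_scaleC.
Qed.

(** Evaluation at generators of [X] embeds [Hom(X, Y)] into a power of [Y], which
    has finite length over [k]. So [Hom(X, Y)] is finitely generated over [k], and
    scalars of [k] act on [Y] by endomorphisms. *)
Lemma artin_algebra_hom_fg (X Y : fgmod A) :
  exists (q : nat) (fs : 'I_q -> {linear X -> Y}), forall f : {linear X -> Y},
    exists th : 'I_q -> {linear Y -> Y}, forall x, f x = \sum_i th i (fs i x).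
Proof.
have [m [g hg]] := fgmodP X.
have [N hN] := restrict_scalars_length (fgmodP Y).
pose F := {ffun 'I_m -> restrict_scalars Y} : lmodType k.
have linE i : linear (fun y : restrict_scalars Y => [ffun j => if j == i then y else 0] : F).
  move=> a x y; apply/ffunP => j; rewrite !ffunE; case: eqP => // _.
  by rewrite scaler0 addr0.
have hF : length_le (m * N) F.
  apply: (length_le_sum (mu := fun i => linear_map_of (linE i)) hN) => v.
  exists v; apply/ffunP => j; rewrite sum_ffunE (bigD1 j) //= ffunE eqxx big1 ?addr0 // => i ij.
  by rewrite ffunE eq_sym (negPf ij).
pose W (v : F) := exists f : {linear X -> Y}, forall i, v i = f (g i).
have hW : submod W.
  split; first by exists \0 => i; rewrite ffunE.
  move=> c v w [f hf] [f' hf']; exists (((linear_map_of (central_scale_linear (Y:=Y) c)) \o f) \+ f') => i.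
  by rewrite !ffunE hf hf'.
have [K [iota [ii iE]]] := submod_object hW.
have [q [u hu]] := finite_length_fg (ex_intro (fun n => length_le n K) _ (length_le_inj ii hF)).
have /choice[fs hfs] a : W (iota (u a)) by apply/iE; exists (u a).
exists q, fs => f.
have [y hy] : exists y, iota y = [ffun i => f (g i)] by apply/iE; exists f => i; rewrite ffunE.
have [c ey] := hu y.
exists (fun a => linear_map_of (central_scale_linear (Y:=Y) (c a))).
have key i : f (g i) = \sum_a linear_map_of (central_scale_linear (Y:=Y) (c a)) (fs a (g i)).
  have := congr1 (fun v : F => v i) hy; rewrite ffunE => <-.
  rewrite ey linear_sum sum_ffunE; apply: eq_bigr => a _.
  by rewrite linearZ ffunE hfs.
move=> x; have [b ->] := hg x; rewrite linear_sum.
under [RHS]eq_bigr do rewrite !linear_sum.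
rewrite [RHS]exchange_big /=; apply: eq_bigr => i _.
rewrite linearZ key /= scaler_sumr; apply: eq_bigr => a _.
by rewrite linearZ; exact/esym/central_scaleC.
Qed.

End ArtinAlgebra.

(** * Torsion pairs *)

Lemma finitely_generated_surj (S : pzRingType) (X Y : lmodType S)
    (p : {linear X -> Y}) :
  surjective p -> finitely_generated X -> finitely_generated Y.
Proof.
move=> sp [n [g hg]]; exists n, (p \o g) => y; have [x <-] := sp y.
have [a ->] := hg x; exists a; rewrite linear_sum; apply: eq_bigr => i _.
by rewrite linearZ.
Qed.

Lemma finitely_generated_prod (S : pzRingType) (X Y : lmodType S) :
  finitely_generated X -> finitely_generated Y ->
  finitely_generated (X * Y : lmodType S)%type.
Proof.
move=> [m [g hg]] [n [h hh]].
exists (m + n)%N, (fun i => match split i with inl j => (g j, 0) | inr j => (0, h j) end) => -[x y].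
have [a ->] := hg x; have [b ->] := hh y.
exists (fun i => match split i with inl j => a j | inr j => b j end).
have el i : split (lshift n i) = inl i := unsplitK (inl i).
have er i : split (rshift m i) = inr i := unsplitK (inr i).
rewrite big_split_ord /=.
transitivity (\sum_(i < m) a i *: ((g i, 0) : X * Y) + \sum_(i < n) b i *: ((0, h i) : X * Y));
  last by congr (_ + _); apply: eq_bigr => i _; rewrite ?el ?er.
have -> : \sum_(i < m) a i *: ((g i, 0) : X * Y) = (\sum_i a i *: g i, 0).
  elim/big_rec2: _ => // i u v _ ->.
  by congr (_, _); rewrite /= ?scaler0 ?addr0.
have -> : \sum_(i < n) b i *: ((0, h i) : X * Y) = (0, \sum_i b i *: h i).
  elim/big_rec2: _ => // i u v _ ->.
  by congr (_, _); rewrite /= ?scaler0 ?addr0.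
by congr (_, _); rewrite /= ?addr0 ?add0r.
Qed.

Section Products.
Variable R : pzRingType.
Implicit Types X Y Z : fgmod R.

Definition prod_fg X Y : fgmod R :=
  FgMod (finitely_generated_prod (fgmodP X) (fgmodP Y)).

Definition prod_fst X Y : {linear prod_fg X Y -> X} := fst.
Definition prod_snd X Y : {linear prod_fg X Y -> Y} := snd.

Lemma prod_pair_linear X Y Z (f : {linear Z -> X}) (g : {linear Z -> Y}) :
  linear (fun z => (f z, g z) : prod_fg X Y).
Proof. by move=> a x y; rewrite !linearP. Qed.
Definition prod_pair X Y Z (f : {linear Z -> X}) (g : {linear Z -> Y}) :
  {linear Z -> prod_fg X Y} := linear_map_of (prod_pair_linear f g).

Definition prod_inl X Y : {linear X -> prod_fg X Y} := prod_pair idfun \0.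
Definition prod_inr X Y : {linear Y -> prod_fg X Y} := prod_pair \0 idfun.

Definition prod_copair X Y Z (f : {linear X -> Z}) (g : {linear Y -> Z}) :
  {linear prod_fg X Y -> Z} := (f \o prod_fst X Y) \+ (g \o prod_snd X Y).

Lemma prod_snd_surj X Y : surjective (prod_snd X Y).
Proof. by move=> y; exists (0, y). Qed.

Lemma prod_exact X Y : exact (prod_inl X Y) (prod_snd X Y).
Proof. by move=> [x y] /=; split=> [->|[z [_ <-]]//]; exists x. Qed.

End Products.

Definition finite_length_ring (R : pzRingType) : Prop :=
  forall X : lmodType R^c, finitely_generated X -> finite_length X.

Section TorsionPairs.
Variable R : pzRingType.
Implicit Types (X Y K Q T F : fgmod R) (t u : torsion_pair R).

Lemma fg_quot X (U : X -> Prop) : submod U ->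
  exists Q (p : {linear X -> Q}), surjective p /\ forall x, p x = 0 <-> U x.
Proof.
move=> hU; have [Q [p [sp hp]]] := quot_object hU.
by exists (FgMod (finitely_generated_surj sp (fgmodP X))), p.
Qed.

Lemma tors_char t X : tors t X <-> forall F, tfree t F -> zero_hom X F.
Proof.
split=> [tX F fF|h]; first exact: torsion_pair_hom tX fF.
have [T [F [i [p [tT fF ii sp ex]]]]] := torsion_pair_ses t X.
apply: tors_iso tT; exists i; apply: surj_inj_bij => // x.
by apply/ex; exact: h.
Qed.

Lemma tfree_char t X : tfree t X <-> forall T, tors t T -> zero_hom T X.
Proof.
split=> [fX T tT|h]; first exact: torsion_pair_hom tT fX.
have [T [F [i [p [tT fF ii sp ex]]]]] := torsion_pair_ses t X.
apply: tfree_iso (fF); apply: iso_sym; exists p; apply: surj_inj_bij => //.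
by apply: ker0_inj => x /ex[y <-]; exact: h.
Qed.

Lemma zero_hom_surj X Y F (p : {linear X -> Y}) :
  surjective p -> zero_hom X F -> zero_hom Y F.
Proof. by move=> sp h f y; have [x <-] := sp y; exact: (h (f \o p)). Qed.

Lemma zero_hom_inj T X Y (i : {linear X -> Y}) :
  injective i -> zero_hom T Y -> zero_hom T X.
Proof. by move=> ii h f x; apply: (inj0 ii); exact: (h (i \o f)). Qed.

Lemma zero_hom_extl K X Q F (i : {linear K -> X}) (p : {linear X -> Q}) :
  surjective p -> exact i p -> zero_hom K F -> zero_hom Q F -> zero_hom X F.
Proof.
move=> sp ex hK hQ f x.
have [|g <-] := factor_surj (f := f) sp; last exact: hQ.
by move=> y /ex[z <-]; exact: (hK (f \o i)).
Qed.

Lemma zero_hom_extr T K X Q (i : {linear K -> X}) (p : {linear X -> Q}) :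
  injective i -> exact i p -> zero_hom T K -> zero_hom T Q -> zero_hom T X.
Proof.
move=> ii ex hK hQ f x.
have [|g <-] := factor_inj (f := f) ii; last by rewrite hK raddf0.
by move=> y; apply/ex; exact: (hQ (p \o f)).
Qed.

Lemma zero_hom0l X Y : zero_module X -> zero_hom X Y.
Proof. by move=> h f x; rewrite (h x) raddf0. Qed.

Lemma zero_hom0r X Y : zero_module Y -> zero_hom X Y.
Proof. by move=> h f x. Qed.

Lemma tors_surj t X Y (p : {linear X -> Y}) : surjective p -> tors t X -> tors t Y.
Proof.
by move=> sp /tors_char h; apply/tors_char => F fF; apply: zero_hom_surj sp (h F fF).
Qed.

Lemma tfree_inj t X Y (i : {linear X -> Y}) : injective i -> tfree t Y -> tfree t X.
Proof.
by move=> ii /tfree_char h; apply/tfree_char => T tT; apply: zero_hom_inj ii (h T tT).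
Qed.

Lemma tors_ext t K X Q (i : {linear K -> X}) (p : {linear X -> Q}) :
  surjective p -> exact i p -> tors t K -> tors t Q -> tors t X.
Proof.
move=> sp ex /tors_char hK /tors_char hQ; apply/tors_char => F fF.
exact: zero_hom_extl sp ex (hK F fF) (hQ F fF).
Qed.

Lemma tfree_ext t K X Q (i : {linear K -> X}) (p : {linear X -> Q}) :
  injective i -> exact i p -> tfree t K -> tfree t Q -> tfree t X.
Proof.
move=> ii ex /tfree_char hK /tfree_char hQ; apply/tfree_char => T tT.
exact: zero_hom_extr ii ex (hK T tT) (hQ T tT).
Qed.

Lemma tors0 t X : zero_module X -> tors t X.
Proof. by move=> h; apply/tors_char => F _; exact: zero_hom0l. Qed.

Lemma tfree0 t X : zero_module X -> tfree t X.
Proof. by move=> h; apply/tfree_char => T _; exact: zero_hom0r. Qed.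

Lemma tors_tfree t X : tors t X -> tfree t X -> zero_module X.
Proof. by move=> tX fX x; exact: (torsion_pair_hom tX fX idfun). Qed.

Lemma tors_prod t X Y : tors t X -> tors t Y -> tors t (prod_fg X Y).
Proof. exact: tors_ext (@prod_snd_surj _ _ _) (@prod_exact _ _ _). Qed.

Lemma torsion_pair_le_tfree t u : torsion_pair_le t u <->
  forall X, tfree u X -> tfree t X.
Proof.
split=> h X.
  by move=> /tfree_char hX; apply/tfree_char => T /h; exact: hX.
by move=> /tors_char hX; apply/tors_char => F /h; exact: hX.
Qed.

Lemma torsion_pair_ext t u : (forall X, tors t X <-> tors u X) -> t = u.
Proof.
move=> h.
have h' X : tfree t X <-> tfree u X.
  split; apply: (torsion_pair_le_tfree _ _).1 => Y; first exact: (h Y).2.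
  exact: (h Y).1.
case: t u h h' => [T F a1 a2 a3 a4] [T' F' b1 b2 b3 b4] /= h h'.
have e : T = T' by apply: funext => X; exact: propext.
have e' : F = F' by apply: funext => X; exact: propext.
by subst T' F'; congr TorsionPair; exact: Prop_irrelevance.
Qed.

Lemma torsion_pair_po : partial_order (@torsion_pair_le R).
Proof.
split=> [t X //|t u v h1 h2 X /h1/h2 //|t u h1 h2].
by apply: torsion_pair_ext => X; split; [exact: h1 | exact: h2].
Qed.

Hypothesis fl : finite_length_ring R.

Lemma fg_sub X (U : X -> Prop) : submod U ->
  exists K (i : {linear K -> X}), injective i /\ forall x, U x <-> exists y, i y = x.
Proof.
move=> hU; have [K [i [ii iE]]] := submod_object hU.
have fK : finitely_generated K.
  by have [n hn] := fl (fgmodP X); apply: finite_length_fg; exists n; exact: length_le_inj ii hn.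
by exists (FgMod fK), i.
Qed.

Lemma fg_length X : finite_length X.
Proof. exact: fl (fgmodP X). Qed.

(** By the ascending chain condition, every module has a submodule [U] maximal
    among those in [C]. A map from a module of [C] to the quotient by [U] is zero,
    since the preimage of its image is an extension of that image by [U]. *)
Lemma torsion_pair_of_class (C : fgmod R -> Prop) :
  (forall X Y (p : {linear X -> Y}), surjective p -> C X -> C Y) ->
  (forall K X Q (i : {linear K -> X}) (p : {linear X -> Q}),
     surjective p -> exact i p -> C K -> C Q -> C X) ->
  (forall X, zero_module X -> C X) ->
  exists t, forall X, tors t X <-> C X.
Proof.
move=> cq ce c0.
pose D F := forall T, C T -> zero_hom T F.
suff [t e] : exists t, tors t = C by exists t => X; rewrite e.
unshelve eexists (@TorsionPair R C D _ _ _ _) => //.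
- by move=> X Y [f fb]; apply: cq; exact: (bij_surj fb).
- by move=> X Y /iso_sym[f fb] dX T cT; apply: zero_hom_inj (bij_inj fb) (dX T cT).
- by move=> T F cT dF; exact: dF.
move=> X.
pose Fam (U : X -> Prop) := submod U /\ exists K (i : {linear K -> X}),
  [/\ injective i, forall x, U x <-> exists y, i y = x & C K].
have [||U [[hU [K [i [ii iE cK]]]] mx]] := submod_max (Fam := Fam) (fg_length X).
- by move=> U [].
- have [K [i [ii iE]]] := fg_sub (@submod0 _ X).
  exists (fun x => x = 0); split; first exact: submod0.
  exists K, i; split=> //; apply: c0 => y; apply: (inj0 ii).
  by apply/iE; exists y.
have [Q [p [sp pE]]] := fg_quot hU.
exists K, Q, i, p; split=> //; last by move=> x; rewrite pE iE.
move=> T cT f z.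
pose U' x := exists w, f w = p x.
have hU' : submod U'.
  split=> [|a x y [w hw] [w' hw']]; first by exists 0; rewrite !raddf0.
  by exists (a *: w + w'); rewrite !linearP hw hw'.
have UU' x : U x -> U' x by move=> /pE e; exists 0; rewrite e raddf0.
suff U'U : forall x, U' x -> U x.
  by have [x e] := sp (f z); rewrite -e; apply/pE/U'U; exists z.
apply: mx => //; split=> //.
have [K' [i' [ii' iE']]] := fg_sub hU'.
exists K', i'; split=> //.
have [I [j [ij jE]]] := fg_sub (submod_range f).
have cI : C I.
  have [|g hg] := factor_inj (f := f) ij; first by move=> w; apply/jE; exists w.
  apply: (cq _ _ g) cT => y; have [w e] := (jE (j y)).2 (ex_intro _ y erefl).
  by exists w; apply: ij; rewrite hg.
have [|a ha] := factor_inj (f := i) ii'.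
  by move=> y; apply/iE'/UU'/iE; exists y.
have [|b hb] := factor_inj (f := p \o i') ij.
  by move=> y /=; apply/jE; apply/iE'; exists y.
apply: (ce _ _ _ a b) => //.
- move=> y; have [w hw] := (jE (j y)).2 (ex_intro _ y erefl); have [x hx] := sp (j y).
  have [y' hy'] : exists y', i' y' = x by apply/iE'; exists w; rewrite hw hx.
  by exists y'; apply: ij; rewrite hb /= hy' hx.
- move=> y; split=> [e|[x <-]].
    have : U (i' y) by apply/pE; rewrite -[LHS]hb e raddf0.
    by case/iE => x hx; exists x; apply: ii'; rewrite ha hx.
  apply: (inj0 ij); rewrite hb /= ha; apply/pE/iE; by exists x.
Qed.

Lemma tors_meet_exists (S : torsion_pair R -> Prop) :
  exists m, forall X, tors m X <-> forall t, S t -> tors t X.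
Proof.
apply: torsion_pair_of_class => [X Y p sp h t St|K X Q i p sp ex hK hQ t St|X h t _].
- by apply: tors_surj sp (h t St).
- by apply: tors_ext sp ex (hK t St) (hQ t St).
- exact: tors0.
Qed.

(** The torsion class of the join consists of the modules without maps to the
    intersection of the torsion-free classes. Only torsion classes have to be
    constructed, so that the ascending chain condition suffices. *)
Lemma tfree_join_exists (S : torsion_pair R -> Prop) :
  exists j, forall X, tfree j X <-> forall t, S t -> tfree t X.
Proof.
pose F X := forall t, S t -> tfree t X.
have [|||j hj] := @torsion_pair_of_class (fun X => forall Y, F Y -> zero_hom X Y).
- by move=> X Y p sp h Z FZ; apply: zero_hom_surj sp (h Z FZ).
- by move=> K X Q i p sp ex hK hQ Z FZ; apply: zero_hom_extl sp ex (hK Z FZ) (hQ Z FZ).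
- by move=> X h Y _; exact: zero_hom0l.
exists j => X; split=> [fX t St|FX].
  apply/tfree_char => T tT; apply: (tfree_char j X).1 => //.
  by apply/hj => Y /(_ _ St); exact: torsion_pair_hom tT.
by apply/tfree_char => T /hj; exact.
Qed.

Lemma is_meet_of_tors (S : torsion_pair R -> Prop) m :
  (forall X, tors m X <-> forall t, S t -> tors t X) ->
  is_meet_of (@torsion_pair_le R) S m.
Proof.
move=> h; split=> [t St X /h|u hu X uX]; first exact.
by apply/h => t /hu; exact.
Qed.

Lemma is_join_of_tfree (S : torsion_pair R -> Prop) j :
  (forall X, tfree j X <-> forall t, S t -> tfree t X) ->
  is_join_of (@torsion_pair_le R) S j.
Proof.
move=> h; split=> [t St|u hu].
  by apply/torsion_pair_le_tfree => X /h; exact.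
by apply/torsion_pair_le_tfree => X uX; apply/h => t /hu/torsion_pair_le_tfree; exact.
Qed.

Lemma tors_meet S m : is_meet_of (@torsion_pair_le R) S m ->
  forall X, tors m X <-> forall t, S t -> tors t X.
Proof.
move=> hm; have [m' hm'] := tors_meet_exists S.
by rewrite (is_meet_of_uniq torsion_pair_po hm (is_meet_of_tors hm')).
Qed.

Lemma tfree_join S j : is_join_of (@torsion_pair_le R) S j ->
  forall X, tfree j X <-> forall t, S t -> tfree t X.
Proof.
move=> hj; have [j' hj'] := tfree_join_exists S.
by rewrite (is_join_of_uniq torsion_pair_po hj (is_join_of_tfree hj')).
Qed.

Lemma torsion_pair_complete : is_complete_lattice (@torsion_pair_le R).
Proof.
split=> [|S|S]; first exact: torsion_pair_po.
  by have [m /is_meet_of_tors] := tors_meet_exists S; exists m.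
by have [j /is_join_of_tfree] := tfree_join_exists S; exists j.
Qed.

(** ** Torsion pairs orthogonal for a half exact bifunctor *)

(** [E X Y] stands for the vanishing at [(X, Y)] of a bifunctor that is half
    exact in both variables. *)
Record half_exact_vanishing (E : fgmod R -> fgmod R -> Prop) : Prop := {
  vanish0l : forall X Y, zero_module X -> E X Y;
  vanish0r : forall X Y, zero_module Y -> E X Y;
  vanish_extl : forall K X Q Y (i : {linear K -> X}) (p : {linear X -> Q}),
    injective i -> surjective p -> exact i p -> E K Y -> E Q Y -> E X Y;
  vanish_extr : forall K X Q Y (i : {linear K -> X}) (p : {linear X -> Q}),
    injective i -> surjective p -> exact i p -> E Y K -> E Y Q -> E Y X
}.

(** A nonzero torsion-free module of a meet has a nonzero torsion-free quotient
    for some member, and the kernel is a shorter torsion-free module of the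
    meet: every torsion-free module of the meet is thus filtered by torsion-free
    modules of the members. Dually for joins. *)
Lemma orthogonal_complete_sublattice E : half_exact_vanishing E ->
  is_complete_sublattice (@torsion_pair_le R)
    (fun t => forall T F, tors t T -> tfree t F -> E T F).
Proof.
move=> hE; split; first exact: torsion_pair_complete.
move=> S hS; split=> [m /tors_meet hm T F mT|j /tfree_join hj T F jT jF].
  have [n] := fg_length F; elim: n F => [|n IH] F hn fF.
    by apply: (vanish0r hE); exact/length_le0.
  case: (EM (zero_module F)) => [|nz]; first exact: (vanish0r hE).
  have [t [St ntF]] : exists t, S t /\ ~ tors t F.
    apply: contrapT => no; apply: nz; apply: tors_tfree fF; apply/hm => t St.
    by apply: contrapT => ntF; apply: no; exists t.
  have [A [B [i [p [tA fB ii sp ex]]]]] := torsion_pair_ses t F.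
  apply: (vanish_extr hE ii sp ex); last by apply: (hS t St) => //; exact: (hm T).1.
  apply: IH; last exact: tfree_inj ii fF.
  apply: (length_lt_inj ii) hn => si; apply: ntF; exact: tors_surj si tA.
have [n] := fg_length T; elim: n T jT => [|n IH] T jT hn.
  by apply: (vanish0l hE); exact/length_le0.
case: (EM (zero_module T)) => [|nz]; first exact: (vanish0l hE).
have [t [St ntF]] : exists t, S t /\ ~ tfree t T.
  apply: contrapT => no; apply: nz; apply: tors_tfree jT _; apply/hj => t St.
  by apply: contrapT => ntF; apply: no; exists t.
have [A [B [i [p [tA fB ii sp ex]]]]] := torsion_pair_ses t T.
apply: (vanish_extl hE ii sp ex); first by apply: (hS t St) => //; exact: (hj F).1.
apply: IH; first exact: tors_surj sp jT.
apply: (length_lt_surj sp) hn => si; apply: ntF.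
by exact: tfree_inj si fB.
Qed.

End TorsionPairs.

(** * Projective resolutions and half exactness of Ext *)

Section Projectives.
Variable S : pzRingType.

Lemma projective_lift (P M N : lmodType S) (g : {linear M -> N}) (f : {linear P -> N}) :
  projective P -> (forall x, exists y, g y = f x) ->
  exists h : {linear P -> M}, forall x, g (h x) = f x.
Proof.
move=> pP hf; have [I [j [ij jE]]] := submod_object (submod_range g).
have [|g' hg'] := factor_inj (f := g) ij; first by move=> y; apply/jE; exists y.
have [|f' hf'] := factor_inj (f := f) ij.
  by move=> x; apply/jE; have [y <-] := hf x; exists y.
have [|h hh] := pP _ _ g' f'.
  by move=> z; have [y e] := (jE (j z)).2 (ex_intro _ z erefl); exists y; apply: ij; rewrite hg'.
by exists h => x; rewrite -hg' hh.
Qed.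

Definition free_module (n : nat) : lmodType S := {ffun 'I_n -> S^o}.

Lemma free_module_map_linear n (X : lmodType S) (g : 'I_n -> X) :
  linear (fun v : free_module n => \sum_i (v i : S) *: g i).
Proof.
move=> a x y; rewrite scaler_sumr -big_split /=; apply: eq_bigr => i _.
by rewrite !ffunE scalerDl scalerA.
Qed.

Definition free_module_map n (X : lmodType S) (g : 'I_n -> X) :
  {linear free_module n -> X} := linear_map_of (free_module_map_linear g).

Definition free_module_basis n (i : 'I_n) : free_module n := [ffun j => (i == j)%:R].

Lemma free_module_basisE n (v : free_module n) :
  v = \sum_i (v i : S) *: free_module_basis i.
Proof.
apply/ffunP => j; rewrite sum_ffunE (bigD1 j) //= !ffunE eqxx big1 ?addr0.
  by rewrite /GRing.scale /= mulr1.
by move=> i ij; rewrite !ffunE (negPf ij) scaler0.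
Qed.

Lemma free_module_projective n : projective (free_module n).
Proof.
move=> M N g f sg; have /choice[m hm] i := sg (f (free_module_basis (n:=n) i)).
exists (free_module_map m) => x; rewrite [in RHS](free_module_basisE x) /= !linear_sum.
by apply: eq_bigr => i _; rewrite !linearZ hm.
Qed.

Lemma free_module_fg n : finitely_generated (free_module n).
Proof. by exists n, (@free_module_basis n) => x; exists x; exact: free_module_basisE. Qed.

Lemma projective_prod (P Q : lmodType S) :
  projective P -> projective Q -> projective (P * Q : lmodType S)%type.
Proof.
move=> pP pQ M N g f sg.
have li : linear (fun x : P => ((x, 0) : P * Q)%type).
  by move=> a x y; congr (_, _); rewrite /= scaler0 addr0.
have lr : linear (fun x : Q => ((0, x) : P * Q)%type).
  by move=> a x y; congr (_, _); rewrite /= scaler0 addr0.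
have [h1 e1] := pP _ _ g (f \o linear_map_of li) sg.
have [h2 e2] := pQ _ _ g (f \o linear_map_of lr) sg.
exists ((h1 \o fst) \+ (h2 \o snd)) => -[x y] /=.
rewrite linearD e1 e2 /= -linearD; congr (f (_, _)); by rewrite /= ?addr0 ?add0r.
Qed.

End Projectives.

Section Resolutions.
Variable R : pzRingType.
Implicit Types X Y K Q : fgmod R.

Lemma enough_projectives X : exists (P : fgmod R) (p : {linear P -> X}),
  projective P /\ surjective p.
Proof.
have [n [g hg]] := fgmodP X.
exists (FgMod (free_module_fg _ n)), (free_module_map g); split.
  exact: free_module_projective.
by move=> x; have [a ->] := hg x; exists [ffun i => a i] => /=; apply: eq_bigr => i _; rewrite ffunE.
Qed.

Hypothesis fl : finite_length_ring R.

Record syzygy X := Syzygy {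
  syz : fgmod R;
  syz_cover : fgmod R;
  syz_incl : {linear syz -> syz_cover};
  syz_aug : {linear syz_cover -> X};
  syz_projective : projective syz_cover;
  syz_incl_inj : injective syz_incl;
  syz_aug_surj : surjective syz_aug;
  syz_exact : exact syz_incl syz_aug
}.

Lemma syzygy_exists X : exists s : syzygy X, True.
Proof.
have [P [p [pP sp]]] := enough_projectives X.
have [K [i [ii iE]]] := fg_sub fl (submod_ker p).
by exists (Syzygy pP ii sp iE).
Qed.

Definition choose_syzygy X : syzygy X := sval (cid (syzygy_exists X)).

Lemma projective_resolution_exists X : exists P : projective_resolution X, True.
Proof.
pose Om i := iter i (fun Y => syz (choose_syzygy Y)) X.
pose st i := choose_syzygy (Om i).
pose obj i := syz_cover (st i).
pose d i : {linear obj i.+1 -> obj i} := syz_incl (st i) \o syz_aug (st i.+1).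
unshelve eexists (@ProjectiveResolution R X obj d (syz_aug (st 0%N)) _ _ _ _) => //.
- by move=> i; exact: syz_projective.
- exact: syz_aug_surj.
- move=> y; rewrite (@syz_exact _ (st 0%N) _); split=> -[x <-]; last by eexists.
  by have [z <-] := @syz_aug_surj _ (st 1%N) x; exists z.
- move=> i y; split=> [/= /(inj0 (@syz_incl_inj _ (st i)))|[x <-]] /=.
    case/syz_exact => x <-; have [z <-] := @syz_aug_surj _ (st i.+2) x.
    by exists z.
  have -> : syz_aug (st i.+1) (syz_incl (st i.+1) (syz_aug (st i.+2) x)) = 0 by apply/syz_exact; eexists.
  by rewrite raddf0.
Qed.

Section ResolutionFacts.
Variables (X : fgmod R) (P : projective_resolution X).

Lemma pres_diff_aug x : pres_aug P (pres_diff P 0 x) = 0.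
Proof. by apply/pres_exact0; exists x. Qed.

Lemma pres_diff_diff i x : pres_diff P i (pres_diff P i.+1 x) = 0.
Proof. by apply/pres_exactS; exists x. Qed.

(** A resolution of the zero module is contractible: its images of differentials
    are direct summands. *)
Lemma pres_contract i : zero_module X ->
  exists s : {linear P i -> P i.+1}, forall x,
    pres_diff P i (s (pres_diff P i x)) = pres_diff P i x.
Proof.
move=> X0; elim: i => [|i [s hs]].
  have [y|s hs] := projective_lift (g := pres_diff P 0) (f := idfun) (@pres_projective _ _ P 0).
    by apply/pres_exact0; exact: X0.
  by exists s => x; exact: hs.
have [y|s' hs'] := projective_lift (g := pres_diff P i.+1)
    (f := idfun \- (s \o pres_diff P i)) (@pres_projective _ _ P i.+1).
  by apply/pres_exactS; rewrite /= linearB hs subrr.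
by exists s' => x; rewrite hs' /= pres_diff_diff raddf0 subr0.
Qed.

End ResolutionFacts.

Section ChainMap.
Variables (X' X : fgmod R) (u : {linear X' -> X}).
Variables (P' : projective_resolution X') (P : projective_resolution X).

Lemma chain_map_exists : exists c : forall m, {linear P' m -> P m},
  (forall x, pres_aug P (c 0%N x) = u (pres_aug P' x)) /\
  (forall m x, pres_diff P m (c m.+1 x) = c m (pres_diff P' m x)).
Proof.
pose ok m (c : {linear P' m -> P m}) :=
  forall x, exists y, pres_diff P m y = c (pres_diff P' m x).
have [|c0 hc0] := projective_lift (g := pres_aug P) (f := u \o pres_aug P') (@pres_projective _ _ P' 0).
  by move=> x; exact: pres_aug_surj.
have ok0 : ok 0%N c0.
  by move=> x; apply/pres_exact0; rewrite hc0 /= pres_diff_aug raddf0.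
have step m (c : {c | ok m c}) : exists c' : {c | ok m.+1 c},
    forall x, pres_diff P m (sval c' x) = sval c (pres_diff P' m x).
  case: c => c hc /=.
  have [//|c' hc'] := projective_lift (g := pres_diff P m) (f := c \o pres_diff P' m) (@pres_projective _ _ P' m.+1).
  unshelve eexists (exist _ c' _) => //.
  by move=> x; apply/pres_exactS; rewrite hc' /= pres_diff_diff raddf0.
pose c := fix c m : {c | ok m c} := match m return {c | ok m c} with
  | 0 => exist _ c0 ok0 | m.+1 => sval (cid (step m (c m))) end.
exists (fun m => sval (c m)); split=> // m x.
exact: (svalP (cid (step m (c m)))).
Qed.
End ChainMap.

Section Cone.
Variables (K X Q : fgmod R) (i : {linear K -> X}) (p : {linear X -> Q}).
Hypotheses (ii : injective i) (sp : surjective p) (ex : exact i p).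
Variables (P' : projective_resolution K) (P : projective_resolution X).
Variable c : forall m, {linear P' m -> P m}.
Hypothesis c_aug : forall x, pres_aug P (c 0%N x) = i (pres_aug P' x).
Hypothesis c_diff : forall m x, pres_diff P m (c m.+1 x) = c m (pres_diff P' m x).

(** The mapping cone of the chain map [c]. *)
Definition cone_obj (n : nat) : fgmod R :=
  if n is m.+1 then prod_fg (P m.+1) (P' m) else P 0%N.

Definition cone_diff (n : nat) : {linear cone_obj n.+1 -> cone_obj n} :=
  match n return {linear cone_obj n.+1 -> cone_obj n} with
  | 0 => prod_copair (pres_diff P 0) (c 0%N)
  | m.+1 => prod_pair (prod_copair (pres_diff P m.+1) (c m.+1))
                      (\0 \- (pres_diff P' m \o prod_snd _ _))
  end.

Lemma cone_exact0 : exact (cone_diff 0) (p \o pres_aug P).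
Proof.
move=> y; split=> [/= /ex[x hx]|[[z z'] <-]] /=.
  have [z' hz'] := @pres_aug_surj _ _ P' x.
  have : pres_aug P (y - c 0%N z') = 0 by rewrite linearB c_aug hz' hx subrr.
  by case/pres_exact0 => z hz; exists (z, z'); rewrite /= hz subrK.
by rewrite linearD pres_diff_aug c_aug add0r; apply/ex; eexists.
Qed.

Lemma cone_exact_aux m (z : P m.+1) (r : P' m.+1) :
  pres_diff P m z + c m (pres_diff P' m r) = 0 ->
  exists w : cone_obj m.+2, cone_diff m.+1 w = (z, pres_diff P' m r).
Proof.
rewrite -c_diff -linearD => /pres_exactS[q hq].
exists (q, - r).
by congr (_, _); rewrite /= ?sub0r linearN ?opprK // hq addrK.
Qed.

Lemma cone_exactS n : exact (cone_diff n.+1) (cone_diff n).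
Proof.
case: n => [|m] -[z z']; split.
- move=> /= e.
  have : pres_aug P' z' = 0.
    apply: (inj0 ii); rewrite -c_aug; have := congr1 (pres_aug P) e.
    by rewrite linearD pres_diff_aug add0r raddf0.
  by case/pres_exact0 => r hr; rewrite -hr in e *; exact: cone_exact_aux.
- case=> -[q q'] [<- <-] /=.
  by rewrite sub0r linearD pres_diff_diff linearN add0r -c_diff subrr.
- move=> /= -[e]; rewrite sub0r => /eqP; rewrite oppr_eq0 => /eqP/pres_exactS[r hr].
  by rewrite -hr in e *; exact: cone_exact_aux.
- case=> -[q q'] [<- <-] /=; congr (_, _); rewrite /= !sub0r.
    by rewrite linearD pres_diff_diff linearN add0r -c_diff subrr.
  by rewrite linearN pres_diff_diff !oppr0.
Qed.

Definition cone_resolution : projective_resolution Q.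
Proof.
refine (@ProjectiveResolution R Q cone_obj cone_diff (p \o pres_aug P) _ _ _ _).
- case=> [|m]; first exact: pres_projective.
  by apply: projective_prod; exact: pres_projective.
- by move=> y; have [x <-] := sp y; have [z <-] := @pres_aug_surj _ _ P x; exists z.
- exact: cone_exact0.
- exact: cone_exactS.
Defined.

(** The cone plays the part of the horseshoe lemma: a cocycle [f] on [P] whose
    pullback to [P'] is the coboundary of [g] extends to the cocycle [(f, g)] of
    the cone, which resolves [Q]. If this is a coboundary, then so is [f]. *)
Lemma ext_zero_cone Y m : ext_zero m.+1 K Y -> ext_zero m.+1 Q Y ->
  forall f : {linear P m.+1 -> Y}, cocycle f -> coboundary f.
Proof.
move=> hK hQ f cf.
have [|g hg] := hK P' (f \o c m.+1).
  by move=> x; rewrite /= -c_diff; exact: cf.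
have [|G hG] := hQ cone_resolution (prod_copair f g : {linear cone_obj m.+1 -> Y}).
  case=> z z' /=; rewrite linearD [X in X + _ + _]cf add0r.
  by rewrite sub0r linearN [X in X - _](hg z') subrr.
case: m f cf g hg G hG {hK hQ} => [|m] f cf g hg G hG.
  by exists G => x; have := hG (x, 0); rewrite /= !raddf0 !addr0.
exists (G \o prod_inl _ _) => x; have := hG (x, 0).
by rewrite /= !raddf0 !addr0.
Qed.

End Cone.

Lemma ext_zero_half_exact n : half_exact_vanishing (@ext_zero R n.+1).
Proof.
split.
- move=> X Y X0 P f cf; have [s hs] := pres_contract P n X0.
  exists (f \o s) => x /=.
  have [y e] : exists y, pres_diff P n.+1 y = x - s (pres_diff P n x).
    by apply/pres_exactS; rewrite linearB hs subrr.
  by rewrite -[x in LHS](subrK (s (pres_diff P n x))) -e linearD [X in X + _]cf add0r.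
- by move=> X Y Y0 P f cf; exists \0 => x; rewrite (Y0 (f x)).
- move=> K X Q Y i p ii sp ex hK hQ P.
  have [P' _] := projective_resolution_exists K.
  have [c [c0 cS]] := chain_map_exists i P' P.
  exact: (ext_zero_cone ii sp ex c0 cS hK hQ).
- move=> K X Q Y i p ii sp ex hK hQ P f cf.
  have [|g hg] := hQ P (p \o f); first by move=> x /=; rewrite cf raddf0.
  have [//|g' hg'] := projective_lift (g := p) (f := g) (@pres_projective _ _ P n).
  have [|h hh] := factor_inj (f := f \- (g' \o pres_diff P n)) ii.
    by move=> x; apply/ex; rewrite /= linearB hg' -hg subrr.
  have [|h' hh'] := hK P h.
    move=> x; apply: (inj0 ii); rewrite hh /= cf pres_diff_diff raddf0 subr0.
    by [].
  exists (g' \+ (i \o h')) => x; have := hh x; rewrite /= hh' => ->.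
  by rewrite addrC subrK.
Qed.

Lemma ext_zero0 X Y : zero_hom X Y -> ext_zero 0 X Y.
Proof.
move=> h P f cf x.
have [|g <-] := factor_surj (p := pres_aug P) (f := f) (@pres_aug_surj _ _ P); last exact: h.
by move=> y /pres_exact0[z <-].
Qed.

End Resolutions.

(** * Separating congruences by length *)

Section Separation.
Variable R : pzRingType.
Implicit Types X Y K Q : fgmod R.

Definition hereditary (C : fgmod R -> Prop) : Prop :=
  (forall K X (i : {linear K -> X}), injective i -> C X -> C K) /\
  (forall X Q (p : {linear X -> Q}), surjective p -> C X -> C Q).

Lemma length_le_hereditary n : hereditary (fun X => length_le n X).
Proof.
by split=> [K X i|X Q p]; [exact: length_le_inj | exact: length_le_surj].
Qed.

Hypothesis fl : finite_length_ring R.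

(** Let [n + 1] be the least length of a module lost between [j] and [j_].
    The congruence of agreement on all modules of length at most [n + 1] except
    those lost between [j] and [j_] identifies [j_] and [j], so it contains
    [con(j_, j)]. If the latter identifies [j'_] and [j'] as well, then these
    two must lose a module [Z] also lost between [j] and [j_]. Now [j] is the
    least element whose class contains [Z], and so is [j'].

    The lemma is stated for two families [T], [F] of classes, so that it applies
    to (torsion, torsion-free) and, for the opposite order, to
    (torsion-free, torsion). *)
Lemma separate_by_length (M : Type) (le : M -> M -> Prop) (T F : M -> fgmod R -> Prop) :
  partial_order le -> (forall x y, exists m, is_meet le x y m) ->
  (forall a b, (forall X, T a X -> T b X) <-> le a b) ->
  (forall x y m, is_meet le x y m -> forall X, T m X <-> T x X /\ T y X) ->
  (forall C, hereditary C -> exists c : congruence le, forall a b,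
      c a b <-> forall X, C X -> (T a X <-> T b X)) ->
  (forall a X Y, isomorphic X Y -> T a X -> T a Y) ->
  (forall a X Y, isomorphic X Y -> F a X -> F a Y) ->
  (forall a X, T a X -> F a X -> zero_module X) ->
  (forall a X, zero_module X -> T a X) ->
  (forall n a b X, (forall Y, length_le n Y -> (T a Y <-> T b Y)) ->
     length_le n.+1 X -> T b X -> ~ T a X -> F a X) ->
  forall j j' j_ j'_ (t : congruence le), le j_ j -> (forall c, le c j -> c <> j -> le c j_) ->
     le j'_ j' -> (forall c, le c j' -> c <> j' -> le c j'_) -> j_ <> j ->
     smallest_congruence_identifying j_ j t ->
     smallest_congruence_identifying j'_ j' t -> j = j'.
Proof.
move=> po exm leP meetP congP isoT isoF TF0 T0 lost j j' j_ j'_ t jj lj jj' lj' ne [tj tmin] [tj' tmin'].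
have lea x y : le x y -> le y x -> x = y by case: po => _ _; exact.
have exn : exists n, `[< exists Z : fgmod R, [/\ length_le n Z, T j Z & ~ T j_ Z] >].
  apply: contrapT => no; apply: ne; apply: lea => //; apply/leP => Z jZ.
  apply: contrapT => nZ; apply: no; have [n hn] := fg_length fl Z.
  by exists n; apply/asboolP; exists Z.
case: (ex_minnP exn) => -[|n] /asboolP[Z [hZ jZ nZ]] nmin.
  by case: nZ; apply: T0; exact/length_le0.
have small Y : length_le n Y -> (T j_ Y <-> T j Y).
  move=> hY; split; first by move: Y {hY}; exact/leP.
  move=> jY; apply: contrapT => nY; suff : (n.+1 <= n)%N by rewrite ltnn.
  by apply: nmin; apply/asboolP; exists Y.
pose C X := length_le n X \/ (length_le n.+1 X /\ ~ (T j X /\ F j_ X)).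
have hC : hereditary C.
  split=> [K X i ii|X Q p sp] [h|[h nX]].
  - by left; exact: length_le_inj ii h.
  - case: (EM (surjective i)) => [si|nsi]; last by left; exact: length_lt_inj ii nsi h.
    have iKX : isomorphic K X by exists i; exact: surj_inj_bij.
    right; split; first exact: length_le_inj ii h.
    by move=> [jK fK]; apply: nX; split; [exact: isoT jK | exact: isoF fK].
  - by left; exact: length_le_surj sp h.
  - case: (EM (injective p)) => [pi|npi]; last by left; exact: length_lt_surj sp npi h.
    have iQX : isomorphic Q X by apply: iso_sym; exists p; exact: surj_inj_bij.
    right; split; first exact: length_le_surj sp h.
    by move=> [jK fK]; apply: nX; split; [exact: isoT jK | exact: isoF fK].
have [c hc] := congP C hC.
have cj : c j_ j.
  apply/hc => X [|[hX nX]]; first exact: small.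
  split; first by move: X {hX nX}; exact/leP.
  move=> jX; apply: contrapT => njX; apply: nX; split=> //.
  exact: lost small hX jX njX.
have /hc cj' : c j'_ j' by apply: (tmin c cj).
have [c1 hc1] := congP _ (length_le_hereditary n.+1).
have [Z' [hZ' jZ' nZ']] : exists Z' : fgmod R, [/\ length_le n.+1 Z', T j' Z' & ~ T j'_ Z'].
  apply: contrapT => no; apply: nZ; suff /hc1 h : c1 j_ j by apply/h.
  apply: (tmin' c1) => //; apply/hc1 => X hX; split; first by move: X {hX}; exact/leP.
  by move=> jX; apply: contrapT => nX; apply: no; exists X.
have [jZ'' fZ'] : T j Z' /\ F j_ Z'.
  by apply: contrapT => nC; apply: nZ'; apply/cj' => //; right.
have nj_Z' : ~ T j_ Z'.
  by move=> h; apply: nZ'; apply: T0; exact: TF0 h fZ'.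
have [m hm] := exm j j'; have [mj mj'] := is_meet_lr hm.
have mZ : T m Z' by apply/(meetP _ _ _ hm).
transitivity m.
  by apply: contrapT => nm; apply: nj_Z'; apply: (leP m j_).2 mZ; apply: lj => // e; apply: nm.
by apply: contrapT => nm; apply: nZ'; apply: (leP m j'_).2 mZ; apply: lj'.
Qed.

End Separation.

(** * Complete sublattices of the lattice of torsion pairs *)

Section Sublattice.
Variable R : pzRingType.
Hypothesis fl : finite_length_ring R.
Variable P : torsion_pair R -> Prop.
Hypothesis hP : is_complete_sublattice (@torsion_pair_le R) P.

Local Notation L := {t : torsion_pair R | P t}.
Definition sub_le (a b : L) : Prop := torsion_pair_le (proj1_sig a) (proj1_sig b).
Implicit Types (a b x y z : L) (X Y K Q : fgmod R).

Lemma sub_po : partial_order sub_le.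
Proof.
split=> [a X //|a b c h1 h2 X /h1/h2 //|[a ha] [b hb] h1 h2].
have e : a = b by have [_ _] := @torsion_pair_po R; apply.
by subst b; congr exist; exact: Prop_irrelevance.
Qed.

Lemma sub_le_tfree a b : sub_le a b <->
  forall X, tfree (proj1_sig b) X -> tfree (proj1_sig a) X.
Proof. exact: torsion_pair_le_tfree. Qed.

Lemma sub_meet_of_tors (S : L -> Prop) m :
  (forall X, tors (proj1_sig m) X <-> forall a, S a -> tors (proj1_sig a) X) ->
  is_meet_of sub_le S m.
Proof.
move=> h; split=> [a Sa X /h|u hu X uX]; first exact.
by apply/h => a /hu; exact.
Qed.

Lemma sub_join_of_tfree (S : L -> Prop) j :
  (forall X, tfree (proj1_sig j) X <-> forall a, S a -> tfree (proj1_sig a) X) ->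
  is_join_of sub_le S j.
Proof.
move=> h; split=> [a Sa|u hu]; apply/sub_le_tfree => X; first by move/h; exact.
by move=> uX; apply/h => a /hu/sub_le_tfree; exact.
Qed.

Lemma sub_meet_exists (S : L -> Prop) : exists m : L,
  forall X, tors (proj1_sig m) X <-> forall a, S a -> tors (proj1_sig a) X.
Proof.
pose S' t := exists2 a, S a & proj1_sig a = t.
have [m hm] := tors_meet_exists fl S'.
have [|Pm _] := hP.2 S'; first by move=> _ [a _ <-]; exact: proj2_sig.
exists (exist _ m (Pm _ (is_meet_of_tors hm))) => X; rewrite hm.
by split=> h; [move=> a Sa; apply: h; exists a | move=> _ [a Sa <-]; exact: h].
Qed.

Lemma sub_join_exists (S : L -> Prop) : exists j : L,
  forall X, tfree (proj1_sig j) X <-> forall a, S a -> tfree (proj1_sig a) X.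
Proof.
pose S' t := exists2 a, S a & proj1_sig a = t.
have [j hj] := tfree_join_exists fl S'.
have [|_ Pj] := hP.2 S'; first by move=> _ [a _ <-]; exact: proj2_sig.
exists (exist _ j (Pj _ (is_join_of_tfree hj))) => X; rewrite hj.
by split=> h; [move=> a Sa; apply: h; exists a | move=> _ [a Sa <-]; exact: h].
Qed.

Lemma sub_meet_tors S m : is_meet_of sub_le S m ->
  forall X, tors (proj1_sig m) X <-> forall a, S a -> tors (proj1_sig a) X.
Proof.
move=> hm; have [m' hm'] := sub_meet_exists S.
by rewrite (is_meet_of_uniq sub_po hm (sub_meet_of_tors hm')).
Qed.

Lemma sub_join_tfree S j : is_join_of sub_le S j ->
  forall X, tfree (proj1_sig j) X <-> forall a, S a -> tfree (proj1_sig a) X.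
Proof.
move=> hj; have [j' hj'] := sub_join_exists S.
by rewrite (is_join_of_uniq sub_po hj (sub_join_of_tfree hj')).
Qed.

Lemma sub_complete : is_complete_lattice sub_le.
Proof.
split=> [|S|S]; first exact: sub_po.
  by have [m /sub_meet_of_tors] := sub_meet_exists S; exists m.
by have [j /sub_join_of_tfree] := sub_join_exists S; exists j.
Qed.

Lemma sub_meet2 x y m : is_meet sub_le x y m -> forall X,
  tors (proj1_sig m) X <-> tors (proj1_sig x) X /\ tors (proj1_sig y) X.
Proof.
move=> /sub_meet_tors h X; rewrite h; split=> [h'|[h1 h2] a [->|->] //].
by split; apply: h'; [left | right].
Qed.

Lemma sub_join2 x y j : is_join sub_le x y j -> forall X,
  tfree (proj1_sig j) X <-> tfree (proj1_sig x) X /\ tfree (proj1_sig y) X.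
Proof.
move=> /sub_join_tfree h X; rewrite h; split=> [h'|[h1 h2] a [->|->] //].
by split; apply: h'; [left | right].
Qed.

(** ** Complete semidistributivity *)

(** A module in the torsion classes of [x] and of the join of the [y]'s has a
    nonzero torsion submodule for some [y]; the quotient is shorter, hence by
    induction lies in the class of [z], which is contained in that of [y]. So
    the module itself is in the classes of [x] and [y]. *)
Lemma sub_completely_semidistributive : completely_semidistributive sub_le.
Proof.
split; first exact: sub_complete.
- move=> x z Y [y0 Yy0] hY j /sub_join_tfree hj.
  have zy y : Y y -> forall X, tors (proj1_sig z) X <-> tors (proj1_sig x) X /\ tors (proj1_sig y) X.
    by move=> /hY/sub_meet2.
  have yj y : Y y -> sub_le y j.
    by move=> Yy; apply/sub_le_tfree => X /hj; exact.
  apply: sub_meet_of_tors => X; split=> [zX a [->|->]|h].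
  + by have [] := (zy _ Yy0 X).1 zX.
  + by apply: (yj _ Yy0); have [] := (zy _ Yy0 X).1 zX.
  have {h} [xX jX] : tors (proj1_sig x) X /\ tors (proj1_sig j) X by split; apply: h; [left|right].
  have [n] := fg_length fl X; elim: n X xX jX => [|n IH] X xX jX hn.
    by apply: tors0; exact/length_le0.
  case: (EM (zero_module X)) => [|nz]; first exact: tors0.
  have [y [Yy nyX]] : exists y, Y y /\ ~ tfree (proj1_sig y) X.
    apply: contrapT => no; apply: nz; apply: tors_tfree jX _; apply/hj => y Yy.
    by apply: contrapT => nyX; apply: no; exists y.
  have [A [B [i [p [yA fB ii sp ex]]]]] := torsion_pair_ses (proj1_sig y) X.
  apply/(zy y Yy); split=> //; apply: (tors_ext sp ex yA).
  suff : tors (proj1_sig z) B by case/(zy y Yy).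
  apply: IH; [exact: tors_surj sp xX | exact: tors_surj sp jX|].
  by apply: (length_lt_surj sp) hn => pi; apply: nyX; exact: tfree_inj pi fB.
- move=> x z Y [y0 Yy0] hY j /sub_meet_tors hj.
  have zy y : Y y -> forall X, tfree (proj1_sig z) X <-> tfree (proj1_sig x) X /\ tfree (proj1_sig y) X.
    by move=> /hY/sub_join2.
  have yj y : Y y -> forall X, tfree (proj1_sig y) X -> tfree (proj1_sig j) X.
    by move=> Yy; apply/torsion_pair_le_tfree => X /hj; exact.
  apply: sub_join_of_tfree => X; split=> [zX a [->|->]|h].
  + by have [] := (zy _ Yy0 X).1 zX.
  + by apply: (yj _ Yy0); have [] := (zy _ Yy0 X).1 zX.
  have {h} [xX jX] : tfree (proj1_sig x) X /\ tfree (proj1_sig j) X by split; apply: h; [left|right].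
  have [n] := fg_length fl X; elim: n X xX jX => [|n IH] X xX jX hn.
    by apply: tfree0; exact/length_le0.
  case: (EM (zero_module X)) => [|nz]; first exact: tfree0.
  have [y [Yy nyX]] : exists y, Y y /\ ~ tors (proj1_sig y) X.
    apply: contrapT => no; apply: nz; apply: tors_tfree _ jX; apply/hj => y Yy.
    by apply: contrapT => nyX; apply: no; exists y.
  have [A [B [i [p [yA fB ii sp ex]]]]] := torsion_pair_ses (proj1_sig y) X.
  apply/(zy y Yy); split=> //; apply: (tfree_ext ii ex _ fB).
  suff : tfree (proj1_sig z) A by case/(zy y Yy).
  apply: IH; [exact: tfree_inj ii xX | exact: tfree_inj ii jX|].
  by apply: (length_lt_inj ii) hn => si; apply: nyX; exact: tors_surj si yA.
Qed.

(** ** Congruence uniformity *)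

(** Torsion submodules and torsion-free quotients of a module of a hereditary
    class are in the class, so on such a class the torsion modules determine
    the torsion-free ones and conversely. *)
Lemma agree_tors_tfree (C : fgmod R -> Prop) (t u : torsion_pair R) : hereditary C ->
  (forall X, C X -> (tors t X <-> tors u X)) <->
  (forall X, C X -> (tfree t X <-> tfree u X)).
Proof.
move=> [hi hs]; split=> h X CX.
  have half (v w : torsion_pair R) : (forall X, C X -> (tors v X <-> tors w X)) ->
      tfree v X -> tfree w X.
    move=> vw vX; have [A [B [i [p [wA fB ii sp ex]]]]] := torsion_pair_ses w X.
    apply: tfree_inj fB; apply: ker0_inj => x /ex[y <-].
    by apply: (torsion_pair_hom _ vX i); apply/vw => //; exact: hi ii CX.
  by split; apply: half => // Y CY; have [h1 h2] := h Y CY; split.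
have half (v w : torsion_pair R) : (forall X, C X -> (tfree v X <-> tfree w X)) ->
    tors v X -> tors w X.
  move=> vw vX; have [A [B [i [p [wA fB ii sp ex]]]]] := torsion_pair_ses w X.
  apply: tors_surj wA => x; apply/ex.
  by apply: (torsion_pair_hom vX); apply/vw => //; exact: hs sp CX.
by split; apply: half => // Y CY; have [h1 h2] := h Y CY; split.
Qed.

(** Meets are intersections of torsion classes, joins are intersections of
    torsion-free classes, and agreement can be tested on either. *)
Definition agree_cong (C : fgmod R -> Prop) (hC : hereditary C) : congruence sub_le.
Proof.
refine (@Congruence L sub_le
  (fun a b => forall X, C X -> (tors (proj1_sig a) X <-> tors (proj1_sig b) X)) _ _ _ _ _).
- by [].
- by move=> a b h X CX; have [h1 h2] := h X CX; split.
- by move=> a b c h1 h2 X CX; rewrite (h1 X CX); exact: h2.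
- move=> x x' y y' m m' hx hy /sub_meet2 hm /sub_meet2 hm' X CX.
  by rewrite hm hm' (hx X CX) (hy X CX).
- move=> x x' y y' m m' /(agree_tors_tfree _ _ hC) hx /(agree_tors_tfree _ _ hC) hy.
  move=> /sub_join2 hm /sub_join2 hm'; apply/(agree_tors_tfree _ _ hC) => X CX.
  by rewrite hm hm' (hx X CX) (hy X CX).
Defined.

Lemma sub_congruence_uniform : is_finite_lattice sub_le -> congruence_uniform sub_le.
Proof.
move=> fin; have [[_ exm exj] _] := fin; split=> //.
  apply: (lower_bijection fin).
  apply: (@separate_by_length R fl _ sub_le (fun a => tors (proj1_sig a)) (fun a => tfree (proj1_sig a))).
  - exact: sub_po.
  - exact: exm.
  - by [].
  - exact: sub_meet2.
  - by move=> C hC; exists (agree_cong hC).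
  - by move=> a X Y; exact: tors_iso.
  - by move=> a X Y; exact: tfree_iso.
  - by move=> a X; exact: tors_tfree.
  - by move=> a X; exact: tors0.
  - move=> n a b X h hX bX naX.
    have [A [B [i [p [aA fB ii sp ex]]]]] := torsion_pair_ses (proj1_sig a) X.
    case: (EM (injective p)) => [pi|npi]; first exact: tfree_inj pi fB.
    case: naX; apply: (tors_ext sp ex aA); apply/h; last exact: tors_surj sp bX.
    exact: length_lt_surj sp npi hX.
apply: upper_bijection; apply: (lower_bijection (finite_lattice_dual fin)).
apply: (@separate_by_length R fl _ (dual_le sub_le) (fun a => tfree (proj1_sig a)) (fun a => tors (proj1_sig a))).
- exact: partial_order_dual sub_po.
- exact: exj.
- by move=> a b; split=> h; exact/sub_le_tfree.
- exact: sub_join2.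
- by move=> C hC; exists (dual_cong (agree_cong hC)) => a b; exact: agree_tors_tfree.
- by move=> a X Y; exact: tfree_iso.
- by move=> a X Y; exact: tors_iso.
- by move=> a X fX tX; exact: tors_tfree tX fX.
- by move=> a X; exact: tfree0.
- move=> n a b X h hX bX naX.
  have [A [B [i [p [aA fB ii sp ex]]]]] := torsion_pair_ses (proj1_sig a) X.
  case: (EM (surjective i)) => [si|nsi]; first exact: tors_surj si aA.
  case: naX; apply: (tfree_ext ii ex _ fB); apply/h; last exact: tfree_inj ii bX.
  exact: length_lt_inj ii nsi hX.
Qed.

End Sublattice.

(** * Finite direct sums and indecomposable modules *)

Section DirectSums.
Variable R : pzRingType.
Implicit Types (X Y Z P Q M : fgmod R) (D C : fgmod R -> Prop).

Lemma prod_iso X X' Y Y' : isomorphic X X' -> isomorphic Y Y' ->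
  isomorphic (prod_fg X Y) (prod_fg X' Y').
Proof.
move=> [f /linear_bij_inv[f' [fK f'K]]] [g /linear_bij_inv[g' [gK g'K]]].
apply: (@iso_of _ _ _ (prod_pair (f \o prod_fst X Y) (g \o prod_snd X Y))
          (prod_pair (f' \o prod_fst X' Y') (g' \o prod_snd X' Y'))).
- by case=> x y; rewrite /= fK gK.
- by case=> x y; rewrite /= f'K g'K.
Qed.

Lemma prod_isoA X Y Z : isomorphic (prod_fg (prod_fg X Y) Z) (prod_fg X (prod_fg Y Z)).
Proof.
apply: (@iso_of _ _ _
  (prod_pair (prod_fst X Y \o prod_fst _ Z) (prod_pair (prod_snd X Y \o prod_fst _ Z) (prod_snd _ Z)))
  (prod_pair (prod_pair (prod_fst X _) (prod_fst Y Z \o prod_snd X _)) (prod_snd Y Z \o prod_snd X _))).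
- by case=> -[].
- by case=> x [].
Qed.

Lemma prod_isoCA X Y Z : isomorphic (prod_fg X (prod_fg Y Z)) (prod_fg Y (prod_fg X Z)).
Proof.
apply: (@iso_of _ _ _
  (prod_pair (prod_fst Y Z \o prod_snd X _) (prod_pair (prod_fst X (prod_fg Y Z)) (prod_snd Y Z \o prod_snd X _)))
  (prod_pair (prod_fst X Z \o prod_snd Y _) (prod_pair (prod_fst Y (prod_fg X Z)) (prod_snd X Z \o prod_snd Y _)))).
- by case=> x [].
- by case=> x [].
Qed.

Lemma prod_iso0l X Y : zero_module X -> isomorphic (prod_fg X Y) Y.
Proof.
move=> X0; apply: (@iso_of _ _ _ (prod_snd X Y) (prod_inr X Y)) => //.
by case=> x y; rewrite /= (X0 x).
Qed.

Lemma prod_iso0r X Y : zero_module Y -> isomorphic (prod_fg X Y) X.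
Proof.
move=> Y0; apply: (@iso_of _ _ _ (prod_fst X Y) (prod_inl X Y)) => //.
by case=> x y; rewrite /= (Y0 y).
Qed.

Inductive direct_sum D : nat -> fgmod R -> Prop :=
| direct_sum0 P : zero_module P -> direct_sum D 0 P
| direct_sumS n P Q P' : isomorphic P (prod_fg Q P') -> D Q ->
    direct_sum D n P' -> direct_sum D n.+1 P.

Lemma direct_sum_sub D C n P : (forall M, D M -> C M) -> direct_sum D n P -> direct_sum C n P.
Proof.
move=> h; elim=> [Q Q0|m Q Q1 Q2 iQ d1 _ IH]; first exact: direct_sum0.
by apply: direct_sumS iQ _ IH; exact: h.
Qed.

Lemma direct_sum_iso D n P P' : isomorphic P P' -> direct_sum D n P -> direct_sum D n P'.
Proof.
move=> e d; case: d e => [Q Q0|m Q Q1 Q2 iQ d1 d2] e.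
  by case: e => f /bij_surj sf; apply: direct_sum0 => y; have [x <-] := sf y; rewrite (Q0 x) raddf0.
by apply: direct_sumS d1 d2; apply: iso_trans iQ; exact: iso_sym.
Qed.

Lemma direct_sum_prod D m n P Q :
  direct_sum D m P -> direct_sum D n Q -> direct_sum D (m + n) (prod_fg P Q).
Proof.
move=> + hQ; elim=> [P' P0|k P1 P2 P3 iP d _ IH].
  by apply: direct_sum_iso hQ; apply: iso_sym; exact: prod_iso0l.
rewrite addSn; apply: direct_sumS d IH.
by apply: iso_trans (prod_isoA _ _ _); apply: prod_iso iP (iso_refl _).
Qed.

Lemma direct_sum_single D M : D M -> direct_sum D 1 M.
Proof.
move=> dM; have [Z Z0] : exists Z : fgmod R, zero_module Z.
  have [Z [p [sp pE]]] := fg_quot (@submod_full _ M).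
  by exists Z => z; have [x <-] := sp z; apply/pE.
by apply: direct_sumS dM (direct_sum0 _ Z0); apply: iso_sym; exact: prod_iso0r.
Qed.

Lemma direct_sum_closed D C n P :
  (forall X, zero_module X -> C X) -> (forall X Y, isomorphic X Y -> C X -> C Y) ->
  (forall X Y, C X -> C Y -> C (prod_fg X Y)) -> (forall M, D M -> C M) ->
  direct_sum D n P -> C P.
Proof.
move=> c0 ci cp dc; elim=> [Q Q0|m Q Q1 Q2 iQ d1 _ IH]; first exact: c0.
by apply: ci (iso_sym iQ) _; apply: cp => //; exact: dc.
Qed.

Lemma direct_sum_detect D n P X (f : {linear P -> X}) : direct_sum D n P ->
  (forall M (g : {linear M -> P}), D M -> forall x, f (g x) = 0) -> forall x, f x = 0.
Proof.
move=> d; elim: d f => [Q Q0|m Q Q1 Q2 [e /linear_bij_inv[e' [eK e'K]]] d1 _ IH] f hf x.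
  by rewrite (Q0 x) raddf0.
have h2 y : f (e' (0, y)) = 0.
  by apply: (IH (f \o (e' \o prod_inr _ _))) => M g dM z; exact: (hf M ((e' \o prod_inr _ _) \o g)).
have h1 y : f (e' (y, 0)) = 0 by exact: (hf Q1 (e' \o prod_inl _ _)).
rewrite -(eK x); case: (e x) => y z.
have -> : ((y, z) : prod_fg Q1 Q2) = (y, 0) + (0, z) by congr (_, _); rewrite /= ?addr0 ?add0r.
by rewrite !linearD h1 h2 addr0.
Qed.

Lemma indecomposable_internal (M : lmodType R^c) (U W : M -> Prop) : indecomposable M ->
  submod U -> submod W -> (forall x, U x -> W x -> x = 0) ->
  (forall x, exists u w, [/\ U u, W w & x = u + w]) ->
  (forall x, U x -> x = 0) \/ (forall x, W x -> x = 0).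
Proof.
move=> [_ ind] hU hW dis sum.
have [K1 [i1 [ii1 iE1]]] := submod_object hU; have [K2 [i2 [ii2 iE2]]] := submod_object hW.
have e : isomorphic (K1 * K2 : lmodType R^c)%type M.
  exists ((i1 \o fst) \+ (i2 \o snd)); apply: surj_inj_bij.
    apply: ker0_inj => -[x y] /= e.
    have Ux : U (i1 x) by apply/iE1; exists x.
    have Wx : W (i1 x).
      by move/eqP: e; rewrite addr_eq0 => /eqP ->; apply: submodN => //; apply/iE2; exists y.
    have x0 : i1 x = 0 by exact: dis.
    by move: e; rewrite x0 add0r => /(inj0 ii2) ->; rewrite (inj0 ii1 x0).
  move=> x; have [u [w [/iE1[y <-] /iE2[z <-] ->]]] := sum x.
  by exists (y, z).
by case: (ind _ _ (iso_sym e)) => z0; [left | right] => x; [move=> /iE1|move=> /iE2] => -[y <-]; rewrite (z0 y) raddf0.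
Qed.

Hypothesis fl : finite_length_ring R.

Lemma direct_sum_indecomposable C :
  (forall P X Y, isomorphic P (prod_fg X Y) -> C P -> C X /\ C Y) ->
  forall P, C P -> exists n, direct_sum (fun M => C M /\ indecomposable M) n P.
Proof.
move=> hC P; have [n] := fg_length fl P; elim: n P => [|n IH] P hn cP.
  by exists 0%N; apply: direct_sum0; exact/length_le0.
case: (EM (zero_module P)) => [P0|nz]; first by exists 0%N; exact: direct_sum0.
case: (EM (indecomposable P)) => [ind|nind]; first by exists 1%N; exact: direct_sum_single.
have [X [Y [e nX nY]]] : exists X Y : lmodType R^c,
    [/\ isomorphic P (X * Y)%type, ~ zero_module X & ~ zero_module Y].
  apply: contrapT => no; apply: nind; split=> // X Y e.
  case: (EM (zero_module X)) => [|nX]; [by left|right].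
  by apply: contrapT => nY; apply: no; exists X, Y.
case: (e) => f fb; have fs := bij_surj fb.
have s1 : surjective (fst \o f : {linear P -> X}) by move=> x; have [z hz] := fs (x, 0); exists z; rewrite /= hz.
have s2 : surjective (snd \o f : {linear P -> Y}) by move=> x; have [z hz] := fs (0, x); exists z; rewrite /= hz.
pose X' := FgMod (finitely_generated_surj s1 (fgmodP P)).
pose Y' := FgMod (finitely_generated_surj s2 (fgmodP P)).
have e' : isomorphic P (prod_fg X' Y') by [].
have [cX cY] := hC _ _ _ e' cP.
have [|a hX] := IH X' _ cX.
  apply: (length_lt_surj (p := fst \o f)) hn => // inj; apply: nY => y.
  have [z hz] := fs (0, y); have : z = 0 by apply: (inj0 inj); rewrite /= hz.
  by move=> z0; move: hz; rewrite z0 raddf0 => -[].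
have [|b hY] := IH Y' _ cY.
  apply: (length_lt_surj (p := snd \o f)) hn => // inj; apply: nX => y.
  have [z hz] := fs (y, 0); have : z = 0 by apply: (inj0 inj); rewrite /= hz.
  by move=> z0; move: hz; rewrite z0 raddf0 => -[].
by exists (a + b)%N; apply: direct_sum_iso (iso_sym e') _; exact: direct_sum_prod.
Qed.

(** Used to remove the summands isomorphic to [M] one by one. *)
Lemma direct_sum_split_off D M n P : direct_sum D n P ->
  direct_sum (fun M' => D M' /\ ~ isomorphic M' M) n P \/
  exists m P', [/\ n = m.+1, direct_sum D m P' & isomorphic P (prod_fg M P')].
Proof.
elim=> [Q Q0|m Q Q1 Q2 iQ d1 d2 IH]; first by left; exact: direct_sum0.
case: (EM (isomorphic Q1 M)) => [e|ne].
  by right; exists m, Q2; split=> //; apply: iso_trans iQ (prod_iso e (iso_refl _)).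
case: IH => [IH|[k [P' [mk dP' e]]]]; first by left; apply: direct_sumS iQ _ IH.
right; exists m, (prod_fg Q1 P'); split=> //.
  by rewrite mk; apply: direct_sumS (iso_refl _) d1 dP'.
apply: iso_trans iQ _; apply: iso_trans (prod_iso (iso_refl _) e) _.
exact: prod_isoCA.
Qed.

(** ** Chains of non-isomorphisms *)

(** Compositions of [2 ^ n.+1 - 1] non-isomorphisms between modules in [D],
    bracketed as in the proof of the lemma of Harada and Sai. *)
Fixpoint harada_sai_chain D n M M' (f : {linear M -> M'}) : Prop :=
  if n is m.+1 then
    exists M1 M2 (f1 : {linear M -> M1}) (h : {linear M1 -> M2}) (f2 : {linear M2 -> M'}),
      [/\ D M1 /\ D M2, harada_sai_chain D m f1, ~ bijective h,
          harada_sai_chain D m f2 & forall x, f x = f2 (h (f1 x))]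
  else ~ bijective f.

(** If the image of [f2 h f1] is not shorter than those of [f1] and [f2], then
    the image of [f1] is complemented by the kernel of [f2 h], and the image of
    [h f1] by that of [f2]; by indecomposability, [h] would be bijective. *)
Lemma harada_sai D b : (forall M, D M -> indecomposable M /\ length_le b M) ->
  forall n M M' (f : {linear M -> M'}), D M -> D M' -> harada_sai_chain D n f ->
  len_le (b - n) (fun y => y = 0) (fun y => exists x, f x = y).
Proof.
move=> hD; elim=> [|n IH] M M' f dM dM'.
  by move=> _; rewrite subn0; apply: length_le_sub; [exact: submod_range | case: (hD _ dM')].
move=> [M1 [M2 [f1 [h [f2 [[d1 d2] hf1 nh hf2 fE]]]]]].
have L1 := IH _ _ _ dM d1 hf1; have L2 := IH _ _ _ d2 dM' hf2.
have trivial_case : (forall x, f x = 0) -> len_le (b - n.+1) (fun y => y = 0) (fun y => exists x, f x = y).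
  by move=> f0; apply: (@len_leW _ _ 0) => // y [x <-].
case e : (b - n)%N => [|c] in L1 L2.
  by apply: trivial_case => x; rewrite fE (L1 (f1 x)) ?raddf0 //; exists x.
rewrite subnS e /=.
rewrite subnS e /= in trivial_case.
(* Otherwise the image of [f] is a proper submodule of that of [f2]. *)
case: (EM (forall y, (exists x, f2 x = y) -> exists x, f x = y)) => [f2f|nf2f]; last first.
  apply: L2 => //; first exact: submod_range.
    by move=> y ->; exists 0; rewrite raddf0.
  by move=> y [x <-]; exists (h (f1 x)).
(* Otherwise the image of [f] is a proper quotient of that of [f1]. *)
case: (EM (forall x, f2 (h (f1 x)) = 0 -> f1 x = 0)) => [inj|ninj]; last first.
  pose V' y := (exists x, f1 x = y) /\ f2 (h y) = 0.
  have hV' : submod V' by apply: submodI; [exact: submod_range | exact: (submod_ker (f2 \o h))].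
  have := len_le_bot hV' (submod_range f1) (V := fun y => y = 0).
  move=> /(_ c) LV.
  apply: (len_le_transfer (Phi := fun W y => (exists x, f1 x = y) /\ W (f2 (h y)))).
  - exact: submod0.
  - exact: submod_range.
  - by move=> y ->; exists 0; rewrite raddf0.
  - by move=> W hW _ _; apply: submodI; [exact: submod_range | exact: (submod_preim (f2 \o h))].
  - by move=> W W' WW' y [a /WW'].
  - move=> W W' hW hW' _ _ W'f sub y W'y; have [x e'] := W'f _ W'y.
    rewrite -e' fE; apply: (sub (f1 x) _).2; split; first by exists x.
    by rewrite -fE e'.
  apply: (@len_le_ext _ _ _ V' _ (fun y => exists x, f1 x = y)) => //.
    by move=> y; split=> [[x <-]|[]//]; split; exists x.
  apply: LV => //.
  - by move=> y ->; split; [exists 0; rewrite raddf0 | rewrite !raddf0].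
  - by move=> y [].
  - by move=> V0; apply: ninj => x fx; apply: V0; split=> //; exists x.
have [A0|K0] : (forall y, (exists x, h (f1 x) = y) -> y = 0) \/ (forall y, f2 y = 0 -> y = 0).
  apply: indecomposable_internal; first by case: (hD _ d2).
  - exact: (submod_range (h \o f1)).
  - exact: submod_ker.
  - by move=> _ [x <-] /inj ->; rewrite raddf0.
  move=> y; have [|x ex] := f2f (f2 y); first by exists y.
  exists (h (f1 x)), (y - h (f1 x)); split; first by exists x.
    by rewrite linearB -fE ex subrr.
  by rewrite addrC subrK.
- by apply: trivial_case => x; rewrite fE (A0 (h (f1 x))) ?raddf0 //; exists x.
have [A1|K1] : (forall y, (exists x, f1 x = y) -> y = 0) \/ (forall y, f2 (h y) = 0 -> y = 0).
  apply: indecomposable_internal; first by case: (hD _ d1).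
  - exact: submod_range.
  - exact: (submod_ker (f2 \o h)).
  - by move=> _ [x <-] /inj.
  move=> y; have [|x ex] := f2f (f2 (h y)); first by exists (h y).
  exists (f1 x), (y - f1 x); split; first by exists x.
    by rewrite !linearB -fE ex subrr.
  by rewrite addrC subrK.
- by apply: trivial_case => x; rewrite fE (A1 (f1 x)) ?raddf0 //; exists x.
case: nh; apply: surj_inj_bij; first by apply: ker0_inj => y hy; apply: K1; rewrite hy raddf0.
move=> y; have [|x ex] := f2f (f2 y); first by exists y.
by exists (f1 x); apply: (ker0_inj K0); rewrite -fE.
Qed.

(** Otherwise nonzero maps to [X] could be prolonged to the left by
    non-isomorphisms for ever, and [harada_sai] bounds the length of such chains.
    The map found spans a simple submodule of the functor [Hom(-, X)] on [D]. *)
Lemma socle_map D b X : (forall M, D M -> indecomposable M /\ length_le b M) ->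
  (exists M (f : {linear M -> X}) x, D M /\ f x <> 0) ->
  exists M (f : {linear M -> X}), [/\ D M, exists x, f x <> 0 &
    forall M' (h : {linear M' -> M}), D M' -> ~ bijective h -> forall x, f (h x) = 0].
Proof.
move=> hD [M0 [f0 [x0 [dM0 nz0]]]]; apply: contrapT => no.
have step M (f : {linear M -> X}) : D M -> (exists x, f x <> 0) ->
    exists M' (h : {linear M' -> M}), [/\ D M', ~ bijective h & exists x, f (h x) <> 0].
  move=> dM nz; apply: contrapT => no'; apply: no; exists M, f; split=> // M' h dM' nh x.
  by apply: contrapT => nx; apply: no'; exists M', h; split=> //; exists x.
have chain n M (f : {linear M -> X}) : D M -> (exists x, f x <> 0) ->
    exists M' (h : {linear M' -> M}), [/\ D M', harada_sai_chain D n h & exists x, f (h x) <> 0].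
  elim: n M f => [|n IH] M f dM nz; first exact: step.
  have [M2 [f2 [d2 c2 nz2]]] := IH _ _ dM nz.
  have [M1 [h [d1 nh nzh]]] := step _ (f \o f2) d2 nz2.
  have [M' [f1 [d' c1 nz1]]] := IH _ (f \o f2 \o h) d1 nzh.
  exists M', (f2 \o h \o f1); split=> //.
  by exists M1, M2, f1, h, f2.
have [M [h [dM hc [x nx]]]] := chain b _ _ dM0 (ex_intro _ x0 nz0).
have := harada_sai hD dM dM0 hc; rewrite subnn => h0.
by apply: nx; rewrite (h0 (h x)) ?raddf0 //; exists x.
Qed.

End DirectSums.

(** * Ext-projective modules and descending torsion classes *)

(** Finite generation of [Hom(X, Y)] over [End(Y)] is what the construction of
    left approximations needs. *)
Definition hom_fg_ring (R : pzRingType) : Prop := forall X Y : fgmod R,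
  exists (q : nat) (fs : 'I_q -> {linear X -> Y}), forall f : {linear X -> Y},
    exists th : 'I_q -> {linear Y -> Y}, forall x, f x = \sum_i th i (fs i x).

Section ExtProjectives.
Variable R : pzRingType.
Implicit Types (X Y Z P Q M N W E V K B : fgmod R) (t u : torsion_pair R).

(** The vanishing of [Ext^1(P, -)] on the torsion class, as a lifting property. As
    torsion classes are closed under quotients, [i] need not be injective. *)
Definition ext_projective t P : Prop :=
  forall W E V (i : {linear W -> E}) (g : {linear E -> V}), tors t W ->
    surjective g -> exact i g -> forall f : {linear P -> V},
    exists h : {linear P -> E}, forall x, g (h x) = f x.

Definition tors_presented t P Z : Prop :=
  exists K (i : {linear K -> P}) (p : {linear P -> Z}),
    [/\ tors t K, surjective p & exact i p].

Definition enough_ext_projectives t : Prop := forall Z, tors t Z ->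
  exists P, [/\ tors t P, ext_projective t P & tors_presented t P Z].

Lemma ext_projective_le t u P : torsion_pair_le u t ->
  ext_projective t P -> ext_projective u P.
Proof. by move=> ut hP W E V i g /ut; exact: hP. Qed.

Lemma ext_projective_zero t P : zero_module P -> ext_projective t P.
Proof. by move=> P0 W E V i g _ _ _ f; exists \0 => x; rewrite raddf0 (P0 x) raddf0. Qed.

Lemma ext_projective_prod t P Q :
  ext_projective t P -> ext_projective t Q -> ext_projective t (prod_fg P Q).
Proof.
move=> hP hQ W E V i g tW sg ex f.
have [h1 e1] := hP _ _ _ i g tW sg ex (f \o prod_inl P Q).
have [h2 e2] := hQ _ _ _ i g tW sg ex (f \o prod_inr P Q).
exists (prod_copair h1 h2) => -[x y] /=.
rewrite linearD e1 e2 /= -linearD; congr (f (_, _)); by rewrite /= ?addr0 ?add0r.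
Qed.

Lemma ext_projective_retract t P Q (a : {linear Q -> P}) (b : {linear P -> Q}) :
  (forall x, b (a x) = x) -> ext_projective t P -> ext_projective t Q.
Proof.
move=> ba hP W E V i g tW sg ex f.
have [h hh] := hP _ _ _ i g tW sg ex (f \o b).
by exists (h \o a) => x; rewrite /= hh /= ba.
Qed.

Lemma ext_projective_iso t P Q : isomorphic P Q -> ext_projective t P -> ext_projective t Q.
Proof.
by case=> f /linear_bij_inv[g [fK gK]]; exact: (ext_projective_retract (a := g) (b := f) gK).
Qed.

Lemma ext_projective_projective t P : projective P -> ext_projective t P.
Proof. by move=> pP W E V i g _ sg _ f; exact: pP. Qed.

Lemma direct_sum_ext_projective t D n P : (forall M, D M -> ext_projective t M) ->
  direct_sum D n P -> ext_projective t P.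
Proof.
move=> h; apply: direct_sum_closed h.
- exact: ext_projective_zero.
- by move=> X Y; exact: ext_projective_iso.
- exact: ext_projective_prod.
Qed.

Lemma direct_sum_tors t D n P : (forall M, D M -> tors t M) ->
  direct_sum D n P -> tors t P.
Proof.
move=> h; apply: direct_sum_closed h.
- exact: tors0.
- by move=> X Y; exact: tors_iso.
- exact: tors_prod.
Qed.

Hypothesis fl : finite_length_ring R.
Hypothesis hom_fg : hom_fg_ring R.

Lemma top_torsion_pair : exists t, forall X : fgmod R, tors t X.
Proof. by have [//|//|//|t ht] := torsion_pair_of_class fl (C := fun=> True); exists t => X; apply/ht. Qed.

Lemma top_enough_ext_projectives t : (forall X, tors t X) -> enough_ext_projectives t.
Proof.
move=> ht Z _; have [P [p [pP sp]]] := enough_projectives Z.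
have [K [i [ii iE]]] := fg_sub fl (submod_ker p).
exists P; split=> //; first exact: ext_projective_projective.
by exists K, i, p.
Qed.

Definition ext_projective_indecomposable t M : Prop :=
  [/\ tors t M, ext_projective t M & indecomposable M].

(** Ext-projectivity passes to direct summands. *)
Lemma ext_projective_direct_sum t P : tors t P -> ext_projective t P ->
  exists n, direct_sum (ext_projective_indecomposable t) n P.
Proof.
move=> tP eP.
have [|n hn] := direct_sum_indecomposable fl (C := fun P => tors t P /\ ext_projective t P) _ (conj tP eP).
  move=> {tP eP}P X Y [f fb] [tP eP].
  have [g [fK gK]] := linear_bij_inv fb.
  split; split.
  - apply: (tors_surj (p := prod_fst X Y \o f)) tP => x.
    by exists (g (x, 0)); rewrite /= gK.
  - by apply: (ext_projective_retract (a := g \o prod_inl X Y) (b := prod_fst X Y \o f)) eP => x; rewrite /= gK.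
  - apply: (tors_surj (p := prod_snd X Y \o f)) tP => x.
    by exists (g (0, x)); rewrite /= gK.
  - by apply: (ext_projective_retract (a := g \o prod_inr X Y) (b := prod_snd X Y \o f)) eP => x; rewrite /= gK.
by exists n; apply: direct_sum_sub hn => M [[? ?] ?].
Qed.

(** ** Left approximations *)

Section Approximation.
Variables (n : nat) (s : 'I_n -> fgmod R) (D : fgmod R -> Prop).
Hypothesis Diso : forall M N, isomorphic M N -> D M -> D N.
Hypothesis Dfin : forall M, D M -> exists i, isomorphic M (s i).
Variable Q : fgmod R.

Definition factors Q1 Y (la : {linear Q -> Q1}) (f : {linear Q -> Y}) : Prop :=
  exists g : {linear Q1 -> Y}, forall x, f x = g (la x).

Lemma approx_add Y m Q0 (la0 : {linear Q -> Q0}) q (fs : 'I_q -> {linear Q -> Y}) :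
  D Y -> direct_sum D m Q0 ->
  exists m' Q1 (la : {linear Q -> Q1}), [/\ direct_sum D m' Q1, factors la la0 &
    forall i, factors la (fs i)].
Proof.
move=> dY d0.
suff key k : exists m' Q1 (la : {linear Q -> Q1}), [/\ direct_sum D m' Q1, factors la la0 &
    forall i : 'I_q, (i < k)%N -> factors la (fs i)].
  have [m' [Q1 [la [d1 f0 fi]]]] := key q.
  by exists m', Q1, la; split=> // i; apply: fi; exact: ltn_ord.
elim: k => [|k [m1 [Q1 [la [d1 [g0 f0] fi]]]]].
  by exists m, Q0, la0; split=> //; exists idfun.
case: (ltnP k q) => [kq|qk]; last first.
  by exists m1, Q1, la; split=> //; [exists g0 | move=> i _; apply: fi; exact: leq_trans (ltn_ord i) qk].
exists (1 + m1)%N, (prod_fg Y Q1), (prod_pair (fs (Ordinal kq)) la); split.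
- by apply: direct_sum_prod d1; exact: direct_sum_single.
- by exists (g0 \o prod_snd Y Q1).
move=> i; rewrite ltnS leq_eqVlt => /orP[/eqP ik|/fi[g hg]]; last by exists (g \o prod_snd Y Q1).
exists (prod_fst Y Q1) => x /=; congr (fs _ x); exact: val_inj.
Qed.

(** The sum, over the finitely many modules in [D] up to isomorphism, of powers
    of these indexed by generators of [Hom(Q, -)]. *)
Lemma left_approximation : exists m Q1 (la : {linear Q -> Q1}), direct_sum D m Q1 /\
  forall k P (f : {linear Q -> P}), direct_sum D k P -> factors la f.
Proof.
suff [m [Q1 [la [d1 h]]]] : exists m Q1 (la : {linear Q -> Q1}), direct_sum D m Q1 /\
    forall i (f : {linear Q -> s i}), D (s i) -> factors la f.
  exists m, Q1, la; split=> // k P f d; elim: d f => [P' P0|j P' M P2 [e /linear_bij_inv[e' [eK e'K]]] dM _ IH] f.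
    by exists \0 => x; rewrite (P0 (f x)).
  have [g2 h2] := IH (prod_snd M P2 \o e \o f).
  have [i [a /linear_bij_inv[a' [aK a'K]]]] := Dfin dM.
  have [|g1 h1] := h i (a \o (prod_fst M P2 \o e \o f)).
    by apply: Diso dM; apply: iso_of aK a'K.
  exists (e' \o prod_pair (a' \o g1) g2) => x.
  rewrite -[LHS]eK; congr (e' _); rewrite /= -h1 -h2 /= aK.
  by case: (e (f x)).
suff key k : exists m Q1 (la : {linear Q -> Q1}), direct_sum D m Q1 /\
    forall i (f : {linear Q -> s i}), (i < k)%N -> D (s i) -> factors la f.
  have [m [Q1 [la [d1 h]]]] := key n.
  by exists m, Q1, la; split=> // i f; apply: h; exact: ltn_ord.
elim: k => [|k [m [Q0 [la0 [d0 h0]]]]].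
  have [Z [p [sp pE]]] := fg_quot (@submod_full _ Q).
  by exists 0%N, Z, p; split=> //; apply: direct_sum0 => z; have [x <-] := sp z; apply/pE.
case: (EM (exists2 i : 'I_n, i = k :> nat & D (s i))) => [[i0 ik di0]|no]; last first.
  exists m, Q0, la0; split=> // i f; rewrite ltnS leq_eqVlt => /orP[/eqP ik|ik] di; last exact: h0.
  by case: no; exists i.
have [q [fs hfs]] := hom_fg Q (s i0).
have [m1 [Q1 [la [d1 [g0 hg0] hi]]]] := approx_add la0 fs di0 d0.
exists m1, Q1, la; split=> // i f; rewrite ltnS leq_eqVlt => /orP[/eqP ik'|ik'] di.
  have ei : i = i0 by apply: val_inj; rewrite /= ik ik'.
  subst i; have [th hth] := hfs f; have /choice[g hg] := hi.
  have lin : linear (fun y => \sum_a th a (g a y)).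
    move=> c x y; rewrite scaler_sumr -big_split /=; apply: eq_bigr => a _.
    by rewrite !linearP.
  exists (linear_map_of lin) => x; rewrite hth /=; apply: eq_bigr => a _.
  by rewrite hg.
have [g hg] := h0 i f ik' di.
by exists (g \o g0) => x; rewrite /= hg hg0.
Qed.

End Approximation.

(** ** Mutation *)

Section Descend.
Variables (n : nat) (s : 'I_n -> fgmod R) (t u : torsion_pair R).
Hypothesis enough : enough_ext_projectives t.
Hypothesis Dfin : forall M, ext_projective_indecomposable t M -> exists i, isomorphic M (s i).
Hypothesis ut : torsion_pair_le u t.

Let D := ext_projective_indecomposable t.

Lemma indecomposable_length_bound : exists b, forall M, D M -> indecomposable M /\ length_le b M.
Proof.
have /choice[l hl] i : exists l, length_le l (s i) by exact: fg_length.
exists (\max_i l i)%N => M dM; split; first by case: dM.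
have [i [f fb]] := Dfin dM; apply: (length_le_inj (bij_inj fb)).
by apply: length_leW (hl i); exact: leq_bigmax.
Qed.

Lemma tors_cover Z : tors t Z -> exists k P (p : {linear P -> Z}),
  direct_sum D k P /\ surjective p.
Proof.
move=> /enough[P [tP eP [K [i [p [tK sp ex]]]]]].
by have [k hk] := ext_projective_direct_sum tP eP; exists k, P, p.
Qed.

Variables (X M : fgmod R) (phi : {linear M -> X}).
Hypothesis uX : tfree u X.
Hypothesis dM : D M.
Hypothesis phi_nonzero : exists x, phi x <> 0.
Hypothesis phi_socle : forall M' (h : {linear M' -> M}), D M' -> ~ bijective h ->
  forall x, phi (h x) = 0.

(** The sum of the images of the non-isomorphisms from [D] to [M], as the least
    submodule containing them. *)
Definition rad_image (x : M) : Prop := forall U : M -> Prop, submod U ->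
  (forall M' (h : {linear M' -> M}), D M' -> ~ bijective h -> forall y, U (h y)) -> U x.

Lemma rad_image_submod : submod rad_image.
Proof.
split=> [U hU _|a x y hx hy U hU h]; first by case: hU.
by apply: hU.2; [exact: hx | exact: hy].
Qed.

Lemma rad_image_in M' (h : {linear M' -> M}) y : D M' -> ~ bijective h -> rad_image (h y).
Proof. by move=> dM' nh U hU; apply. Qed.

Variables (B : fgmod R) (pi : {linear M -> B}).
Hypothesis pi_surj : surjective pi.
Hypothesis piE : forall x, pi x = 0 <-> rad_image x.

Lemma phi_factor : exists psi : {linear B -> X}, forall x, psi (pi x) = phi x.
Proof.
apply: factor_surj => // x /piE h; apply: (h (fun x => phi x = 0)); first exact: submod_ker.
exact: phi_socle.
Qed.

Lemma pi_nonzero : exists x, pi x <> 0.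
Proof.
have [x nx] := phi_nonzero; have [psi hpsi] := phi_factor.
by exists x => e; apply: nx; rewrite -hpsi e raddf0.
Qed.

(** [rad_image] is torsion, being generated by torsion modules, so that [f] lifts
    to [M]; the lift is not a non-isomorphism, since [pi] kills these. *)
Lemma map_to_B_lift M' (f : {linear M' -> B}) : D M' -> (exists x, f x <> 0) ->
  exists h : {linear M' -> M}, bijective h /\ forall x, pi (h x) = f x.
Proof.
move=> dM' [x0 nx0].
have [W [j [ij jE]]] := fg_sub fl rad_image_submod.
have tW : tors t W.
  apply/tors_char => F fF g w.
  pose U x := exists2 w, j w = x & g w = 0.
  have hU : submod U.
    split; first by exists 0; rewrite raddf0.
    move=> a _ _ [w1 <- g1] [w2 <- g2]; exists (a *: w1 + w2); rewrite linearP //.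
    by rewrite g1 g2 scaler0 addr0.
  suff [w' /ij <- //] : U (j w).
  apply: ((jE (j w)).2 (ex_intro _ w erefl)) => // M1 h d1 nh y.
  have [z|h' hh'] := factor_inj (f := h) ij; first by apply/jE; exact: rad_image_in.
  exists (h' y); first exact: hh'.
  by case: d1 => tM1 _ _; exact: (torsion_pair_hom tM1 fF (g \o h')).
have ex : exact j pi by move=> y; rewrite piE jE.
have [_ eM' _] := dM'.
have [h hh] := eM' _ _ _ j pi tW pi_surj ex f.
exists h; split=> //; apply: contrapT => nh; apply: nx0; rewrite -hh.
by apply/piE; exact: rad_image_in.
Qed.

Variable t' : torsion_pair R.
Hypothesis t'E : forall Z, tors t' Z <-> tors t Z /\ zero_hom Z B.

Lemma descend_le : torsion_pair_le t' t.
Proof. by move=> Z /t'E[]. Qed.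

(** A nonzero map from a module of [D] over [Z] to [B] lifts to an isomorphism
    onto [M], so that [phi] would factor through a map from [Z] to [X]. *)
Lemma descend_ge : torsion_pair_le u t'.
Proof.
move=> Z uZ; apply/t'E; split; first exact: ut.
move=> psi z; have [k [P [p [dP sp]]]] := tors_cover (ut uZ).
have [x <-] := sp z; apply: (direct_sum_detect (f := psi \o p) dP) => M' g dM' y /=.
apply: contrapT => ny.
have [|h [hb hh]] := map_to_B_lift (f := psi \o p \o g) dM'; first by exists y.
have [q hq] := phi_factor; have [m nm] := phi_nonzero.
have [w hw] := bij_surj hb m; apply: nm; rewrite -hw -hq hh.
exact: (torsion_pair_hom uZ uX (q \o psi)).
Qed.

Lemma descend_lt : ~ tors t' M.
Proof. by move=> /t'E[_ h]; have [x nx] := pi_nonzero; apply: nx; exact: h. Qed.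

Let remaining M' := D M' /\ ~ isomorphic M' M.

Lemma remaining_tors M' : remaining M' -> tors t' M'.
Proof.
move=> [dM' nM']; apply/t'E; split; first by case: dM'.
move=> f x; apply: contrapT => nx; apply: nM'.
by have [|h [hb _]] := map_to_B_lift (f := f) dM'; [exists x | exists h].
Qed.

(** If [M] occurs in [P], then either [K -> P -> M -> B] is zero, and the map
    [P -> M -> B] factors through [Z], which is impossible; or some module of [D]
    in [K] maps isomorphically to the summand [M], which can then be split off. *)
Lemma remove_summand k P Z : direct_sum D k P -> tors_presented t P Z -> zero_hom Z B ->
  exists k' P', direct_sum remaining k' P' /\ tors_presented t P' Z.
Proof.
elim: k P => [|k IH] P dP pres ZB.
  have [dN|[m [P' []//]]] := direct_sum_split_off M dP.
  by exists 0%N, P.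
have [dN|[m [P' [[<-] dP' [e /linear_bij_inv[e' [eK e'K]]]]]]] := direct_sum_split_off M dP.
  by exists k.+1, P.
have [K [i [p [tK sp ex]]]] := pres.
pose be : {linear P -> B} := pi \o (prod_fst M P' \o e).
case: (EM (forall y, be (i y) = 0)) => [bi0|nbi].
  have [|g hg] := factor_surj (p := p) (f := be) sp; first by move=> x /ex[y <-].
  have [x nx] := pi_nonzero; case: nx.
  by have := hg (e' (x, 0)); rewrite ZB /be /= e'K => <-.
have [l [L [c [dL sc]]]] := tors_cover tK.
have [M' [g [dM' [x nx]]]] : exists M' (g : {linear M' -> L}), D M' /\ exists x, be (i (c (g x))) <> 0.
  apply: contrapT => no; apply: nbi => y; have [z <-] := sc y.
  apply: (direct_sum_detect (f := be \o i \o c) dL) => M' g dM' x.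
  by apply: contrapT => nx; apply: no; exists M', g; split=> //; exists x.
pose a : {linear M' -> P} := i \o (c \o g).
pose h : {linear M' -> M} := prod_fst M P' \o (e \o a).
have hb : bijective h.
  apply: contrapT => nh; apply: nx.
  by apply/piE; exact: (rad_image_in (h := h)).
have [h' [hK h'K]] := linear_bij_inv hb.
have pa y : p (a y) = 0 by apply/ex; exists (c (g y)).
apply: (IH P') => //.
exists K, ((prod_snd M P' \o (e \o i)) \- (prod_snd M P' \o (e \o (a \o (h' \o (prod_fst M P' \o (e \o i)))))) ),
  (p \o (e' \o prod_inr M P')); split=> //.
- move=> z; have [x' hx'] := sp z.
  exists (e (x' - a (h' (e x').1))).2 => /=.
  have e1 : (e (x' - a (h' (e x').1))).1 = 0.
    by rewrite linearB /= -[X in _ - X]/(h (h' (e x').1)) h'K subrr.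
  have -> : e' (0, (e (x' - a (h' (e x').1))).2) = x' - a (h' (e x').1).
    by rewrite -e1 -surjective_pairing eK.
  by rewrite linearB pa subr0 hx'.
- move=> y; split=> [/= /ex[w hw]|[w <-]] /=.
    exists w; have ew : e (i w) = (0, y) by rewrite hw e'K.
    by rewrite ew /= !raddf0 addr0.
  set v := i w - a (h' (e (i w)).1).
  have ev : e v = (0, (e (i w)).2 - (e (a (h' (e (i w)).1))).2).
    rewrite /v linearB; congr (_, _).
    by rewrite /= -[X in _ - X]/(h (h' (e (i w)).1)) h'K subrr.
  rewrite -ev eK /v linearB pa subr0; by apply/ex; exists w.
Qed.

Lemma descend_cover Z : tors t' Z ->
  exists k P, direct_sum remaining k P /\ tors_presented t P Z.
Proof.
move=> /t'E[/enough[P [tP eP pres]] ZB].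
by have [k dP] := ext_projective_direct_sum tP eP; exact: remove_summand dP pres ZB.
Qed.

Lemma remaining_ext_projective k P : direct_sum remaining k P -> ext_projective t P.
Proof. by apply: direct_sum_ext_projective => M' [[]]. Qed.

(** These are the new summands of the mutation. A lift [l : Q' -> E] of a map from
    [Y] restricts along [la] to a map from [Q] to [W]. The latter lifts to a
    presentation of [W] by sums of modules other than [M], hence extends to [Q'],
    and subtracting the extension from [l] gives a map that vanishes on [Q]. *)
Lemma coker_ext_projective Q Q' Y (la : {linear Q -> Q'}) (y : {linear Q' -> Y}) k :
  ext_projective t Q -> direct_sum remaining k Q' ->
  (forall m P (f : {linear Q -> P}), direct_sum remaining m P -> factors la f) ->
  surjective y -> exact la y -> ext_projective t' Y.
Proof.
move=> eQ dQ' lap sy exy W E V i g tW sg ex f.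
have [W0 [j [ij jE]]] := fg_sub fl (submod_range i).
have tW0 : tors t' W0.
  have [w|i' hi'] := factor_inj (f := i) ij; first by apply/jE; exists w.
  apply: (tors_surj (p := i')) tW => w; have [v hv] := (jE (j w)).2 (ex_intro _ w erefl).
  by exists v; apply: ij; rewrite hi'.
have [l hl] := remaining_ext_projective dQ' (descend_le tW) sg ex (f \o y).
have [x|al hal] := factor_inj (f := l \o la) ij.
  apply/jE/ex; rewrite /= hl /=.
  by have -> : y (la x) = 0; [apply/exy; exists x | rewrite raddf0].
have [m [P0 [dP0 [K0 [i0 [p0 [tK0 sp0 ex0]]]]]]] := descend_cover tW0.
have [al' hal'] := eQ _ _ _ i0 p0 tK0 sp0 ex0 al.
have [be hbe] := lap _ _ al' dP0.
have [|h hh] := factor_surj (p := y) (f := l \- (j \o (p0 \o be))) sy.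
  by move=> q /exy[x <-] /=; rewrite -hbe hal' hal subrr.
exists h => z; have [q <-] := sy z; rewrite hh /= linearB hl.
have -> : g (j (p0 (be q))) = 0 by apply/ex/jE; eexists.
by rewrite subr0.
Qed.

(** Let [K -> P -> Z] be a torsion presentation with [P] a sum of modules other
    than [M], let [Q -> K] be an Ext-projective cover in [t], [la : Q -> Q'] the
    left approximation and [Y] its cokernel. The composite [Q -> P] factors
    through [la], which makes [Z] a quotient of [P x Y] whose kernel is a quotient
    of [Q'], so lies in [t']. *)
Lemma descend_enough : enough_ext_projectives t'.
Proof.
move=> Z tZ; have [k [P [dP [K [i [z [tK sz ex]]]]]]] := descend_cover tZ.
have [Q [tQ eQ [K1 [i1 [q [tK1 sq ex1]]]]]] := enough tK.
have DNiso M1 M2 : isomorphic M1 M2 -> remaining M1 -> remaining M2.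
  move=> e [[tM eM iM] nM]; split; first split.
  - exact: tors_iso e tM.
  - exact: ext_projective_iso e eM.
  - split=> [z0|X1 X2 e']; last by apply: iM.2; exact: iso_trans e e'.
    by apply: iM.1; case: e => f /bij_inj fi x; apply: (inj0 fi); exact: z0.
  - by move=> e2; apply: nM; exact: iso_trans e e2.
have DNfin M1 : remaining M1 -> exists i, isomorphic M1 (s i) by case=> /Dfin.
have [m [Q' [la [dQ' lap]]]] := left_approximation DNiso DNfin Q.
have [Y [y [sy yE]]] := fg_quot (submod_range la).
have [ga hga] := lap _ _ (i \o q) dP.
have exy : exact la y by [].
have tN m' N : direct_sum remaining m' N -> tors t' N by apply: direct_sum_tors; exact: remaining_tors.
have [|ze hze] := factor_surj (p := y) (f := z \o ga) sy.
  by move=> x /exy[w <-] /=; rewrite -hga; apply/ex; eexists.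
exists (prod_fg P Y); split.
- by apply: tors_prod; [exact: tN dP | exact: tors_surj sy (tN _ _ dQ')].
- apply: ext_projective_prod; last exact: coker_ext_projective eQ dQ' lap sy exy.
  exact: ext_projective_le descend_le (remaining_ext_projective dP).
exists Q', (prod_pair ga y), (prod_copair z (\0 \- ze)); split; first exact: tN dQ'.
- by move=> w; have [x <-] := sz w; exists (x, 0); rewrite /= raddf0 subr0 addr0.
case=> x w; split=> [/= e|[q' [<- <-]]] /=; last by rewrite hze sub0r subrr.
have [q' hq'] := sy w; rewrite -hq' hze sub0r /= -linearB in e.
have /ex[v hv] := e; have [v' hv'] := sq v.
exists (q' + la v'); rewrite /=; congr (_, _).
  by rewrite linearD -hga /= hv' hv addrC subrK.
have -> : y (q' + la v') = y q' + y (la v') by rewrite linearD.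
by have -> : y (la v') = 0; [apply/exy; exists v' | rewrite addr0 hq'].
Qed.

End Descend.

(** Take [X] torsion for [t] and torsion-free for [u], and [phi : M -> X] as in
    [socle_map]. With [B] the quotient of [M] by the images of the
    non-isomorphisms into [M], the modules of [t] without nonzero map to [B] form
    the new torsion class. *)
Lemma descend n (s : 'I_n -> fgmod R) t u : enough_ext_projectives t ->
  (forall M, ext_projective_indecomposable t M -> exists i, isomorphic M (s i)) ->
  torsion_pair_le u t -> ~ torsion_pair_le t u ->
  exists t', [/\ enough_ext_projectives t', torsion_pair_le u t', torsion_pair_le t' t &
    exists i, tors t (s i) /\ ~ tors t' (s i)].
Proof.
move=> enough Dfin ut ntu.
have [Y [tY nuY]] : exists Y, tors t Y /\ ~ tors u Y.
  apply: contrapT => no; apply: ntu => Y tY; apply: contrapT => nY; apply: no; by exists Y.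
have [A [X [i [p [uA uX ii sp ex]]]]] := torsion_pair_ses u Y.
have tX : tors t X by exact: tors_surj sp tY.
have nX : ~ zero_module X.
  move=> X0; apply: nuY; apply: (tors_surj (p := i)) uA => y.
  by apply/ex; rewrite (X0 (p y)).
have [b hb] := indecomposable_length_bound Dfin.
have [|M [phi [dM nz soc]]] := socle_map (X := X) hb.
  have [k [P [c [dP sc]]]] := tors_cover enough tX.
  apply: contrapT => no; apply: nX => x; have [z <-] := sc x.
  apply: (direct_sum_detect dP) => M g dM y; apply: contrapT => ny.
  by apply: no; exists M, (c \o g), y.
have [B [pi [spi piE]]] := fg_quot (@rad_image_submod t M).
have [|||t' ht'] := torsion_pair_of_class fl (C := fun Z => tors t Z /\ zero_hom Z B).
- move=> Z Z' f sf [h1 h2]; split; first exact: tors_surj sf h1.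
  exact: zero_hom_surj sf h2.
- move=> K Z Q j q sq exq [h1 h2] [h3 h4]; split; first exact: tors_ext sq exq h1 h3.
  exact: zero_hom_extl sq exq h2 h4.
- by move=> Z Z0; split; [exact: tors0 | exact: zero_hom0l].
exists t'; split.
- exact: (descend_enough enough Dfin nz soc spi piE ht').
- exact: (descend_ge enough ut uX nz soc spi piE ht').
- exact: (descend_le ht').
have [i0 e] := Dfin _ dM; exists i0; split.
  by apply: tors_iso e _; case: dM.
by move=> h; apply: (descend_lt nz soc spi piE ht'); exact: tors_iso (iso_sym e) h.
Qed.

(** Descending from the class of all modules, every torsion class is reached; and
    a class with enough Ext-projectives is determined by the [s i] in it. *)
Lemma finitely_many_torsion_pairs n (s : 'I_n -> fgmod R) :
  (forall t M, ext_projective_indecomposable t M -> exists i, isomorphic M (s i)) ->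
  exists code : torsion_pair R -> {set 'I_n}, injective code.
Proof.
move=> Dfin.
have reach m t u : (#|[set i | `[< tors t (s i) >]]| <= m)%N ->
    enough_ext_projectives t -> torsion_pair_le u t -> enough_ext_projectives u.
  elim: m t => [|m IH] t hm et ut.
    case: (EM (torsion_pair_le t u)) => [tu|ntu].
      by rewrite (_ : u = t) //; apply: torsion_pair_ext => X; split; [exact: ut | exact: tu].
    have [t' [_ _ _ [i [ti _]]]] := descend et (Dfin t) ut ntu.
    move: hm; rewrite leqn0 cards_eq0 => /eqP/setP/(_ i); rewrite !inE.
    by move/asboolPn.
  case: (EM (torsion_pair_le t u)) => [tu|ntu].
    by rewrite (_ : u = t) //; apply: torsion_pair_ext => X; split; [exact: ut | exact: tu].
  have [t' [et' ut' t't [i [ti nt'i]]]] := descend et (Dfin t) ut ntu.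
  apply: (IH t') => //; rewrite -ltnS; apply: leq_trans hm; apply: proper_card.
  apply/properP; split.
    by apply/subsetP => k; rewrite !inE => /asboolP h; apply/asboolP; exact: t't.
  by exists i; rewrite !inE; [apply/asboolP | apply/asboolP].
have [top htop] := top_torsion_pair.
have enough u : enough_ext_projectives u.
  by apply: (reach _ top u (leqnn _)) => //; exact: top_enough_ext_projectives.
exists (fun t => [set i | `[< tors t (s i) >]]) => t u e.
have sub (v w : torsion_pair R) : [set i | `[< tors v (s i) >]] = [set i | `[< tors w (s i) >]] ->
    torsion_pair_le v w.
  move=> evw Z vZ; have [k [P [p [dP sp]]]] := tors_cover (enough v) vZ.
  apply: tors_surj sp _; apply: direct_sum_tors dP => M dM.
  have [i eM] := Dfin v M dM; apply: tors_iso (iso_sym eM) _.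
  have : i \in [set i | `[< tors w (s i) >]].
    by rewrite -evw inE; apply/asboolP; apply: tors_iso eM _; case: dM.
  by rewrite inE => /asboolP.
by apply: torsion_pair_ext => X; split; apply: sub.
Qed.

End ExtProjectives.

(** * Ext-projective modules are tau-rigid *)

Section TauRigid.
Variables (k : comPzRingType) (A : algType k).
Implicit Types (M : fgmod A) (t : torsion_pair A).

Lemma dual_basis (P : fgmod A) : projective P ->
  exists (l : nat) (y : 'I_l -> P) (w : 'I_l -> {linear P -> right_regular A}),
    forall x, x = \sum_j (w j x : A^c) *: y j.
Proof.
move=> pP; have [l [y hy]] := fgmodP P.
have [x|h hh] := projective_lift (g := free_module_map y) (f := idfun) pP.
  by have [a ->] := hy x; exists [ffun i => a i] => /=; apply: eq_bigr => i _; rewrite ffunE.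
have lin j : linear (fun x => (h x j : right_regular A)).
  by move=> a u v; rewrite linearP !ffunE.
by exists l, y, (fun j => linear_map_of (lin j)) => x; rewrite -[LHS]hh.
Qed.

(** For a map [g : P1 -> M], extend the induced map [im f -> M / g (ker f)] to
    [P0] and lift it to [h : P0 -> M]. Then [g - h f] maps onto its values on
    [ker f], so [P1] is the sum of [ker f] and [ker (g - h f)], and [g = h f] by
    minimality. *)
Lemma ext_projective_factor t M (P1 P0 : fgmod A) (f : {linear P1 -> P0}) (p : {linear P0 -> M})
    (g : {linear P1 -> M}) : tors t M -> ext_projective t M ->
  minimal_presentation f p -> exists h : {linear P0 -> M}, forall x, g x = h (f x).
Proof.
move=> tM eM [[pP1 pP0] sp ex _ minf].
have [W [pi [spi piE]]] := fg_quot (submod_image g (submod_ker f)).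
have tW : tors t W by exact: tors_surj spi tM.
pose rel : {linear P1 -> prod_fg W P0} := prod_pair (pi \o g) (\0 \- f).
have [E [q [sq qE]]] := fg_quot (submod_range rel).
have [i iE] : exists i : {linear W -> E}, forall w, i w = q (w, 0).
  by exists (q \o prod_inl W P0).
have [|gE hgE] := factor_surj (p := q) (f := p \o prod_snd W P0) sq.
  by move=> _ /qE[x <-] /=; apply/ex; exists (- x); rewrite sub0r raddfN.
have q_rel x : q (0, f x) = i (pi (g x)).
  have : q ((pi (g x), 0) - (0, f x)) = 0.
    by apply/qE; exists x; congr (_, _); rewrite /= ?subr0.
  by rewrite linearB iE => /eqP; rewrite subr_eq0 => /eqP.
have iexact : exact i gE.
  move=> e; have [[w y] <-] := sq e; rewrite hgE /=; split=> [/ex[x hx]|[w' hw']].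
    exists (w + pi (g x)).
    rewrite linearD -q_rel hx iE -[LHS](linearD q).
    by congr (q (_, _)); rewrite /= ?addr0 ?add0r.
  have := congr1 gE hw'; rewrite iE !hgE /= => <-; exact: raddf0.
have ii : injective i.
  apply: ker0_inj => w; rewrite iE => /qE[x [<- e]]; apply/piE; exists x => //.
  by move/eqP: e; rewrite sub0r oppr_eq0 => /eqP.
have sgE : surjective gE by move=> m; have [y <-] := sp m; exists (q (0, y)); rewrite hgE.
have [h0 hh0] := eM _ _ _ i gE tW sgE iexact idfun.
have [y|r hr] := factor_inj (f := (q \o prod_inr W P0) \- (h0 \o p)) ii.
  by apply/iexact; rewrite /= linearB hgE hh0 /= subrr.
have rf x : r (f x) = pi (g x).
  apply: ii; rewrite hr /= -q_rel.
  have -> : p (f x) = 0 by apply/ex; exists x.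
  by rewrite raddf0 subr0.
have [//|h hh] := projective_lift (g := pi) (f := r) pP0.
exists h => x.
have [X [iota [_ iotaE]]] := submod_object (submod_ker (g \- (h \o f))).
have /(_ x)[y hy] : surjective iota.
  apply: minf => y.
  have /piE[z fz gz] : pi (g y - h (f y)) = 0 by rewrite linearB hh rf subrr.
  have /iotaE[w hw] : (g \- (h \o f)) (y - z) = 0.
    by rewrite /= [f (y - z)]linearB fz subr0 linearB gz subKr subrr.
  by exists w; rewrite hw linearB fz subr0.
have : (g \- (h \o f)) x = 0 by apply/iotaE; exists y.
by move/eqP; rewrite /= subr_eq0 => /eqP.
Qed.

(** [Hom(M, D Tr M)] is the dual of the cokernel of
    [Hom(f, M) : Hom(P0, M) -> Hom(P1, M)]. *)
Lemma ext_projective_tau_rigid t M : tors t M -> ext_projective t M -> tau_rigid M.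
Proof.
move=> tM eM N [T [[P1 [P0 [f [p [q [pres qlin sq q0]]]]]] [E [b [_ bt bx buniq]]]]] phi m.
have [[pP1 pP0] _ _ _ _] := pres.
have b0x s : b 0 s = 0.
  have := bx 1 0 0 s; rewrite scaler0 addr0 scale1r => /eqP.
  by rewrite -subr_eq0 opprD addNKr oppr_eq0 => /eqP.
have bZ a x s : b ((a : A^c) *: x) s = b x ((a : A) *: s).
  by have := bx a x 0 s; rewrite addr0 b0x addr0.
have bD x y s : b (x + y) s = b x s + b y s.
  by have := bx 1 x y s; rewrite !scale1r.
have bsum I (r : seq I) (F : I -> N) s : b (\sum_(i <- r) F i) s = \sum_(i <- r) b (F i) s.
  by elim: r => [|i r IH]; rewrite ?big_nil ?big_cons ?b0x // bD IH.
have bDr x s s' : b x (s + s') = b x s + b x s'.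
  by have := bt x 1 s s'; rewrite !scale1r.
have b0r x : b x 0 = 0.
  have := bDr x 0 0; rewrite addr0 => /eqP.
  by rewrite -subr_eq0 opprD addNKr oppr_eq0 => /eqP.
have bsumr I (r : seq I) x (F : I -> T) : b x (\sum_(i <- r) F i) = \sum_(i <- r) b x (F i).
  by elim: r => [|i r IH]; rewrite ?big_nil ?big_cons ?b0r // bDr IH.
suff zero s : b (phi m) s = 0.
  have [|x [_ ux]] := buniq (b 0); first exact: bt.
  by rewrite -(ux 0) //; apply/esym/ux => s; rewrite zero b0x.
have qD (u v w : {linear P1 -> right_regular A}) : (forall x, (w x : A) = (u x : A) + (v x : A)) -> q w = q u + q v.
  by move=> h; rewrite -[q u]scale1r; apply: qlin => x; rewrite mul1r.
have qe (u v : {linear P1 -> right_regular A}) : (forall x, u x = v x) -> q u = q v.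
  move=> h.
  have z0 : q \0 = 0.
    have /eqP : q \0 = q \0 + q \0 by apply: qD => x /=; rewrite addr0.
    by rewrite -subr_eq0 opprD addNKr oppr_eq0 => /eqP.
  by rewrite (qD v \0 u) ?z0 ?addr0 // => x; rewrite h /= addr0.
have q_zero : q \0 = 0.
  have /eqP : q \0 = q \0 + q \0 by apply: qD => x /=; rewrite addr0.
  by rewrite -subr_eq0 opprD addNKr oppr_eq0 => /eqP.
have qsum I (r : seq I) (a : I -> A) (w : I -> {linear P1 -> right_regular A})
    (u : {linear P1 -> right_regular A}) :
    (forall x, (u x : A) = \sum_(j <- r) a j * (w j x : A)) ->
    q u = \sum_(j <- r) a j *: q (w j).
  elim: r u => [|j r IH] u hu.
    by rewrite big_nil -q_zero; apply: qe => x; rewrite hu big_nil.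
  pose F (x : P1) : A := \sum_(j <- r) a j * (w j x : A).
  have lin : linear (F : P1 -> right_regular A).
    move=> c x y; transitivity (F x * (c : A) + F y) => //.
    rewrite /F mulr_suml -big_split /=; apply: eq_bigr => i _.
    transitivity (a i * ((w i x : A) * (c : A) + (w i y : A))).
      by congr (a i * _); exact: linearP.
    by rewrite mulrDr mulrA.
  rewrite big_cons -(IH (linear_map_of lin)) //.
  by apply: qlin => x; rewrite hu big_cons.
have [l [y [w hy]]] := dual_basis pP1.
have [l' [z [v hz]]] := dual_basis pP0.
have qE u : q u = \sum_j (u (y j) : A) *: q (w j).
  apply: qsum => x; rewrite {1}(hy x) linear_sum; apply: eq_bigr => j _.
  by rewrite linearZ.
have [u <-] := sq s.
have ling : linear (fun x => (u x : A^c) *: m).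
  by move=> c x x'; rewrite linearP scalerDl -scalerA.
have [h hh] := ext_projective_factor (linear_map_of ling) tM eM pres.
have step1 : b (phi m) (q u) = \sum_j b (phi (h (f (y j)))) (q (w j)).
  rewrite qE bsumr; apply: eq_bigr => j _.
  by rewrite -bZ -linearZ -hh.
have step2 : \sum_j b (phi (h (f (y j)))) (q (w j)) =
    \sum_i b (phi (h (z i))) (q (v i \o f)).
  under [RHS]eq_bigr do rewrite qE bsumr.
  rewrite [RHS]exchange_big /=; apply: eq_bigr => j _.
  rewrite {1}(hz (f (y j))) !linear_sum bsum; apply: eq_bigr => i _.
  by rewrite !linearZ bZ.
rewrite step1 step2 big1 // => i _.
by rewrite (q0 (v i \o f)).2 ?b0r //; exists (v i).
Qed.

End TauRigid.

(** * Omega-torsion pairs *)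

Local Close Scope ring_scope.

Theorem corollary2p6 (k : comPzRingType) (A : algType k)
    (hA : artin_algebra A) (n : nat) (hn : 1 <= n) :
  [/\ is_complete_sublattice (@torsion_pair_le A) (@omega_torsion_pair A n),
      forall d : nat, has_global_dimension A d ->
        is_complete_sublattice (@torsion_pair_le A)
          (@s_torsion_pair A (@ext_zero A d)),
      completely_semidistributive (@omega_le A n)
    & tau_tilting_finite A -> congruence_uniform (@omega_le A n)].
Proof.
have fl : finite_length_ring A by move=> X; exact: artin_algebra_finite_length.
have hf : hom_fg_ring A by move=> X Y; exact: artin_algebra_hom_fg.
have sub m : is_complete_sublattice (@torsion_pair_le A) (@omega_torsion_pair A m.+1).
  by apply: orthogonal_complete_sublattice; [exact: fl | exact: ext_zero_half_exact].
case: n hn => // n _; split.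
- exact: sub.
- case=> [|d] _; last exact: sub.
  split; first exact: torsion_pair_complete.
  have all0 t : s_torsion_pair (@ext_zero A 0) t.
    by move=> T F tT fF; apply: ext_zero0; exact: torsion_pair_hom tT fF.
  by move=> S _; split=> ? _; exact: all0.
- exact: (sub_completely_semidistributive fl (sub n)).
case=> m [s hs].
have [t M [tM eM iM]|code ci] := finitely_many_torsion_pairs fl hf (s := s).
  by apply: hs => //; exact: (ext_projective_tau_rigid tM eM).
apply: (sub_congruence_uniform fl (sub n)).
apply: (@finite_lattice_of_injective _ _ m (fun a => code (proj1_sig a))).
  exact: (sub_complete fl (sub n)).
move=> [a ha] [b hb] /= /ci e; subst b; congr exist; exact: Prop_irrelevance.
Qed.
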